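(* Let $0<\alpha\le 1/2$ and let $f_0\in H_2^\alpha\cap L^\infty$ be a probability density on $\mathbb{R}$. Let $X_1,X_2,\ldots$ be i.i.d. with density $f_0$, let $K$ be a kernel and $(h_n)$ a bandwidth sequence as described in the context, and let $$T_n(h_n)=\frac{2}{n(n-1)h_n}\sum_{1\le i<j\le n}K\Big(\frac{X_i-X_j}{h_n}\Big),\qquad n\ge 2.$$ I. For all $R,L>0$ there are constants $c_1(R),c_2(R)$, depending only on $R$ and the function $K$, such that $$\sup_{f_0\in\mathcal H_\alpha(R)}\Big|E\,T_n(h_n)-\int_{\mathbb{R}}f_0^2(x)\,dx\Big|\le B(h_n):=c_1(R)\,h_n^{2\alpha}$$ and $$\sup_{f_0\in\mathcal H_\alpha(R)\cap\mathcal B(L)}E\Big(T_n(h_n)-E\,T_n(h_n)-\frac1n\sum_{i=1}^nY_i\Big)^2\le c_2^2(R)\,\sigma^2(h_n,n):=c_2^2(R)\Big(\frac{1}{n^2h_n}\vee\frac{L\,h_n^{2\alpha}}{n}\Big),$$ where $Y_i=2\big(f_0(X_i)-\int_{\mathbb{R}}f_0^2\big)$. II. As a consequence, if $h_n\approx n^{-2/(4\alpha+1)}$, then, as $n\to\infty$: (a) if $0<\alpha\le 1/4$, then $$T_n(h_n)-\int_{\mathbb{R}}f_0(x)^2\,dx=O_P\big(n^{-4\alpha/(4\alpha+1)}\big);$$ (b) if $\alpha>1/4$, and if $\tau^2=\int_{\mathbb{R}}f_0^3-\big(\int_{\mathbb{R}}f_0^2\big)^2$, then $$\sqrt n\Big(T_n(h_n)-\int_{\mathbb{R}}f_0(x)^2\,dx\Big)\to_d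 Z\sim N(0,4\tau^2).$$
   Context: $L^p=L^p(\mathbb{R})$ with respect to Lebesgue measure, with norm $\|\cdot\|_p$. The Fourier transform is $F\phi(u)=\int_{\mathbb{R}}e^{-ixu}\phi(x)\,dx$ for $\phi\in L^1$, extended continuously to $L^2$. For $\alpha>0$, $H_2^\alpha=\{\phi\in L^2:\|\phi\|_{2,\alpha}:=\|F\phi(\cdot)(1+|\cdot|^2)^{\alpha/2}\|_2<\infty\}$. For $R,L>0$: $\mathcal H_\alpha(R)=\{\phi:\|\phi\|_{2,\alpha}\le R\}$ and $\mathcal B(L)=\{\phi:\|\phi\|_\infty\le L\}$. In the suprema, $f_0$ ranges over bounded probability densities on $\mathbb{R}$ in the indicated sets, and $E$ is expectation when the $X_i$ are i.i.d. with density $f_0$. Kernel: $K:\mathbb{R}\to\mathbb{R}$ is a (measurable) symmetric bounded function with $\int K(u)\,du=1$ and $\int|K(u)||u|\,du<\infty$. Bandwidths: $h_n>0$ and $h_n\to0$ as $n\to\infty$. $a\vee b=\max(a,b)$. $a_n\approx b_n$ means that $a_n/b_n$ is bounded away from $0$ and from $\infty$. $\to_d$ denotes convergence in distribution and $O_P$ denotes stochastic boundedness, for fixed $f_0$. $N(0,0)$ is the point mass at $0$. *)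

(* Defs.v *)
From HB Require Import structures.
From mathcomp Require Import all_boot all_order all_algebra.
From mathcomp Require Import finmap complex.
From mathcomp Require Import all_classical all_reals all_analysis.

Set Implicit Arguments.
Unset Strict Implicit.
Unset Printing Implicit Defensive.

Import Order.TTheory GRing.Theory Num.Theory.
Import numFieldNormedType.Exports.

Local Open Scope classical_set_scope.
Local Open Scope ring_scope.

Notation leb := lebesgue_measure.

(* [Re (e^(-ixu)) = cos (xu)] and [Im (e^(-ixu)) = - sin (xu)]; integrals of
   complex-valued functions are taken componentwise. *)
Definition fourier_L1 (R : realType) (phi : R -> R) (u : R) : R[i] :=
  Complex (\int[leb]_x (cos (x * u) * phi x))
          (\int[leb]_x (- sin (x * u) * phi x)).

(* The L^2 seminorm of a complex-valued function, given by the modulus. *)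
Definition normC2 (R : realType) (g : R -> R[i]) : \bar R :=
  Lnorm leb 2%:E (fun u => (Normc.normc (g u))%:E).

(* [g] is a value at [phi] of the continuous extension of the Fourier transform
   from L^1 /\ L^2 to L^2; [g] is determined almost everywhere. *)
Definition is_fourier_L2 (R : realType) (phi : R -> R) (g : R -> R[i]) : Prop :=
  [/\ measurable_fun setT (fun u => complex.Re (g u)),
      measurable_fun setT (fun u => complex.Im (g u)) &
      exists phi_ : nat -> R -> R,
        [/\ forall k, phi_ k \in Lfun leb 1 /\ phi_ k \in Lfun leb 2%:E,
            Lnorm leb 2%:E (fun x => (phi_ k x - phi x)%:E)
              @[k --> \oo] --> 0%E &
            normC2 (fun u => fourier_L1 (phi_ k) u - g u) @[k --> \oo] --> 0%E]].

Definition fourier (R : realType) (phi : R -> R) : R -> R[i] :=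
  if phi \in Lfun leb 1 then fourier_L1 phi
  else xget (fun=> 0) [set g | is_fourier_L2 phi g].

Definition sobolev_norm (R : realType) (alpha : R) (phi : R -> R) : \bar R :=
  Lnorm leb 2%:E (fun u =>
    (Normc.normc (fourier phi u) * (1 + u ^+ 2) `^ (alpha / 2))%:E).

Definition sobolev (R : realType) (alpha : R) : set (R -> R) :=
  [set phi | phi \in Lfun leb 2%:E /\ (sobolev_norm alpha phi < +oo)%E].

Definition sobolev_ball (R : realType) (alpha r : R) : set (R -> R) :=
  [set phi | sobolev alpha phi /\ (sobolev_norm alpha phi <= r%:E)%E].

Definition sup_ball (R : realType) (L : R) : set (R -> R) :=
  [set phi | phi \in Lfun leb +oo%E /\
             (Lnorm leb +oo%E (EFin \o phi) <= L%:E)%E].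

Definition is_density (R : realType) (f : R -> R) : Prop :=
  [/\ measurable_fun setT f, forall x, 0 <= f x
    & (\int[leb]_x (f x)%:E = 1)%E].

(* An extended-real integral equal to 1 forces integrability. *)
Definition is_kernel (R : realType) (K : R -> R) : Prop :=
  [/\ measurable_fun setT K,
      forall u, K (- u) = K u,
      exists M : R, forall u, `|K u| <= M,
      (\int[leb]_u (K u)%:E = 1)%E
    & (\int[leb]_u (`|K u| * `|u|)%:E < +oo)%E].

Definition is_bandwidth (R : realType) (h : nat -> R) : Prop :=
  (forall n, 0 < h n) /\ h @ \oo --> 0.

(* [a_n / b_n] is bounded away from 0 and infinity; the finitely many
   exceptions make the values of the sequences at [n = 0] irrelevant. *)
Definition same_order (R : realType) (a b : nat -> R) : Prop :=
  exists c C : R, [/\ 0 < c, 0 < C & \forall n \near \oo, c <= a n / b n <= C].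

Definition mutually_independent (R : realType) (d : measure_display)
    (Omega : measurableType d) (P : probability Omega R)
    (X : nat -> {RV P >-> R}) : Prop :=
  forall (J : {fset nat}) (A : nat -> set R), (forall j, measurable (A j)) ->
    P (\bigcap_(j in [set` J]) (X j @^-1` A j)) =
    (\prod_(j <- J) P (X j @^-1` A j))%E.

Definition has_density (R : realType) (d : measure_display)
    (Omega : measurableType d) (P : probability Omega R)
    (X : {RV P >-> R}) (f : R -> R) : Prop :=
  forall A : set R, measurable A ->
    distribution P X A = (\int[leb]_(x in A) (f x)%:E)%E.

Definition iid_with_density (R : realType) (d : measure_display)
    (Omega : measurableType d) (P : probability Omega R)
    (X : nat -> {RV P >-> R}) (f : R -> R) : Prop :=
  mutually_independent X /\ forall i, has_density (X i) f.

(* The sample [X_1, ..., X_n] is [X 0, ..., X n.-1]. *)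
Definition T_stat (R : realType) (d : measure_display)
    (Omega : measurableType d) (P : probability Omega R)
    (X : nat -> {RV P >-> R}) (K : R -> R) (h : R) (n : nat) (w : Omega) : R :=
  2 / (n%:R * (n%:R - 1) * h) *
  \sum_(i < n) \sum_(j < n | (i < j)%N) K ((X i w - X j w) / h).

Definition int_sq (R : realType) (f : R -> R) : R := \int[leb]_x (f x ^+ 2).

Definition Y_var (R : realType) (d : measure_display)
    (Omega : measurableType d) (P : probability Omega R)
    (X : nat -> {RV P >-> R}) (f : R -> R) (i : nat) (w : Omega) : R :=
  2 * (f (X i w) - int_sq f).

Definition bigO_P (R : realType) (d : measure_display)
    (Omega : measurableType d) (P : probability Omega R)
    (Z : nat -> Omega -> R) (r : nat -> R) : Prop :=
  forall e : R, 0 < e -> exists M : R,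
    \forall n \near \oo, (P [set w | (M * r n < `|Z n w|)%R] <= e%:E)%E.

Definition cvg_in_distribution (R : realType) (d : measure_display)
    (Omega : measurableType d) (P : probability Omega R)
    (Z : nat -> Omega -> R) (m : probability (measurableTypeR R) R) : Prop :=
  forall g : R -> R, continuous g -> (exists M : R, forall x, `|g x| <= M) ->
    'E_P[g \o Z n]%E @[n --> \oo] --> (\int[m]_x (g x)%:E)%E.

(* Normal law with mean [m] and variance [v]. [normal_prob] takes the standard
   deviation, and at standard deviation 0 it is not the point mass. *)
Definition gaussian (R : realType) (m v : R) :
    probability (measurableTypeR R) R :=
  if v == 0
  then (@dirac _ (measurableTypeR R) m R : probability (measurableTypeR R) R)
  else (normal_prob m (Num.sqrt v) : probability (measurableTypeR R) R).

(* Main.v *)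
(* With D(t) = \int (f(x+t) - f(x))^2 dx, the bias of T_n is -1/2 \int K(v) D(hv) dv.
   Hoeffding's decomposition writes T_n - E T_n - (1/n) \sum Y_i as a degenerate
   U-statistic, whose second moment is at most 2 E k^2 / (n (n-1)) with
   k = K((X_1 - X_2)/h)/h, plus a centred i.i.d. mean of 2 (K_h * f - f)(X_i), whose
   variance is controlled by \int |K(v)| D(hv) dv. Both halves of part I thus
   reduce to D(t) <= C r^2 |t|^(2 alpha) and \int f^2 <= C r^2. These follow from
   the inequality \int g^2 <= C \int |Fg|^2 for bounded integrable g: weight |Fg|^2
   by the triangle function at scale 1/n, apply Fubini, and let n tend to
   infinity; the transform of the triangle is an integrable nonnegative
   (Fejer) kernel.

   In part II the bandwidth makes bias and remainder O(n^(-4 alpha/(4 alpha+1))) in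
   mean square. For alpha <= 1/4 this dominates n^(-1/2), and Chebyshev's inequality
   concludes. For alpha > 1/4 it is o(n^(-1/2)), so the limit is that of
   n^(-1/2) \sum Y_i. By Taylor's formula E cos(a S_n + b) is multiplied at each step by
   exp(-a^2 v/2) up to O(|a|^3), whence the convergence of the characteristic
   functions; convergence in distribution follows by smoothing compactly
   supported functions with the Fejer kernel. *)

Require Import Defs.
From HB Require Import structures.
From mathcomp Require Import all_boot all_order all_algebra.
From mathcomp Require Import all_classical all_reals all_analysis.
From mathcomp Require Import measurable_realfun ess_sup_inf finmap complex ring lra.

Set Implicit Arguments.
Unset Strict Implicit.
Unset Printing Implicit Defensive.

Import Order.TTheory GRing.Theory Num.Theory.
Import numFieldNormedType.Exports.

Local Open Scope classical_set_scope.
Local Open Scope ring_scope.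

(** The constants of part I must depend neither on [alpha] nor on [L]. This rests on two crude
    bounds valid for all [alpha] in []0, 1/2]]: [2 - 2 cos w <= 4 |w|^(2 alpha)] and
    [|v|^(2 alpha) <= 1 + |v|]; the second is where the first moment of the kernel enters. The bias
    is of order [h^(2 alpha)], twice the smoothness, because [\int f(x) f(x+t) dx] differs from
    [\int f^2] by half of [D(t)], which is already quadratic. The density is bounded only almost
    everywhere. It is replaced by its minimum with an essential bound, which changes no law,
    integral or Sobolev norm; the integrands then become bounded factors times integrable ones, and
    real-valued integrals can be used throughout. Independence is given as a product formula on
    finite families of events. It is used in one form only: the first n variables are packed in one
    random element V, and V together with the next variable has a product law. The second moments
    and the characteristic function are computed by induction on n, integrating out the last
    variable. *)

Notation integ mu f := (integrable mu setT (EFin \o f)).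

(** * Integrals of real-valued functions *)

Section toolbox.
Context d {T : measurableType d} {R : realType}.
Variable mu : {measure set T -> \bar R}.
Implicit Types f g : T -> R.

Lemma integ_mfun f : integ mu f -> measurable_fun setT f.
Proof. by move/measurable_int/measurable_EFinP. Qed.

Lemma integD f g : integ mu f -> integ mu g -> integ mu (fun x => f x + g x).
Proof.
move=> hf hg; have := integrableD measurableT hf hg.
by apply: eq_integrable => // x _ /=.
Qed.

Lemma integB f g : integ mu f -> integ mu g -> integ mu (fun x => f x - g x).
Proof.
move=> hf hg; have := integrableB measurableT hf hg.
by apply: eq_integrable => // x _ /=.
Qed.

Lemma integZ (k : R) f : integ mu f -> integ mu (fun x => k * f x).
Proof.
move=> hf; have := integrableZl measurableT k hf.
by apply: eq_integrable => // x _ /=.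
Qed.

Lemma integ_norm f : integ mu f -> integ mu (fun x => `|f x|).
Proof. by move/integrable_norm. Qed.

Lemma integ_le f g : measurable_fun setT f -> integ mu g ->
  (forall x, `|f x| <= g x) -> integ mu f.
Proof.
move=> mf hg fg; apply: le_integrable hg => //.
  exact/measurable_EFinP.
by move=> x _ /=; rewrite lee_fin (le_trans (fg x))// ler_norm.
Qed.

Lemma integMb (c : R) f g : integ mu f -> measurable_fun setT g ->
  (forall x, `|g x| <= c) -> integ mu (fun x => g x * f x).
Proof.
move=> hf mg gc; apply: (@integ_le _ (fun x => c * `|f x|)).
- by apply: measurable_funM => //; exact: integ_mfun.
- exact/integZ/integ_norm.
- by move=> x; rewrite normrM ler_wpM2r.
Qed.

Lemma integ_eq f g : f =1 g -> integ mu f -> integ mu g.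
Proof. by move=> fg; apply: eq_integrable => // x _ /=; rewrite fg. Qed.

Lemma integbM (c : R) f g : integ mu f -> measurable_fun setT g ->
  (forall x, `|g x| <= c) -> integ mu (fun x => f x * g x).
Proof.
move=> hf mg gc; apply: integ_eq (integMb hf mg gc) => x.
by rewrite mulrC.
Qed.

Lemma integ_sum (I : Type) (s : seq I) (P : pred I) (F : I -> T -> R) :
  (forall i, integ mu (F i)) -> integ mu (fun x => \sum_(i <- s | P i) F i x).
Proof.
move=> hF; have := @integrable_sum _ _ _ mu setT measurableT I s P (fun i x => (F i x)%:E) (fun i _ => hF i).
by apply: eq_integrable => // x _ /=; rewrite sumEFin.
Qed.

Lemma Rint_sum (I : Type) (s : seq I) (P : pred I) (F : I -> T -> R) :
  (forall i, integ mu (F i)) ->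
  \int[mu]_x (\sum_(i <- s | P i) F i x) = \sum_(i <- s | P i) \int[mu]_x F i x.
Proof.
move=> hF; elim: s => [|i s IH].
  under eq_Rintegral do rewrite big_nil.
  by rewrite Rintegral_cst // mul0r big_nil.
rewrite big_cons -IH; case: ifPn => Pi.
  by rewrite -RintegralD //; [|exact: integ_sum]; apply: eq_Rintegral => x _; rewrite big_cons Pi.
by apply: eq_Rintegral => x _; rewrite big_cons (negbTE Pi).
Qed.

Lemma RintD f g : integ mu f -> integ mu g ->
  \int[mu]_x (f x + g x) = \int[mu]_x f x + \int[mu]_x g x.
Proof. exact: RintegralD. Qed.

Lemma RintB f g : integ mu f -> integ mu g ->
  \int[mu]_x (f x - g x) = \int[mu]_x f x - \int[mu]_x g x.
Proof. exact: RintegralB. Qed.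

Lemma RintZ (k : R) f : integ mu f -> \int[mu]_x (k * f x) = k * \int[mu]_x f x.
Proof. by move=> hf; rewrite RintegralZl. Qed.

Lemma Rint_le f g : integ mu f -> integ mu g -> (forall x, f x <= g x) ->
  \int[mu]_x f x <= \int[mu]_x g x.
Proof. by move=> hf hg fg; apply: le_Rintegral. Qed.

Lemma Rint_norm f : integ mu f -> `|\int[mu]_x f x| <= \int[mu]_x `|f x|.
Proof. by move=> hf; apply: le_normr_Rintegral. Qed.

Lemma Rint_norm_le f g : integ mu f -> integ mu g -> (forall x, `|f x| <= g x) ->
  `|\int[mu]_x f x| <= \int[mu]_x g x.
Proof.
move=> hf hg fg; apply: le_trans (Rint_norm hf) _.
by apply: Rint_le => //; exact: integ_norm.
Qed.

Lemma Rint_EFin f : integ mu f -> (\int[mu]_x (f x)%:E)%E = (\int[mu]_x f x)%:E.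
Proof. by move=> hf; rewrite /Rintegral fineK //; exact: integrable_fin_num. Qed.

Lemma integ_ge0 f : measurable_fun setT f -> (forall x, 0 <= f x) ->
  (\int[mu]_x (f x)%:E < +oo)%E -> integ mu f.
Proof.
move=> mf f0 fy; apply/integrableP; split; first exact/measurable_EFinP.
by under eq_integral => x _ do rewrite /= ger0_norm //.
Qed.

Lemma dominated_Rint (F : nat -> T -> R) f g :
  (forall n, measurable_fun setT (F n)) -> measurable_fun setT f -> integ mu g ->
  (forall x, F n x @[n --> \oo] --> f x) ->
  (forall n x, `|F n x| <= g x) ->
  \int[mu]_x F n x @[n --> \oo] --> \int[mu]_x f x.
Proof.
move=> mF mf ig Ff Fg.
have [] := @dominated_convergence _ T R mu setT measurableT
  (fun n x => (F n x)%:E) (fun x => (f x)%:E) (fun x => (g x)%:E) _ _ _ ig _.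
- by move=> n; exact/measurable_EFinP.
- exact/measurable_EFinP.
- by apply: aeW => x _; apply/fine_cvgP; split; [exact: nearW|exact: Ff].
- by apply: aeW => x n _; rewrite lee_fin.
move=> hf _; rewrite (Rint_EFin hf) => /fine_cvgP[_].
exact: cvg_trans.
Qed.

End toolbox.

(** * Fubini's theorem for real-valued iterated integrals *)

Section fubini.
Context d1 d2 {T1 : measurableType d1} {T2 : measurableType d2} {R : realType}.
Variables (m1 : {sigma_finite_measure set T1 -> \bar R})
          (m2 : {sigma_finite_measure set T2 -> \bar R}).
Implicit Types F : T1 * T2 -> R.

(** The inner integral is the finite part of the extended one, hence 0 where that is infinite. In
    absolute value it is at most the extended one everywhere, and it equals it almost everywhere;
    this transfers Fubini's theorem to real integrals. *)
Lemma integ_fubini1 F : integ (m1 \x m2)%E F ->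
  integ m1 (fun x => \int[m2]_y F (x, y)).
Proof.
move=> hF; have h := integrable_fubini_F hF.
apply/integrableP; split.
  apply/measurable_EFinP; apply: measurableT_comp => //.
  exact: (measurable_int _ h).
move/integrableP : h => [mh]; apply: le_lt_trans.
apply: ge0_le_integral => //=.
- by do 3 apply: measurableT_comp => //.
- exact: measurableT_comp.
move=> x _; rewrite /fubini_F /Rintegral.
by case: (\int[m2]_y _)%E => [r||] //=; rewrite normr0 ?leey.
Qed.

Lemma Rint_fubini1 F : integ (m1 \x m2)%E F ->
  \int[m1]_x \int[m2]_y F (x, y) = \int[(m1 \x m2)%E]_z F z.
Proof.
move=> hF; rewrite /Rintegral -(integral12_prod_meas1 hF); congr fine.
have hh := integrable_fubini_F hF.
apply: ae_eq_integral => //.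
- by have /integ_fubini1/measurable_int := hF.
- exact: (measurable_int _ hh).
have := integrable_ae measurableT hh.
by apply: filterS => x /= + _ => /(_ I) xfin; rewrite fineK.
Qed.

Lemma integ_fubini2 F : integ (m1 \x m2)%E F ->
  integ m2 (fun y => \int[m1]_x F (x, y)).
Proof.
move=> hF.
have h : m2.-integrable setT (fun y => \int[m1]_x (F (x, y))%:E)%E.
  have mF := measurable_int _ hF.
  apply/integrableP; split; first exact: measurable_fubini_G hF.
  apply: le_lt_trans ((integrable21ltyP m1 m2 mF).1 hF).
  apply: ge0_le_integral => //.
  - by apply: measurableT_comp => //; exact: measurable_fubini_G hF.
  - apply: (@measurable_fun_fubini_tonelli_G _ _ _ _ _ m1 (fun z => `|(F z)%:E|%E)).
      by apply: measurableT_comp.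
    by [].
  - move=> y _; apply: le_abse_integral => //.
    exact: (measurableT_comp mF).
apply/integrableP; split.
  apply/measurable_EFinP; apply: measurableT_comp => //.
  exact: (measurable_int _ h).
move/integrableP : h => [mh]; apply: le_lt_trans.
apply: ge0_le_integral => //=.
- by do 3 apply: measurableT_comp => //.
- exact: measurableT_comp.
move=> x _; rewrite /Rintegral.
by case: (\int[m1]_y _)%E => [r||] //=; rewrite normr0 ?leey.
Qed.

Lemma Rint_fubini2 F : integ (m1 \x m2)%E F ->
  \int[m2]_y \int[m1]_x F (x, y) = \int[(m1 \x m2)%E]_z F z.
Proof.
move=> hF; rewrite /Rintegral -(integral21_prod_meas1 hF); congr fine.
apply: ae_eq_integral => //.
- by have /integ_fubini2/measurable_int := hF.
- exact: measurable_fubini_G hF.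
have := ae_integrable2 hF.
apply: filterS => y /= hy _; rewrite fineK //.
exact: (integrable_fin_num measurableT hy).
Qed.

Lemma Rint_swap F : integ (m1 \x m2)%E F ->
  \int[m1]_x \int[m2]_y F (x, y) = \int[m2]_y \int[m1]_x F (x, y).
Proof. by move=> hF; rewrite Rint_fubini1 // Rint_fubini2. Qed.

Lemma integ_tonelli F : measurable_fun setT F ->
  (forall x, integ m2 (fun y => F (x, y))) ->
  integ m1 (fun x => \int[m2]_y `|F (x, y)|) ->
  integ (m1 \x m2)%E F.
Proof.
move=> mF h2 h1; apply/integrable12ltyP; first exact/measurable_EFinP.
have -> : (fun x => \int[m2]_y `|(EFin \o F) (x, y)|)%E =
          (fun x => (\int[m2]_y `|F (x, y)|)%:E).
  by apply/funext => x; rewrite -Rint_EFin //; exact: integ_norm.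
by rewrite (Rint_EFin h1) ltry.
Qed.

(** Domination by a product of integrable functions of one variable is how joint integrability is
    checked in most exchanges of integrals below. *)
Lemma integ_prod (a : T1 -> R) (b : T2 -> R) F : measurable_fun setT F ->
  integ m1 a -> integ m2 b -> (forall x y, `|F (x, y)| <= a x * b y) ->
  integ (m1 \x m2)%E F.
Proof.
move=> mF ha hb Fab.
have h2 x : integ m2 (fun y => F (x, y)).
  apply: (@integ_le _ _ _ _ _ (fun y => a x * b y)) => //.
    exact: measurableT_comp.
  exact: integZ.
apply: integ_tonelli => //.
have mG : measurable_fun setT (fun x => \int[m2]_y `|F (x, y)|).
  apply: measurableT_comp => //.
  apply: (measurable_fun_fubini_tonelli_F (fun z => (`|F z|)%:E)) => //=.
  by apply/measurable_EFinP; exact: measurableT_comp.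
apply: (@integ_le _ _ _ _ _ (fun x => `|a x| * \int[m2]_y `|b y|)) => //.
  have := integZ (\int[m2]_y `|b y|) (integ_norm ha).
  by apply: integ_eq => x; rewrite mulrC.
move=> x; rewrite ger0_norm; last by apply: Rintegral_ge0.
rewrite -RintZ; last exact: integ_norm.
apply: Rint_le; [exact: integ_norm|exact/integZ/integ_norm|move=> y].
by apply: le_trans (Fab x y) _; rewrite -normrM ler_norm.
Qed.

End fubini.

(** * Affine changes of variable for Lebesgue measure *)

Section affine.
Context {R : realType}.
Local Notation leb := (@lebesgue_measure R).
Variables (a b : R).
Hypothesis a0 : 0 < a.

Let phi : measurableTypeR R -> measurableTypeR R := fun x => a * x + b.

Let mphi : measurable_fun setT phi.
Proof. by apply: measurable_funD => //; exact: measurable_funM. Qed.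

Let pf : {measure set (measurableTypeR R) -> \bar R}.
Proof. unshelve refine (pushforward leb phi : {measure set _ -> \bar R}). exact: mphi. Defined.

(** Lebesgue measure is characterised by its values on the intervals []c, e]], so the scaled image
    measure has to be computed only there. *)
Let leb_affine_set (A : set (measurableTypeR R)) : measurable A ->
  leb A = mscale (NngNum (ltW a0)) pf A.
Proof.
apply: lebesgue_measure_unique => _ [[c e]] _ <- /=.
rewrite /mscale/= /pf/= /pushforward.
have -> : phi @^-1` `]c, e] = `](c - b) / a, (e - b) / a]%classic.
  apply/seteqP; split => x /=; rewrite !in_itv/= /phi;
  by rewrite ltr_pdivrMr// ler_pdivlMr// ltrBlDr lerBrDr mulrC.
rewrite !lebesgue_measure_itv/= !lte_fin ltr_pM2r ?invr_gt0// ltrD2r.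
case: ifPn => ce; last by rewrite mule0.
by rewrite -!EFinB -EFinM; congr (_%:E); field; rewrite gt_eqF.
Qed.

Let ge0_affine (f : R -> \bar R) : measurable_fun setT f -> (forall x, 0 <= f x)%E ->
  (\int[leb]_x f x = a%:E * \int[leb]_x f (a * x + b)%R)%E.
Proof.
move=> mf f0.
rewrite (eq_measure_integral (mscale (NngNum (ltW a0)) pf)); last first.
  by move=> A mA _; exact: leb_affine_set.
rewrite ge0_integral_mscale //=; congr (_ * _)%E.
by rewrite ge0_integral_pushforward.
Qed.

Lemma integ_affine (f : R -> R) : integ leb f -> integ leb (fun x => f (a * x + b)).
Proof.
move=> hf; have mf := integ_mfun hf.
apply/integrableP; split.
  by apply/measurable_EFinP; exact: (measurableT_comp mf mphi).
have /integrableP[_] := hf.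
rewrite (@ge0_affine (fun x => `|(f x)%:E|)%E) //; last first.
  by apply: measurableT_comp => //; exact/measurable_EFinP.
rewrite /=; set I := (\int[leb]_x _)%E.
have : (0 <= I)%E by apply: integral_ge0.
(* If [I] were infinite, so would be [a * I], because [a > 0]. *)
case: I => [r||] _ //; first by rewrite !ltry.
by rewrite gt0_muley ?lte_fin // ltxx.
Qed.

Let ge0_Rint_affine (f : R -> R) : integ leb f -> (forall x, 0 <= f x) ->
  \int[leb]_x f (a * x + b) = a^-1 * \int[leb]_x f x.
Proof.
move=> hf f0; have := @ge0_affine (EFin \o f) (measurable_int _ hf) f0.
rewrite (Rint_EFin hf) (Rint_EFin (integ_affine hf)) -EFinM => -[->].
by rewrite mulKf // gt_eqF.
Qed.

(** The nonnegative case extends through [f = (|f| + f) - |f|], a difference of two nonnegative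
    integrable functions. *)
Lemma Rint_affine (f : R -> R) : integ leb f ->
  \int[leb]_x f (a * x + b) = a^-1 * \int[leb]_x f x.
Proof.
move=> hf; have hn := integ_norm hf; have hp := integD hn hf.
have fE g x : g x = (`|g x| + g x) - `|g x| :> R by rewrite addrAC subrr add0r.
have hna := integ_affine hn; have hpa := integ_affine hp.
under eq_Rintegral do rewrite [f _]fE.
under [in RHS]eq_Rintegral do rewrite [f _]fE.
rewrite (RintB hpa hna) (RintB hp hn) mulrBr.
rewrite (ge0_Rint_affine hn) // (ge0_Rint_affine hp) // => x.
by have := ler_norm (- f x); rewrite normrN => ?; lra.
Qed.

End affine.

Section translation.
Context {R : realType}.
Local Notation leb := (@lebesgue_measure R).

Lemma integ_shift (b : R) (f : R -> R) : integ leb f -> integ leb (fun x => f (x + b)).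
Proof.
move=> /(integ_affine b ltr01); apply: integ_eq => x.
by rewrite mul1r.
Qed.

Lemma Rint_shift (b : R) (f : R -> R) : integ leb f ->
  \int[leb]_x f (x + b) = \int[leb]_x f x.
Proof.
move=> hf; have := Rint_affine b ltr01 hf; rewrite invr1 mul1r => <-.
by apply: eq_Rintegral => x _; rewrite mul1r.
Qed.

End translation.

Section measurable_Rint.
Context d1 d2 {T1 : measurableType d1} {T2 : measurableType d2} {R : realType}.
Variable m2 : {sigma_finite_measure set T2 -> \bar R}.

Lemma measurable_Rint (F : T1 * T2 -> R) : measurable_fun setT F ->
  (forall x, integ m2 (fun y => F (x, y))) ->
  measurable_fun setT (fun x => \int[m2]_y F (x, y)).
Proof.
move=> mF iF.
have mn : measurable_fun setT (fun z => `|F z|) by exact: measurableT_comp.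
have ge0_meas (G : T1 * T2 -> R) : measurable_fun setT G -> (forall z, 0 <= G z) ->
    measurable_fun setT (fun x => \int[m2]_y G (x, y)).
  move=> mG G0; apply: measurableT_comp => //.
  apply: (@measurable_fun_fubini_tonelli_F _ _ _ _ _ m2 (EFin \o G)) => //=.
  exact/measurable_EFinP.
have -> : (fun x => \int[m2]_y F (x, y)) =
    (fun x => \int[m2]_y (`|F (x, y)| + F (x, y)) - \int[m2]_y `|F (x, y)|).
  apply/funext => x; have hn := integ_norm (iF x).
  by rewrite (RintD hn (iF x)) addrAC subrr add0r.
apply: measurable_funB; last exact: (ge0_meas (fun z => `|F z|) mn).
apply: (ge0_meas (fun z => `|F z| + F z)) => [|z]; first exact: measurable_funD.
by have := ler_norm (- F z); rewrite normrN => ?; lra.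
Qed.

End measurable_Rint.

Lemma measurable_cosR (R : realType) : measurable_fun setT (@cos R).
Proof. by apply: continuous_measurable_fun; exact: continuous_cos. Qed.

Lemma measurable_sinR (R : realType) : measurable_fun setT (@sin R).
Proof. by apply: continuous_measurable_fun; exact: continuous_sin. Qed.

(** Descends along the structure of the function. Atoms are closed by [assumption], which sees only
    the local context and instantiates nothing; hence the steps [have := mZ n => ?] before its
    calls. Differences are tried before sums because [a - b] is the sum of [a] and [- b]. *)
Ltac mea := repeat first
  [ assumption | exact: measurable_fst | exact: measurable_snd
  | exact: measurable_id | exact: measurable_cst | solve [by []]
  | exact: measurable_cosR | exact: measurable_sinR
  | match goal with
    | |- measurable_fun _ (fun _ => _ + - _) => apply: measurable_funB
    | |- measurable_fun _ (fun _ => _ + _) => apply: measurable_funD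
    | |- measurable_fun _ (fun _ => - _) => apply: measurableT_comp
    | |- measurable_fun _ (fun _ => _ * _) => apply: measurable_funM
    | |- measurable_fun _ (fun _ => _ ^+ _) => apply: measurable_funX
    | |- measurable_fun _ (fun _ => `|_|) => apply: measurableT_comp
    | |- measurable_fun _ (fun _ => (_, _)) => apply: measurable_fun_pair
    | |- measurable_fun _ (fun _ => ?f _) => apply: (measurableT_comp (f:=f))
    end ].

(** * Fourier bounds for Sobolev functions *)

Section fourier_quadratic.
Context {R : realType}.
Local Notation leb := (@lebesgue_measure R).

(* [c] stands for (x, u) |-> cos (x u) or sin (x u). *)
Lemma weighted_square_transform (c : R * R -> R) (W g : R -> R) :
  measurable_fun setT c -> (forall z, `|c z| <= 1) -> integ leb W -> integ leb g ->
  [/\ integ leb (fun u => W u * (\int[leb]_x (c (x, u) * g x)) ^+ 2),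
      measurable_fun setT (fun z : R * R => \int[leb]_u (W u * (c (z.1, u) * c (z.2, u)))),
      integ (leb \x leb)%E
        (fun z => g z.1 * g z.2 * \int[leb]_u (W u * (c (z.1, u) * c (z.2, u)))) &
      \int[leb]_u (W u * (\int[leb]_x (c (x, u) * g x)) ^+ 2) =
      \int[(leb \x leb)%E]_z
        (g z.1 * g z.2 * \int[leb]_u (W u * (c (z.1, u) * c (z.2, u))))].
Proof.
move=> mc c1 iW ig.
have mW := integ_mfun iW; have mg := integ_mfun ig.
have icg u : integ leb (fun x => c (x, u) * g x).
  by apply: (integMb (c := 1)) => //; mea.
set C := fun u => \int[leb]_x (c (x, u) * g x).
have mC : measurable_fun setT C.
  by apply: (measurable_Rint (m2 := leb) (F := fun z : R * R => c (z.2, z.1) * g z.2)) => //; mea.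
set G := \int[leb]_x `|g x|.
have C_le u : `|C u| <= G.
  apply: Rint_norm_le => // [|x]; first exact: integ_norm.
  by rewrite normrM ler_piMl.
have iWC2 : integ leb (fun u => W u * C u ^+ 2).
  apply: (integbM (c := G ^+ 2)) => //.
  - mea.
  - by move=> u; rewrite normrX lerXn2r ?nnegrE// (le_trans _ (C_le u)).
have mQ3 : measurable_fun setT
    (fun z : (R * R) * R => W z.2 * (c (z.1.1, z.2) * c (z.1.2, z.2))) by mea.
have iQ z1 z2 : integ leb (fun u => W u * (c (z1, u) * c (z2, u))).
  apply: (integbM (c := 1)) => //.
  - mea.
  - by move=> u; rewrite normrM mulr_ile1.
set Q := fun z : R * R => \int[leb]_u (W u * (c (z.1, u) * c (z.2, u))).
have mQ : measurable_fun setT Q.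
  by apply: (measurable_Rint (m2 := leb) (F := fun z : (R * R) * R => W z.2 * (c (z.1.1, z.2) * c (z.1.2, z.2)))) ; last by move=> [x y]; exact: iQ.
have Q_le z : `|Q z| <= \int[leb]_u `|W u|.
  apply: Rint_norm_le => // [|u]; first exact: integ_norm.
  by rewrite normrM ler_piMr// normrM mulr_ile1.
have iGG : integ (leb \x leb)%E (fun z => g z.1 * g z.2 * Q z).
  apply: (integ_prod (m1 := leb) (m2 := leb) (a := fun x => `|g x| * \int[leb]_u `|W u|) (b := fun x => `|g x|)).
  - mea.
  - by have := integZ (\int[leb]_u `|W u|) (integ_norm ig); apply: integ_eq => x; rewrite mulrC.
  - exact: integ_norm.
  - by move=> x y /=; rewrite !normrM mulrAC ler_wpM2r // ler_wpM2l.
split => //.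
(* The square is opened one factor at a time: one copy of [C u] stays as a bounded coefficient while
   the other is exchanged with the integral in [u]; then the remaining copy is treated in the same
   way. Integrability of [W] makes both exchanges legitimate. *)
transitivity (\int[leb]_u \int[leb]_x (W u * C u * (c (x, u) * g x))).
  by apply: eq_Rintegral => u _; rewrite RintZ // -/(C u) -mulrA -expr2.
have iWC : integ leb (fun u => W u * C u).
  exact: (integbM (c := G)).
rewrite (Rint_swap (m1 := leb) (m2 := leb) (F := fun z : R * R => W z.1 * C z.1 * (c (z.2, z.1) * g z.2))); last first.
  apply: (integ_prod (m1 := leb) (m2 := leb) (a := fun u => `|W u * C u|) (b := fun x => `|g x|)).
  - mea.
  - exact: integ_norm.
  - exact: integ_norm.
  - by move=> u x /=; rewrite [X in X <= _]normrM ler_wpM2l// normrM ler_piMl.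
rewrite -Rint_fubini1 //; apply: eq_Rintegral => x _ /=.
transitivity (g x * \int[leb]_u (W u * C u * c (x, u))).
  rewrite -RintZ; first by apply: eq_Rintegral => u _; rewrite mulrA mulrC.
  apply: (integbM (c := 1)) => //.
  mea.
transitivity (g x * \int[leb]_y (g y * Q (x, y))); last first.
  rewrite -RintZ; first by apply: eq_Rintegral => y _; rewrite mulrA.
  apply: (integbM (c := \int[leb]_u `|W u|)) => //.
  mea.
congr (_ * _).
transitivity (\int[leb]_u \int[leb]_y (W u * c (x, u) * (c (y, u) * g y))).
  by apply: eq_Rintegral => u _; rewrite RintZ // -/(C u) mulrAC.
have iWc : integ leb (fun u => W u * c (x, u)).
  apply: (integbM (c := 1)) => //.
  mea.
rewrite (Rint_swap (m1 := leb) (m2 := leb) (F := fun z : R * R => W z.1 * c (x, z.1) * (c (z.2, z.1) * g z.2))); last first.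
  apply: (integ_prod (m1 := leb) (m2 := leb) (a := fun u => `|W u * c (x, u)|) (b := fun x => `|g x|)).
  - mea.
  - exact: integ_norm.
  - exact: integ_norm.
  - by move=> u y /=; rewrite [X in X <= _]normrM ler_wpM2l// normrM ler_piMl.
apply: eq_Rintegral => y _; rewrite /Q -RintZ //; apply: eq_Rintegral => u _ /=.
by ring.
Qed.

End fourier_quadratic.

(** * The triangle function and the Fejer kernel *)

Section fejer.
Context {R : realType}.
Local Notation leb := (@lebesgue_measure R).
Local Notation I01 := (`[0, 1]%classic : set R).

(** The right half of the triangle function. As the cosine is even, it carries half of the transform
    of the whole triangle: [fejer t] is [(1 - cos t) / t^2] for nonzero [t], half of the usual
    kernel. *)
Definition tri (u : R) : R := (1 - u) * \1_I01 u.
Definition fejer (t : R) : R := \int[leb]_u (tri u * cos (u * t)).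

Lemma integ_indic01 : integ leb (\1_I01 : R -> R).
Proof. exact: integrable_indic_itv. Qed.

Lemma Rint_indic01 : \int[leb]_x (\1_I01 x : R) = 1.
Proof.
rewrite /Rintegral integral_indic// setIT.
have h : leb I01 = 1%E by rewrite lebesgue_measure_itv/= lte01 oppr0 adde0.
exact: (f_equal fine h).
Qed.

Lemma tri_ge0 u : 0 <= tri u.
Proof.
rewrite /tri indicE; case: (boolP (u \in I01)) => [|_]; last by rewrite mulr0.
by move=> /set_mem; rewrite /= in_itv/= => /andP[u0 u1]; rewrite mulr1 subr_ge0.
Qed.

Lemma tri_le u : tri u <= \1_I01 u.
Proof.
rewrite /tri indicE; case: (boolP (u \in I01)) => [|_]; last by rewrite mulr0.
by move=> /set_mem; rewrite /= in_itv/= => /andP[u0 u1]; rewrite mulr1 gerBl.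
Qed.

Lemma tri_le1 u : tri u <= 1.
Proof. by apply: le_trans (tri_le u) _; rewrite indicE; case: (u \in _). Qed.

Lemma measurable_tri : measurable_fun setT tri.
Proof. by apply: measurable_funM; [exact: measurable_funB|exact: measurable_indic]. Qed.

Lemma integ_tri : integ leb tri.
Proof.
apply: integ_le integ_indic01 _; first exact: measurable_tri.
by move=> u; rewrite ger0_norm ?tri_ge0// tri_le.
Qed.

Lemma integ_tri_cos t : integ leb (fun u => tri u * cos (u * t)).
Proof.
apply: (integbM (c := 1)); [exact: integ_tri|mea|by move=> u; exact: cos_max].
Qed.

Lemma measurable_fejer : measurable_fun setT fejer.
Proof.
have := measurable_tri => mt.
apply: (measurable_Rint (m2 := leb) (F := fun z : R * R => tri z.2 * cos (z.2 * z.1))).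
  by mea.
exact: integ_tri_cos.
Qed.

Lemma fejerN t : fejer (- t) = fejer t.
Proof. by apply: eq_Rintegral => u _; rewrite mulrN cosN. Qed.

Lemma fejerE t : t != 0 -> fejer t = (1 - cos t) / t ^+ 2.
Proof.
move=> t0.
(* Integration by parts gives this antiderivative of [(1 - u) cos (u t)]. *)
pose G u : R := (1 - u) * (sin (u * t) / t) - cos (u * t) / t ^+ 2.
have dG (u : R) : is_derive u 1 G ((1 - u) * cos (u * t)).
  rewrite /G; apply: is_derive_eq.
  rewrite /GRing.scale/=; field.
  by rewrite t0.
have cf : continuous (fun u : R => (1 - u) * cos (u * t)).
  move=> u; apply: cvgM.
    by apply: cvgB; [exact: cvg_cst|exact: cvg_id].
  apply: continuous_comp; last exact: continuous_cos.
  by apply: cvgM; [exact: cvg_id|exact: cvg_cst].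
have cG : continuous G.
  by move=> u; apply: differentiable_continuous; apply/derivable1_diffP; have [] := dG u.
have : (\int[leb]_(x in I01) ((1 - x) * cos (x * t))%:E = (G 1)%:E - (G 0)%:E)%E.
  apply: continuous_FTC2; first exact: ltr01.
  - exact: continuous_subspaceT.
  - split.
    + by move=> x _; have [] := dG x.
    + exact: cvg_at_right_filter (cG 0).
    + exact: cvg_at_left_filter (cG 1).
  - by move=> x _; rewrite derive1E; have [_ ->] := dG x.
move=> h.
rewrite /fejer -[LHS]/(fine _).
have -> : (\int[leb]_x (tri x * cos (x * t))%:E =
           \int[leb]_(x in I01) ((1 - x) * cos (x * t))%:E)%E.
  rewrite [RHS]integral_mkcond; apply: eq_integral => x _.
  rewrite /patch /tri indicE; case: ifPn => _; first by rewrite mulr1.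
  by rewrite mulr0 mul0r.
rewrite h /G /= mul1r subrr mul0r mul0r sin0 cos0 subr0 !mul0r mulr0.
by rewrite sub0r mulrBl; ring.
Qed.

Lemma fejer_ge0 t : 0 <= fejer t.
Proof.
have [->|t0] := eqVneq t 0.
  by apply: Rintegral_ge0 => u _; rewrite mulr0 cos0 mulr1 tri_ge0.
by rewrite fejerE // divr_ge0 ?sqr_ge0 // subr_ge0 cos_le1.
Qed.

Lemma fejer_le1 t : fejer t <= 1.
Proof.
rewrite -Rint_indic01; apply: Rint_le; [exact: integ_tri_cos|exact: integ_indic01|].
move=> u; apply: le_trans (tri_le u); rewrite ler_piMr ?tri_ge0 ?cos_le1 //.
Qed.

(** Adds [fejer t <= 1] and [fejer t * t^2 = 1 - cos t <= 2]; comparison with the Cauchy density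
    then yields integrability. *)
Lemma fejer_le t : fejer t <= 3 * (1 + t ^+ 2)^-1.
Proof.
rewrite -ler_pdivrMr ?invr_gt0 ?ltr_pwDl ?sqr_ge0 // invrK mulrDr mulr1.
suff : fejer t * t ^+ 2 <= 2 by have := fejer_le1 t; lra.
have [->|t0] := eqVneq t 0; first by rewrite expr0n mulr0.
rewrite fejerE // divfK ?sqrf_eq0 //.
by have := cos_geN1 t; lra.
Qed.

Lemma integ_cauchy : integ leb (fun t => (1 + t ^+ 2)^-1).
Proof.
have h := @integral0y_oneDsqr R.
apply: integ_ge0.
- apply: continuous_measurable_fun; exact: continuous_oneDsqrV.
- by move=> x; rewrite invr_ge0 addr_ge0 ?sqr_ge0.
rewrite ge0_symfun_integralT.
- by rewrite -set_itvcy h -EFinM ltry.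
- by move=> x; rewrite invr_ge0 addr_ge0 ?sqr_ge0.
- exact: continuous_oneDsqrV.
- by move=> x /=; rewrite sqrrN.
Qed.

Lemma integ_fejer : integ leb fejer.
Proof.
apply: integ_le (integZ 3 integ_cauchy) _; first exact: measurable_fejer.
by move=> t; rewrite ger0_norm ?fejer_ge0 ?fejer_le.
Qed.

(** Obtained without evaluating the integral, which is pi: for [t] and [u] in [[0, 1]] one has
    [cos (u t) >= cos 1 > 0], so [fejer >= cos 1 * \int tri] on [[0, 1]]. Positivity of [\int tri]
    is read off from [fejer 1 = 1 - cos 1]. *)
Lemma Rint_fejer_gt0 : 0 < \int[leb]_t fejer t.
Proof.
have cos1 : cos 1 < 1 :> R.
  rewrite -[ltRHS]cos0 ltr_cos ?in_itv/= ?lexx ?ler01 ?pi_ge0 //=.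
  by rewrite (le_trans _ (@pi_ge2 R)) // ler1n.
have tri0 : 0 < \int[leb]_u tri u.
  apply: (@lt_le_trans _ _ (fejer 1)).
    by rewrite fejerE ?oner_eq0 // expr1n divr1 subr_gt0.
  apply: Rint_le; [exact: integ_tri_cos|exact: integ_tri|].
  by move=> u; rewrite ler_piMr ?tri_ge0 ?cos_le1.
have c0 := @cos1_gt0 R.
apply: (@lt_le_trans _ _ (\int[leb]_t (cos 1 * (\int[leb]_u tri u) * \1_I01 t))).
  by rewrite RintZ ?Rint_indic01 ?mulr1 ?mulr_gt0 //; exact: integ_indic01.
apply: Rint_le; [exact/integZ/integ_indic01|exact: integ_fejer|].
move=> t; rewrite indicE; case: (boolP (t \in I01)) => [|_]; last by rewrite mulr0 fejer_ge0.
move=> /set_mem; rewrite /= in_itv/= mulr1 => /andP[t0 t1].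
rewrite -RintZ; last exact: integ_tri.
apply: Rint_le; [exact/integZ/integ_tri|exact: integ_tri_cos|].
move=> u; rewrite mulrC /tri indicE; case: (boolP (u \in I01)) => [|_]; last by rewrite mulr0 !mul0r.
move=> /set_mem; rewrite /= in_itv/= mulr1 => /andP[u0 u1].
rewrite ler_wpM2l ?subr_ge0 // leNgt ltr_cos ?in_itv/= ?mulr_ge0 ?ler01 //=.
- by rewrite -leNgt mulr_ile1.
- by rewrite (le_trans _ (@pi_ge2 R)) // ler1n.
- by rewrite (le_trans (mulr_ile1 u0 t0 u1 t1)) // (le_trans _ (@pi_ge2 R)) // ler1n.
Qed.

End fejer.

Lemma leb_itv_lty (R : realType) (a b : R) : (@lebesgue_measure R `[a, b]%classic < +oo)%E.
Proof. by rewrite lebesgue_measure_itv /=; case: ifP => _; rewrite ltry. Qed.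

(** * Cutoffs and continuity of translations in L^1 *)

Section cutoff.
Context {R : realType}.
Local Notation leb := (@lebesgue_measure R).

Definition cutoff (A x : R) : R := Num.max 0 (Num.min 1 (2 - `|x| / A)).

Lemma cutoff_ge0 A x : 0 <= cutoff A x.
Proof. by rewrite /cutoff le_max lexx. Qed.

Lemma cutoff_le1 A x : cutoff A x <= 1.
Proof. by rewrite /cutoff ge_max ler01 ge_min lexx. Qed.

Lemma cutoff_eq1 A x : 0 < A -> `|x| <= A -> cutoff A x = 1.
Proof.
move=> A0 xA; have xA1 : `|x| / A <= 1 by rewrite ler_pdivrMr // mul1r.
rewrite /cutoff; have /min_idPl -> : 1 <= 2 - `|x| / A by lra.
by apply/max_idPr.
Qed.

Lemma cutoff_eq0 A x : 0 < A -> 2 * A <= `|x| -> cutoff A x = 0.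
Proof.
move=> A0 xA; have xA1 : 2 <= `|x| / A by rewrite ler_pdivlMr.
by rewrite /cutoff; apply/max_idPl; rewrite ge_min; apply/orP; right; lra.
Qed.

Lemma continuous_cutoff A : continuous (cutoff A).
Proof.
move=> x; apply: (@continuous_max _ _ (fun=> 0) (fun x => Num.min 1 (2 - `|x| / A))).
  exact: cvg_cst.
apply: (@continuous_min _ _ (fun=> 1) (fun x => (2 - `|x| / A))).
  exact: cvg_cst.
apply: cvgB; first exact: cvg_cst.
by apply: cvgM; [apply: norm_continuous|exact: cvg_cst].
Qed.

Lemma compact_support_bounded (h : R -> R) (A : R) : 0 <= A -> continuous h ->
  (forall x, A <= `|x| -> h x = 0) -> exists M : R, forall x, `|h x| <= M.
Proof.
move=> A0 ch h0.
have hc : {within `[- A, A], continuous (fun x => `|h x|)}.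
  apply: continuous_subspaceT => x.
  apply: (continuous_comp (ch x)); exact: norm_continuous.
have [|c _ hM] := EVT_max _ hc; first by lra.
exists `|h c| => x.
have [xA|/ltW xA] := leP A `|x|.
  by rewrite h0 ?normr0 //.
by apply: hM; rewrite in_itv /= -ler_norml.
Qed.

Lemma integ_compact_support (h : R -> R) (A : R) : 0 <= A -> continuous h ->
  (forall x, A <= `|x| -> h x = 0) -> integ leb h.
Proof.
move=> A0 ch h0; have [M hM] := compact_support_bounded A0 ch h0.
have iM : integ leb (fun x => M * \1_(`[- A, A]%classic : set R) x).
  by apply: integZ; exact: integrable_indic_itv.
apply: integ_le iM _; first exact: continuous_measurable_fun.
move=> x; rewrite indicE; case: (boolP (x \in _)) => [_|/negP xA].
  by rewrite mulr1.
rewrite mulr0 h0 ?normr0 // leNgt; apply/negP => /ltW xA'; apply: xA.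
by apply/mem_set; rewrite /= in_itv /= -ler_norml.
Qed.

End cutoff.

Lemma le_sum_thirds (R : realFieldType) (a b c : R) : a <= c / 3 -> b <= c / 3 -> a + b + a <= c.
Proof. by move=> *; lra. Qed.

Section translation_continuity.
Context {R : realType}.
Local Notation leb := (@lebesgue_measure R).
Variable t : nat -> R.
Hypothesis t0 : t n @[n --> \oo] --> 0.

Let tcont (g : R -> R) := \int[leb]_x `|g (x + t n) - g x| @[n --> \oo] --> 0.

(** By translation invariance the translate of [g - h] has the same L^1 norm as [g - h]; this is why
    one of the terms is counted twice in [le_sum_thirds]. *)
Let tcont_approx (g : R -> R) : integ leb g ->
  (forall e : R, 0 < e -> exists h : R -> R, [/\ integ leb h, tcont h & \int[leb]_x `|g x - h x| <= e]) ->
  tcont g.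
Proof.
move=> ig H; apply/cvgrPdist_le => e e0.
have [|h [ih th gh]] := H (e / 3); first by rewrite divr_gt0.
move/cvgrPdist_le : th => /(_ (e / 3)); rewrite divr_gt0// => /(_ isT).
apply: filterS => n; rewrite !sub0r !normrN => hn.
have Ih := ler_norm (\int[leb]_x `|h (x + t n) - h x|).
rewrite ger0_norm; last by apply: Rintegral_ge0.
have igh : integ leb (fun x => `|g x - h x|) by exact/integ_norm/integB.
have := Rint_shift (t n) igh => Es.
have is1 := integ_shift (t n) igh.
have is2 : integ leb (fun x => `|h (x + t n) - h x|).
  by apply/integ_norm/integB => //; exact: integ_shift.
have : \int[leb]_x `|g (x + t n) - g x| <=
    \int[leb]_x ((`|g (x + t n) - h (x + t n)| + `|h (x + t n) - h x|) + `|g x - h x|).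
  apply: Rint_le.
  - by apply/integ_norm/integB => //; exact: integ_shift.
  - exact: integD (integD is1 is2) igh.
  - move=> x; have -> : g (x + t n) - g x = (g (x + t n) - h (x + t n)) + (h (x + t n) - h x) - (g x - h x) by ring.
    by rewrite (le_trans (ler_normB _ _)) // lerD2r ler_normD.
rewrite (RintD (integD is1 is2) igh) (RintD is1 is2) Es => /le_trans; apply.
by apply: le_sum_thirds => //; exact: le_trans Ih hn.
Qed.

Let tcont_compact (h : R -> R) (A : R) : 0 <= A -> continuous h ->
  (forall x, A <= `|x| -> h x = 0) -> tcont h.
Proof.
move=> A0 ch h0; have [M hM] := compact_support_bounded A0 ch h0.
have M0 : 0 <= M by apply: le_trans (hM 0).
have ih := integ_compact_support A0 ch h0.
have mh := continuous_measurable_fun ch.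
(* A convergent sequence is bounded, so all the translates are supported in the single interval
   [[-(A + B), A + B]], on which a constant dominates. *)
have [B tB] : exists B : R, forall n, `|t n| <= B.
  have /cvg_seq_bounded[M0' [_ HM]] : cvg (t n @[n --> \oo]) by apply/cvg_ex; exists 0.
  by exists (M0' + 1) => n; apply: HM; rewrite ?ltrDl.
rewrite /tcont -[X in _ --> X](_ : \int[leb]_x (cst 0 x) = 0); last first.
  by rewrite Rintegral_cst // mul0r.
have iM : integ leb (fun x => (M + M) * \1_(`[- (A + B), A + B]%classic : set R) x).
  by apply: integZ; exact: integrable_indic_itv.
apply: (dominated_Rint _ _ iM).
- move=> n; mea.
- exact: measurable_cst.
- move=> x; have tx : x + t n @[n --> \oo] --> x.
    by rewrite -[X in _ --> X]addr0; apply: cvgD; [exact: cvg_cst|exact: t0].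
  have hx : h (x + t n) @[n --> \oo] --> h x := cvg_comp _ _ tx (ch x).
  have h1 : h (x + t n) - h x @[n --> \oo] --> h x - h x.
    by apply: cvgB; [exact: hx|exact: cvg_cst].
  rewrite subrr in h1.
  have h3 := cvg_norm h1; rewrite normr0 in h3; rewrite /cst. exact: h3.
- move=> n x; rewrite normr_id indicE; case: (boolP (x \in _)) => [_|/negP xA].
    by rewrite mulr1 (le_trans (ler_normB _ _)) // lerD.
  have xAB : A + B <= `|x|.
    rewrite leNgt; apply/negP => /ltW xA'; apply: xA.
    by apply/mem_set; rewrite /= in_itv /= -ler_norml.
  rewrite mulr0 !h0 ?subrr ?normr0 //.
    by apply: le_trans xAB; rewrite lerDl (le_trans _ (tB 0%N)).
  have h2 := ler_normB (x + t n) (t n); rewrite addrK in h2.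
  have := le_trans h2 (lerD (lexx `|x + t n|) (tB n)).
  by move/(le_trans xAB); rewrite lerD2r.
Qed.

(** Density of compactly supported continuous functions in two halves of [e / 2]: a cutoff reduces
    to a segment, on which a continuous approximation exists. Multiplying that approximation by the
    same cutoff makes it continuous and compactly supported on the whole line, and only decreases
    the error. *)
Lemma translation_continuous_L1 (g : R -> R) : integ leb g ->
  \int[leb]_x `|g (x + t n) - g x| @[n --> \oo] --> 0.
Proof.
move=> ig; have mg := integ_mfun ig.
apply: tcont_approx => // e e0.
have c1 n x : `|cutoff n.+1%:R x| <= 1 :> R.
  by rewrite ger0_norm ?cutoff_ge0 ?cutoff_le1.
have mc n : measurable_fun setT (cutoff n.+1%:R : R -> R).
  by apply: continuous_measurable_fun; exact: continuous_cutoff.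
have ic n := integbM ig (mc n) (c1 n).
have : \int[leb]_x `|g x - g x * cutoff n.+1%:R x| @[n --> \oo] --> 0.
  rewrite -[X in _ --> X](_ : \int[leb]_x (cst 0 x) = 0); last first.
    by rewrite Rintegral_cst // mul0r.
  apply: (dominated_Rint _ _ (integ_norm ig)).
  - move=> n; have := mc n => ?; mea.
  - exact: measurable_cst.
  - move=> x; apply: cvg_near_cst; near=> n.
    rewrite cutoff_eq1 ?mulr1 ?subrr ?normr0 //.
    rewrite -natr1 (@le_trans _ _ n%:R) ?lerDl//.
    near: n; exact: nbhs_infty_ger.
  - move=> n x; rewrite normr_id -[X in X - _]mulr1 -mulrBr normrM ler_piMr //.
    have := cutoff_ge0 n.+1%:R x; have := cutoff_le1 n.+1%:R x => ? ?.
    by rewrite ler_norml; lra.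
move/cvgrPdist_le => /(_ (e / 2)); rewrite divr_gt0// => /(_ isT)[N _ /(_ N (leqnn N))].
rewrite sub0r normrN => gN.
set A : R := N.+1%:R in gN.
pose E : set R := `[- (2 * A), 2 * A]%classic.
have mE : measurable E by exact: measurable_itv.
have [||g_ [cg ig_ gg]] := @approximation_continuous_integrable R E g mE.
- exact: leb_itv_lty.
- exact: integrableS ig.
move/fine_cvgP : gg => [/= _].
move/cvgrPdist_le => /(_ (e / 2)); rewrite divr_gt0// => /(_ isT)[k _ /(_ k (leqnn k))].
rewrite sub0r normrN => gk.
have A0 : 0 < A by [].
pose h x := g_ k x * cutoff A x.
have ch : continuous h by move=> x; apply: cvgM; [exact: cg|exact: continuous_cutoff].
have h0 x : 2 * A <= `|x| -> h x = 0 by move=> ?; rewrite /h cutoff_eq0 ?mulr0.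
have A20 : 0 <= 2 * A by rewrite mulr_ge0.
have ih := integ_compact_support A20 ch h0.
exists h; split => //; first exact: tcont_compact ch h0.
have ih2 : integ leb (fun x => `|g x * cutoff A x - h x|) by apply/integ_norm/integB => //; exact: ic.
have ih1 : integ leb (fun x => `|g x - g x * cutoff A x|) by apply/integ_norm/integB => //; exact: ic.
apply: (@le_trans _ _ (\int[leb]_x (`|g x - g x * cutoff A x| + `|g x * cutoff A x - h x|))).
  apply: Rint_le; [exact/integ_norm/integB|exact: integD|].
  move=> x. rewrite (_ : g x - h x = (g x - g x * cutoff A x) + (g x * cutoff A x - h x)); [exact: ler_normD|ring].
rewrite RintD // [leRHS](splitr e); apply: lerD.
  by apply: le_trans gN; exact: ler_norm.
apply: le_trans gk; apply: le_trans (ler_norm _).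
rewrite /=; have -> : fine (\int[leb]_(z in E) `|(g z - g_ k z)%:E|)%E = \int[leb]_x (((fun z => `|g z - g_ k z|) \_ E) x).
  by rewrite -Rintegral_mkcond.
apply: Rint_le => //.
  have : leb.-integrable E (EFin \o (fun z => `|g z - g_ k z|)).
    have igE : leb.-integrable E (EFin \o g) by exact: integrableS ig.
    have iB : leb.-integrable E ((EFin \o g) \- (EFin \o g_ k))%E by exact: integrableB.
    have iB' : leb.-integrable E (EFin \o (fun z => g z - g_ k z)).
      by apply: eq_integrable iB.
    exact: (integrable_norm iB').
  by move=> /(@integrable_mkcond _ (measurableTypeR R) R leb E _ mE).1; rewrite restrict_EFin.
move=> x; rewrite /patch; case: ifPn => [_|/negP xE].
  by rewrite /h -mulrBl normrM ler_piMr //; exact: c1.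
rewrite /h -mulrBl cutoff_eq0 ?mulr0 ?normr0 //.
rewrite leNgt; apply/negP => /ltW xA'; apply: xE.
by apply/mem_set; rewrite /E /= in_itv /= -ler_norml.
Unshelve. all: end_near.
Qed.

End translation_continuity.

(** * Half of Plancherel's theorem *)

Section plancherel.
Context {R : realType}.
Local Notation leb := (@lebesgue_measure R).

(** The squared modulus of the Fourier transform; the sign of the sine part disappears in the
    square. *)
Definition power_spectrum (g : R -> R) (u : R) : R :=
  (\int[leb]_x (cos (x * u) * g x)) ^+ 2 + (\int[leb]_x (sin (x * u) * g x)) ^+ 2.

Definition autocorr (g : R -> R) (t : R) : R := \int[leb]_x (g x * g (x + t)).

Variables (g : R -> R) (M : R).
Hypotheses (ig : integ leb g) (gM : forall x, `|g x| <= M).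

Let mg : measurable_fun setT g := integ_mfun ig.

Let mgs (t : R) : measurable_fun setT (fun x : R => g (x + t)).
Proof. exact: integ_mfun (integ_shift t ig). Qed.

Lemma integ_autocorr t : integ leb (fun x => g x * g (x + t)).
Proof. by apply: (integbM ig (mgs t) (c := M)) => x; exact: gM. Qed.

(** Boundedness of [g] turns continuity of translations in L^1 into continuity of the
    autocorrelation at 0. Dividing by [M + 1] avoids the case [M = 0]. *)
Lemma autocorr_cvg (t : nat -> R) : t n @[n --> \oo] --> 0 ->
  autocorr g (t n) @[n --> \oo] --> autocorr g 0.
Proof.
move=> t0; apply/cvgrPdist_le => e e0.
have M0 : 0 <= M by apply: le_trans (gM 0).
have /cvgrPdist_le := translation_continuous_L1 t0 ig.
move=> /(_ (e / (M + 1))); rewrite divr_gt0 ?ltr_wpDl// => /(_ isT).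
apply: filterS => n; rewrite sub0r normrN => hn.
have hd : integ leb (fun x => g (x + t n) - g x) by apply: integB => //; exact: integ_shift.
rewrite distrC /autocorr -RintB; [|exact: integ_autocorr..].
apply: (@le_trans _ _ (M * \int[leb]_x `|g (x + t n) - g x|)).
  rewrite -RintZ; last exact: integ_norm.
  apply: Rint_norm_le; [|exact/integZ/integ_norm|].
    by apply: integB; exact: integ_autocorr.
  by move=> x; rewrite addr0 -mulrBr normrM ler_wpM2r.
have := le_trans (ler_norm _) hn; rewrite ler_pdivlMr ?ltr_wpDl// => hn'.
apply: le_trans hn'; rewrite mulrC ler_wpM2l ?lerDl ?ler01 //.
by apply: Rintegral_ge0.
Qed.

Let W n u : R := tri (n.+1%:R^-1 * u).

Let iW n : integ leb (W n).
Proof.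
have n0 : 0 < n.+1%:R^-1 :> R by rewrite invr_gt0.
have := integ_affine 0 n0 (@integ_tri R).
by apply: integ_eq => u; rewrite addr0.
Qed.

Let fejer_scale n t : \int[leb]_u (W n u * cos (u * t)) = n.+1%:R * fejer (n.+1%:R * t).
Proof.
have n0 : 0 < n.+1%:R^-1 :> R by rewrite invr_gt0.
have := Rint_affine 0 n0 (integ_tri_cos (n.+1%:R * t)).
rewrite invrK => <-; apply: eq_Rintegral => u _.
by rewrite addr0 /W; congr (_ * cos _); field; rewrite ?pnatr_eq0.
Qed.

Let M0 : 0 <= M. Proof. exact: le_trans (gM 0). Qed.

(** The cosine and sine parts add up through [cos a cos b + sin a sin b = cos (a - b)], so the
    weight [W n] is transformed into the kernel [(n+1) fejer ((n+1) (x - y))]; the substitution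
    [y = x + s / (n+1)] then moves the scale into the autocorrelation. *)
Lemma fejer_autocorr n :
  integ leb (fun u => W n u * power_spectrum g u) /\
  \int[leb]_u (W n u * power_spectrum g u) =
  \int[leb]_s (fejer s * autocorr g (n.+1%:R^-1 * s)).
Proof.
have mc : measurable_fun setT (fun z : R * R => cos (z.1 * z.2)) by mea.
have ms : measurable_fun setT (fun z : R * R => sin (z.1 * z.2)) by mea.
have [ic1 mc2 ic3 Ec] := weighted_square_transform mc (fun z => cos_max _) (iW n) ig.
have [is1 ms2 is3 Es] := weighted_square_transform ms (fun z => sin_max _) (iW n) ig.
split.
  by apply: integ_eq (integD ic1 is1) => u; rewrite -mulrDr.
rewrite /= in Ec Es.
transitivity (\int[leb]_u (W n u * (\int[leb]_x (cos (x * u) * g x)) ^+ 2 +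
                           W n u * (\int[leb]_x (sin (x * u) * g x)) ^+ 2)).
  by apply: eq_Rintegral => u _; rewrite -mulrDr.
rewrite (RintD ic1 is1) Ec Es -(RintD ic3 is3).
have mf := @measurable_fejer R.
have mF : measurable_fun setT (fun z : R * R =>
    g z.1 * g z.2 * (n.+1%:R * fejer (n.+1%:R * (z.1 - z.2)))) by mea.
have iWb (c : R -> R) : measurable_fun setT c -> (forall u, `|c u| <= 1) ->
    integ leb (fun u => W n u * c u).
  by move=> mmc c1; apply: (integbM (c := 1)).
have E z : g z.1 * g z.2 * \int[leb]_u (W n u * (cos (z.1 * u) * cos (z.2 * u))) +
    g z.1 * g z.2 * \int[leb]_u (W n u * (sin (z.1 * u) * sin (z.2 * u))) =
    g z.1 * g z.2 * (n.+1%:R * fejer (n.+1%:R * (z.1 - z.2))).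
  rewrite -mulrDr -fejer_scale -RintD.
  - congr (_ * _); apply: eq_Rintegral => u _; rewrite -mulrDr -cosB.
    by congr (_ * cos _); ring.
  - apply: iWb; first by mea.
    by move=> u; rewrite normrM mulr_ile1 // cos_max.
  - apply: iWb; first by mea.
    by move=> u; rewrite normrM mulr_ile1 // sin_max.
have iF : integ (leb \x leb)%E (fun z : R * R =>
    g z.1 * g z.2 * (n.+1%:R * fejer (n.+1%:R * (z.1 - z.2)))).
  by apply: integ_eq (integD ic3 is3) => z; rewrite -E.
under eq_Rintegral do rewrite E.
rewrite -Rint_fubini1 //=.
have n0 : 0 < n.+1%:R^-1 :> R by rewrite invr_gt0.
transitivity (\int[leb]_x \int[leb]_s (g x * (g (n.+1%:R^-1 * s + x) * fejer s))).
  apply: eq_Rintegral => x _.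
  have ih : integ leb (fun y => g y * fejer (n.+1%:R * (y - x))).
    apply: (integbM (c := 1)) => //; first by mea.
    by move=> y; rewrite ger0_norm ?fejer_ge0 ?fejer_le1.
  have := Rint_affine x n0 ih; rewrite invrK => Ea.
  transitivity (g x * (n.+1%:R * \int[leb]_y (g y * fejer (n.+1%:R * (y - x))))).
    rewrite -RintZ // -RintZ; last exact: integZ.
    apply: eq_Rintegral => y _; rewrite -[X in fejer X]opprK fejerN -mulrN opprB.
    by ring.
  rewrite -Ea -RintZ; last exact: (integ_affine x n0 ih).
  apply: eq_Rintegral => s _; congr (_ * (_ * fejer _)).
  by field; rewrite ?pnatr_eq0.
rewrite (Rint_swap (m1 := leb) (m2 := leb)
    (F := fun z : R * R => g z.1 * (g (n.+1%:R^-1 * z.2 + z.1) * fejer z.2))).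
  apply: eq_Rintegral => s _; rewrite /autocorr -RintZ; last exact: integ_autocorr.
  by apply: eq_Rintegral => x _; rewrite /= (addrC x); ring.
apply: (integ_prod (m1 := leb) (m2 := leb) (a := fun x => M * `|g x|) (b := fejer)).
- by mea.
- exact/integZ/integ_norm.
- exact: integ_fejer.
- move=> x y /=; rewrite !normrM (ger0_norm (fejer_ge0 y)) mulrA.
  by rewrite ler_wpM2r ?fejer_ge0 // mulrC ler_wpM2r.
Qed.

(** [W n] is at most 1, so every left side of [fejer_autocorr] is bounded by the full spectrum,
    while the right sides converge by domination. [W n] lives on [u >= 0], which loses a factor 2:
    the constant is pi instead of Plancherel's 2 pi. *)
Lemma bessel_fourier : integ leb (power_spectrum g) ->
  (\int[leb]_t fejer t) * (\int[leb]_x (g x ^+ 2)) <= \int[leb]_u power_spectrum g u.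
Proof.
move=> ip.
have a0 : autocorr g 0 = \int[leb]_x (g x ^+ 2).
  by apply: eq_Rintegral => x _; rewrite addr0 expr2.
have ifc : integ leb (fun t => fejer t * autocorr g 0).
  by have := integZ (autocorr g 0) (@integ_fejer R); apply: integ_eq => t; rewrite mulrC.
have mac n : measurable_fun setT (fun s : R => autocorr g (n.+1%:R^-1 * s)).
  apply: (measurable_Rint (m2 := leb)
    (F := fun z : R * R => g z.2 * g (z.2 + n.+1%:R^-1 * z.1))); first by mea.
  by move=> s /=; exact: integ_autocorr.
have ac_le t : `|autocorr g t| <= M * \int[leb]_x `|g x|.
  rewrite -RintZ; last exact: integ_norm.
  apply: Rint_norm_le; [exact: integ_autocorr|exact/integZ/integ_norm|].
  by move=> x; rewrite normrM mulrC ler_wpM2r.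
have mf := @measurable_fejer R.
have : \int[leb]_s (fejer s * autocorr g (n.+1%:R^-1 * s)) @[n --> \oo] -->
       \int[leb]_s (fejer s * autocorr g 0).
  apply: (dominated_Rint _ _ (integZ (M * \int[leb]_x `|g x|) (@integ_fejer R))).
  - by move=> n; have := mac n => ?; mea.
  - by mea.
  - move=> s; apply: cvgM; first exact: cvg_cst.
    apply: autocorr_cvg; rewrite -[X in _ --> X](mul0r s).
    by apply: cvgM; [exact: cvg_harmonic|exact: cvg_cst].
  - move=> n s; rewrite normrM (ger0_norm (fejer_ge0 s)) mulrC.
    by rewrite ler_wpM2r ?fejer_ge0.
under [in X in _ --> X -> _]eq_Rintegral do rewrite mulrC.
rewrite RintZ; last exact: integ_fejer.
rewrite a0 mulrC => h; apply: (cvgr_to_le h).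
apply: nearW => n.
have [iWp <-] := fejer_autocorr n.
apply: Rint_le => // u.
rewrite ler_piMl ?tri_le1 // /power_spectrum addr_ge0 ?sqr_ge0 //.
Qed.

End plancherel.

(** * Increments of Sobolev functions *)

Section sobolev_increments.
Context {R : realType}.
Local Notation leb := (@lebesgue_measure R).

Definition sq_increment (f : R -> R) (t : R) : R :=
  \int[leb]_x ((f (x + t) - f x) ^+ 2).

Lemma power_spectrum_ge0 (g : R -> R) u : 0 <= power_spectrum g u.
Proof. by rewrite addr_ge0 ?sqr_ge0. Qed.

Lemma integ_trig (c : R -> R) (g : R -> R) (u : R) : measurable_fun setT c ->
  (forall x, `|c x| <= 1) -> integ leb g -> integ leb (fun x => c (x * u) * g x).
Proof.
move=> mc c1 ig; apply: (integMb (c := 1)) => //.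
by mea.
Qed.

Lemma measurable_power_spectrum (g : R -> R) : integ leb g ->
  measurable_fun setT (power_spectrum g).
Proof.
move=> ig; have mg := integ_mfun ig.
have H (c : R -> R) : measurable_fun setT c -> (forall x, `|c x| <= 1) ->
    measurable_fun setT (fun u : R => \int[leb]_x (c (x * u) * g x)).
  move=> mc c1.
  apply: (measurable_Rint (m2 := leb) (F := fun z : R * R => c (z.2 * z.1) * g z.2)).
    by mea.
  by move=> u; exact: integ_trig.
have Hc := H _ (@measurable_cosR R) (@cos_max R).
have Hs := H _ (@measurable_sinR R) (@sin_max R).
by rewrite /power_spectrum; mea.
Qed.

(** Translation multiplies the transform by [e^(itu)], and [|e^(itu) - 1|^2 = 2 - 2 cos (t u)]. In
    real form the translation rotates the pair of cosine and sine transforms. *)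
Lemma power_spectrum_increment (f : R -> R) (t u : R) : integ leb f ->
  power_spectrum (fun x => f (x + t) - f x) u =
  (2 - 2 * cos (t * u)) * power_spectrum f u.
Proof.
move=> hf; have hft := integ_shift t hf.
have ic (g : R -> R) : integ leb g -> integ leb (fun x => cos (x * u) * g x).
  by move=> ?; apply: integ_trig => //; [exact: measurable_cosR|exact: cos_max].
have is_ (g : R -> R) : integ leb g -> integ leb (fun x => sin (x * u) * g x).
  by move=> ?; apply: integ_trig => //; [exact: measurable_sinR|exact: sin_max].
have Ec : \int[leb]_x (cos (x * u) * f (x + t)) =
    cos (t * u) * \int[leb]_x (cos (x * u) * f x) +
    sin (t * u) * \int[leb]_x (sin (x * u) * f x).
  rewrite -RintZ; last exact: ic.
  rewrite -RintZ; last exact: is_.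
  rewrite -RintD; [|by apply: integZ; exact: ic|by apply: integZ; exact: is_].
  rewrite -[RHS](Rint_shift t); last first.
    by apply: integD; apply: integZ; [exact: ic|exact: is_].
  apply: eq_Rintegral => x _; rewrite !mulrA -mulrDl; congr (_ * _).
  by rewrite -[in LHS](addrK (t * u) (x * u)) cosB mulrDl; ring.
have Es : \int[leb]_x (sin (x * u) * f (x + t)) =
    cos (t * u) * \int[leb]_x (sin (x * u) * f x) -
    sin (t * u) * \int[leb]_x (cos (x * u) * f x).
  rewrite -RintZ; last exact: is_.
  rewrite -RintZ; last exact: ic.
  rewrite -RintB; [|by apply: integZ; exact: is_|by apply: integZ; exact: ic].
  rewrite -[RHS](Rint_shift t); last first.
    by apply: integB; apply: integZ; [exact: is_|exact: ic].
  apply: eq_Rintegral => x _; rewrite !mulrA -mulrBl; congr (_ * _).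
  by rewrite -[in LHS](addrK (t * u) (x * u)) sinB mulrDl; ring.
rewrite /power_spectrum.
under eq_Rintegral do rewrite mulrBr.
rewrite RintB ?Ec; [|exact: ic..].
under [X in _ + X ^+ 2]eq_Rintegral do rewrite mulrBr.
rewrite RintB ?Es; [|exact: is_..].
set a := Rintegral _ _ _; set b := Rintegral _ _ _.
have := cos2Dsin2 (t * u); set c := cos _; set s := sin _ => cs.
have -> : (c * a + s * b - a) ^+ 2 + (c * b - s * a - b) ^+ 2 =
  (c ^+ 2 + s ^+ 2 + 1 - 2 * c) * (a ^+ 2 + b ^+ 2) by ring.
by rewrite cs; ring.
Qed.

(** For [|w| >= 1] the left side is at most 4. For [|w| < 1], [fejer_le1] reads [1 - cos w <= w^2],
    and [w^2 <= |w|^(2 alpha)]. The factor 4 serves all [alpha] at once. *)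
Lemma two_sub_cos_le (w alpha : R) : 0 < alpha <= 1 / 2 ->
  2 - 2 * cos w <= 4 * `|w| `^ (2 * alpha).
Proof.
move=> /andP[a0 a1].
have [w1|w1] := leP 1 `|w|.
  have : 1 <= `|w| `^ (2 * alpha).
    by rewrite -[leLHS](powRr0 `|w|) ler_powR //; lra.
  by have := cos_geN1 w; lra.
have [->|w0] := eqVneq w 0.
  by rewrite cos0 mulr1 subrr mulr_ge0 ?powR_ge0.
have := fejer_le1 w; rewrite fejerE // ler_pdivrMr ?exprn_even_gt0 //= mul1r => h.
have : `|w| ^+ 2 <= `|w| `^ (2 * alpha).
  rewrite -powR_mulrn // ger_powR ?normr_gt0 ?w0 ?ltW //.
  lra.
rewrite real_normK ?num_real //; move: h; set p := _ `^ _; set q := w ^+ 2; have : 0 <= q by exact: sqr_ge0.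
lra.
Qed.

Variables (alpha r M : R) (f : R -> R).
Hypotheses (ha : 0 < alpha <= 1 / 2) (hf : integ leb f) (fM : forall x, `|f x| <= M).
Hypotheses (hS : integ leb (fun u => power_spectrum f u * (1 + u ^+ 2) `^ alpha))
  (hr : \int[leb]_u (power_spectrum f u * (1 + u ^+ 2) `^ alpha) <= r ^+ 2).

Let one_le u : 1 <= (1 + u ^+ 2) `^ alpha :> R.
Proof.
case/andP: ha => a0 _.
by rewrite -[leLHS](powRr0 (1 + u ^+ 2)) ler_powR ?lerDl ?sqr_ge0 // ltW.
Qed.

Lemma sobolev_int_sq : (\int[leb]_t fejer t) * int_sq f <= r ^+ 2.
Proof.
have ip : integ leb (power_spectrum f).
  apply: integ_le hS _; first exact: measurable_power_spectrum.
  by move=> u; rewrite ger0_norm ?power_spectrum_ge0 // ler_peMr ?power_spectrum_ge0.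
apply: le_trans (bessel_fourier hf fM ip) _; apply: le_trans hr.
by apply: Rint_le => // u; rewrite ler_peMr ?power_spectrum_ge0.
Qed.

(** In [|t u|^(2 alpha)] the factor [|u|^(2 alpha) = (u^2)^alpha] is absorbed by the Sobolev weight
    [(1 + u^2)^alpha], and the factor in [t] comes out. *)
Lemma sobolev_sq_increment t :
  (\int[leb]_t fejer t) * sq_increment f t <= 4 * `|t| `^ (2 * alpha) * r ^+ 2.
Proof.
have hft := integ_shift t hf.
have hi : integ leb (fun x => f (x + t) - f x) by exact: integB.
have bnd u : power_spectrum (fun x => f (x + t) - f x) u <=
    4 * `|t| `^ (2 * alpha) * (power_spectrum f u * (1 + u ^+ 2) `^ alpha).
  rewrite power_spectrum_increment //.
  have h1 := two_sub_cos_le (t * u) ha.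
  rewrite (le_trans (ler_wpM2r (power_spectrum_ge0 f u) h1)) //.
  rewrite normrM powRM // -!mulrA ler_wpM2l // ler_wpM2l ?powR_ge0 //.
  rewrite mulrC ler_wpM2l ?power_spectrum_ge0 //.
  rewrite powRrM powR_mulrn // real_normK ?num_real //.
  case/andP: ha => a0 _.
  by rewrite ge0_ler_powR ?ltW ?nnegrE ?addr_ge0 ?sqr_ge0 // ltrDr.
have iB := integZ (4 * `|t| `^ (2 * alpha)) hS.
have ip : integ leb (power_spectrum (fun x => f (x + t) - f x)).
  apply: integ_le iB _; first exact: measurable_power_spectrum.
  by move=> u; rewrite ger0_norm ?power_spectrum_ge0.
have iM x : `|f (x + t) - f x| <= M + M.
  by rewrite (le_trans (ler_normB _ _)) // lerD.
apply: le_trans (bessel_fourier hi iM ip) _.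
apply: le_trans (Rint_le ip iB bnd) _.
by rewrite RintZ // ler_wpM2l // mulr_ge0 // powR_ge0.
Qed.

End sobolev_increments.

Section sobolev_norm.
Context {R : realType}.
Local Notation leb := (@lebesgue_measure R).

(** An integrable [f] falls in the first case of [fourier], so the squared norm is the weighted
    integral of the explicit spectrum. As the integrand is nonnegative, its finite integral yields
    integrability. *)
Lemma sobolev_norm_spectrum (alpha r : R) (f : R -> R) : integ leb f -> 0 <= r ->
  (sobolev_norm alpha f <= r%:E)%E ->
  integ leb (fun u => power_spectrum f u * (1 + u ^+ 2) `^ alpha) /\
  \int[leb]_u (power_spectrum f u * (1 + u ^+ 2) `^ alpha) <= r ^+ 2.
Proof.
move=> hf r0; rewrite /sobolev_norm => hN.
have f1 : f \in Lfun leb 1 by apply/Lfun1_integrable.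
have E : (Lnorm leb 2%:E (fun u => (Normc.normc (fourier f u) *
    (1 + u ^+ 2) `^ (alpha / 2))%:E) `^ 2 =
    \int[leb]_u (power_spectrum f u * (1 + u ^+ 2) `^ alpha)%:E)%E.
  rewrite poweR_Lnorm ?pnatr_eq0 //; apply: eq_integral => u _.
  rewrite /fourier f1. rewrite poweR_EFin; congr (_%:E).
  rewrite powR_mulrn ?normr_ge0 // real_normK ?num_real // exprMn.
  rewrite sqr_sqrtr ?addr_ge0 ?sqr_ge0 //; congr (_ * _).
    congr (_ + _).
    have -> : \int[leb]_x (- sin (x * u) * f x) = - \int[leb]_x (sin (x * u) * f x).
      under eq_Rintegral do rewrite mulNr -mulN1r.
      rewrite RintZ ?mulN1r //; apply: integ_trig => //.
        exact: measurable_sinR.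
      exact: sin_max.
    by rewrite sqrrN.
  by rewrite -(powR_mulrn 2 (powR_ge0 _ _)) -powRrM divfK ?pnatr_eq0.
have : (\int[leb]_u (power_spectrum f u * (1 + u ^+ 2) `^ alpha)%:E <= (r ^+ 2)%:E)%E.
  rewrite -E -powR_mulrn // -poweR_EFin gt0_ler_poweR //.
    by rewrite in_itv /= Lnorm_ge0 leey.
  by rewrite in_itv /= leey lee_fin r0.
move=> h.
have mp := measurable_power_spectrum hf.
have ip : integ leb (fun u => power_spectrum f u * (1 + u ^+ 2) `^ alpha).
  apply: integ_ge0.
  - apply: measurable_funM => //.
    by apply: (measurableT_comp (measurable_powR alpha)); mea.
  - by move=> u; rewrite mulr_ge0 ?power_spectrum_ge0 ?powR_ge0.
  - by apply: le_lt_trans h _; rewrite ltry.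
by split => //; rewrite -lee_fin -Rint_EFin.
Qed.

End sobolev_norm.

(** * Kernel smoothing *)

Section smoothing.
Context {R : realType}.
Local Notation leb := (@lebesgue_measure R).

(** Cauchy-Schwarz for the weight [w]: the second moment of [g] about [m] is a nonnegative quadratic
    polynomial in [m], evaluated at its minimum [A / W]. *)
Lemma sq_Rint_le d (T : measurableType d) (mu : {measure set T -> \bar R})
  (w g : T -> R) : integ mu w -> (forall x, 0 <= w x) ->
  integ mu (fun x => w x * g x) -> integ mu (fun x => w x * g x ^+ 2) ->
  (\int[mu]_x (w x * g x)) ^+ 2 <= \int[mu]_x w x * \int[mu]_x (w x * g x ^+ 2).
Proof.
move=> iw w0 iwg iwg2.
set A := \int[mu]_x (w x * g x); set W := \int[mu]_x w x.
set B := \int[mu]_x (w x * g x ^+ 2).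
have W0 : 0 <= W by apply: Rintegral_ge0.
have B0 : 0 <= B by apply: Rintegral_ge0 => x _; rewrite mulr_ge0 ?sqr_ge0.
have key (m : R) : 0 <= B - 2 * m * A + m ^+ 2 * W.
  have -> : B - 2 * m * A + m ^+ 2 * W = \int[mu]_x (w x * (g x - m) ^+ 2).
    rewrite -RintZ // -RintZ // -RintB //; last exact: integZ.
    rewrite -RintD //; [|by apply: integB => //; exact: integZ|exact: integZ].
    by apply: eq_Rintegral => x _; ring.
  by apply: Rintegral_ge0 => x _; rewrite mulr_ge0 ?sqr_ge0.
have [W00|W1] := eqVneq W 0.
  have [A0|A0] := eqVneq A 0; first by rewrite A0 expr0n W00 mul0r.
  (* With [W = 0] the polynomial is affine in [m]; if [A] were nonzero, it would take the value -1
     at this [m]. *)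
  have := key ((B + 1) / (2 * A)); rewrite W00 mulr0 addr0.
  rewrite (_ : 2 * _ * A = B + 1); last by field.
  by rewrite opprD addrA subrr sub0r ler0N1.
have Wp : 0 < W by rewrite lt_neqAle eq_sym W1.
have := key (A / W).
have -> : B - 2 * (A / W) * A + (A / W) ^+ 2 * W = (W * B - A ^+ 2) / W by field.
by rewrite pmulr_lge0 ?invr_gt0 // subr_ge0.
Qed.

Variables (K f : R -> R) (MK L h : R).
Hypotheses (mK : measurable_fun setT K) (Ksym : forall u, K (- u) = K u)
  (KM : forall u, `|K u| <= MK) (iK : integ leb K) (K1 : \int[leb]_u K u = 1).
Hypotheses (iff : integ leb f) (f0 : forall x, 0 <= f x) (fL : forall x, f x <= L).
Hypothesis h0 : 0 < h.

Let mf : measurable_fun setT f := integ_mfun iff.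
Let L0 : 0 <= L. Proof. exact: le_trans (f0 0) (fL 0). Qed.
Let fn x : `|f x| <= L. Proof. by rewrite ger0_norm. Qed.
Let MK0 : 0 <= MK. Proof. exact: le_trans (KM 0). Qed.

Local Notation K1n := (\int[leb]_u `|K u|).

(** Expand the square in [sq_increment] and use translation invariance. This identity is what makes
    the bias quadratic in the increments. *)
Lemma autocorrE t : autocorr f t = int_sq f - sq_increment f t / 2.
Proof.
have ift := integ_shift t iff.
have mft : measurable_fun setT (fun x : R => f (x + t)) by mea.
have i1 : integ leb (fun x => f x ^+ 2).
  have : integ leb (fun x => f x * f x) by apply: (integbM (c := L)).
  by apply: integ_eq => x; rewrite expr2.
have i2 := integ_shift t i1.
have i3 : integ leb (fun x => f x * f (x + t)) by apply: (integbM (c := L)).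
rewrite /sq_increment.
have -> : \int[leb]_x ((f (x + t) - f x) ^+ 2) =
    \int[leb]_x (f (x + t) ^+ 2) + \int[leb]_x (f x ^+ 2) - 2 * autocorr f t.
  rewrite -RintZ // -RintD // -RintB; [|exact: integD|exact: integZ].
  by apply: eq_Rintegral => x _; ring.
by rewrite (Rint_shift t i1) -/(int_sq f); field.
Qed.

Lemma integ_sq_increment t : integ leb (fun x => (f (x + t) - f x) ^+ 2).
Proof.
have ift := integ_shift t iff.
have mft : measurable_fun setT (fun x : R => f (x + t)) by mea.
have : integ leb (fun x => (f (x + t) - f x) * (f (x + t) - f x)).
  apply: (integbM (c := L + L)); [exact: integB|by mea|].
  by move=> x; rewrite (le_trans (ler_normB _ _)) // lerD.
by apply: integ_eq => x; rewrite expr2.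
Qed.

Lemma sq_increment_ge0 t : 0 <= sq_increment f t.
Proof. by apply: Rintegral_ge0 => x _; rewrite sqr_ge0. Qed.

Lemma autocorr_ge0 t : 0 <= autocorr f t.
Proof. by apply: Rintegral_ge0 => x _; rewrite mulr_ge0. Qed.

Lemma autocorr_le t : autocorr f t <= int_sq f.
Proof. by rewrite autocorrE gerBl divr_ge0 // sq_increment_ge0. Qed.

Lemma sq_increment_le t : sq_increment f t <= 2 * int_sq f.
Proof. by have := autocorr_ge0 t; rewrite autocorrE; lra. Qed.

Lemma measurable_sq_increment : measurable_fun setT (sq_increment f).
Proof.
apply: (measurable_Rint (m2 := leb) (F := fun z : R * R => (f (z.2 + z.1) - f z.2) ^+ 2)).
  by mea.
by move=> t /=; exact: integ_sq_increment.
Qed.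

(** The convolution of [f] with [K(./h)/h], with the bandwidth moved into the argument of [f]; the
    sign [+] uses the symmetry of [K]. *)
Definition smooth (x : R) : R := \int[leb]_v (K v * f (x + h * v)).

Lemma integ_smooth_section x : integ leb (fun v => K v * f (x + h * v)).
Proof. by apply: (integbM (c := L)) => //; mea. Qed.

Lemma measurable_smooth : measurable_fun setT smooth.
Proof.
apply: (measurable_Rint (m2 := leb) (F := fun z : R * R => K z.2 * f (z.1 + h * z.2))).
  by mea.
by move=> x /=; exact: integ_smooth_section.
Qed.

Lemma smooth_bound x : `|smooth x| <= L * K1n.
Proof.
rewrite -RintZ; last exact: integ_norm.
apply: Rint_norm_le; [exact: integ_smooth_section|exact/integZ/integ_norm|].
by move=> v; rewrite normrM mulrC ler_wpM2r.
Qed.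

Lemma smooth_kernel x : \int[leb]_y (K ((x - y) / h) / h * f y) = smooth x.
Proof.
have mk : measurable_fun setT (fun y : R => K ((x - y) / h) / h) by mea.
have ig : integ leb (fun y => K ((x - y) / h) / h * f y).
  apply: (integMb (c := MK / h)) => // y.
  by rewrite normrM normfV (gtr0_norm h0) ler_pM2r ?invr_gt0.
have := Rint_affine x h0 ig => E.
apply: (mulfI (x := h^-1)); first by rewrite invr_eq0 gt_eqF.
rewrite -E -RintZ; last exact: integ_smooth_section.
apply: eq_Rintegral => v _; rewrite -[in RHS]Ksym.
rewrite [h * v + x]addrC mulrC mulrA mulrC; congr (_ * _).
by rewrite mulrC; congr (_ * K _); field; rewrite gt_eqF.
Qed.

Lemma integ_K_autocorr : integ leb (fun v => K v * autocorr f (h * v)).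
Proof.
apply: (integbM (c := int_sq f)) => //.
  have := measurable_sq_increment => ms.
  have -> : (fun v => autocorr f (h * v)) = (fun v => int_sq f - sq_increment f (h * v) / 2).
    by apply/funext => v; rewrite autocorrE.
  by mea.
by move=> v; rewrite ger0_norm ?autocorr_ge0 ?autocorr_le.
Qed.

Lemma Rint_smooth_f : \int[leb]_x (smooth x * f x) = \int[leb]_v (K v * autocorr f (h * v)).
Proof.
have iF : integ (leb \x leb)%E (fun z : R * R => f z.1 * (K z.2 * f (z.1 + h * z.2))).
  apply: (integ_prod (m1 := leb) (m2 := leb) (a := f) (b := fun v => L * `|K v|)) => //.
  - by mea.
  - exact/integZ/integ_norm.
  - move=> x v /=; rewrite !normrM (ger0_norm (f0 x)) ler_wpM2l // mulrC.
    by rewrite ler_wpM2r.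
transitivity (\int[leb]_x \int[leb]_v (f x * (K v * f (x + h * v)))).
  apply: eq_Rintegral => x _; rewrite RintZ; last exact: integ_smooth_section.
  by rewrite mulrC.
rewrite (Rint_swap iF); apply: eq_Rintegral => v _ /=.
rewrite -RintZ; last by apply: integ_autocorr.
by apply: eq_Rintegral => x _; ring.
Qed.

Lemma integ_K_increment : integ leb (fun v => `|K v| * sq_increment f (h * v)).
Proof.
apply: (integbM (c := 2 * int_sq f)); first exact: integ_norm.
  by have := measurable_sq_increment => ms; mea.
by move=> v; rewrite ger0_norm ?sq_increment_ge0 ?sq_increment_le.
Qed.

Lemma smooth_bias :
  `|\int[leb]_x (smooth x * f x) - int_sq f| <=
  2^-1 * \int[leb]_v (`|K v| * sq_increment f (h * v)).
Proof.
have Ef : int_sq f = \int[leb]_v (int_sq f * K v) by rewrite RintZ // K1 mulr1.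
rewrite Rint_smooth_f {1}Ef -RintB; last 2 first.
- exact: integ_K_autocorr.
- exact: integZ.
rewrite -RintZ; last exact: integ_K_increment.
apply: Rint_norm_le.
- by apply: integB; [exact: integ_K_autocorr|exact: integZ].
- exact/integZ/integ_K_increment.
move=> v; rewrite autocorrE.
have -> : K v * (int_sq f - sq_increment f (h * v) / 2) - int_sq f * K v =
  - (2^-1 * (K v * sq_increment f (h * v))) by field.
by rewrite normrN !normrM (ger0_norm (sq_increment_ge0 _)) (@ger0_norm _ 2^-1) ?invr_ge0.
Qed.

(** As [\int K = 1], [smooth x - f x] is the integral of the increments against [K]. Since [K] may
    change sign, Cauchy-Schwarz is applied with the weight [|K|], at the cost of the factor
    [\int |K|]; Tonelli's theorem then integrates in [x] first. *)
Lemma smooth_variance :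
  integ leb (fun x => (smooth x - f x) ^+ 2) /\
  \int[leb]_x ((smooth x - f x) ^+ 2) <=
  K1n * \int[leb]_v (`|K v| * sq_increment f (h * v)).
Proof.
have ms := measurable_smooth.
have ia : integ leb (fun v => `|K v|) by exact: integ_norm.
have iF : integ (leb \x leb)%E
    (fun z : R * R => `|K z.1| * (f (z.2 + h * z.1) - f z.2) ^+ 2).
  apply: (integ_tonelli (m1 := leb) (m2 := leb)); first by mea.
    by move=> v /=; apply: integZ; exact: integ_sq_increment.
  apply: integ_eq integ_K_increment => v /=.
  rewrite -RintZ; last exact: integ_sq_increment.
  by apply: eq_Rintegral => x _; rewrite (ger0_norm (mulr_ge0 (normr_ge0 _) (sqr_ge0 _))).
have dn x v : `|f (x + h * v) - f x| <= L + L.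
  by rewrite (le_trans (ler_normB _ _)) // lerD.
have iw x : integ leb (fun v => `|K v| * (f (x + h * v) - f x)).
  by apply: (integbM (c := L + L)) => //; mea.
have iw2 x : integ leb (fun v => `|K v| * (f (x + h * v) - f x) ^+ 2).
  apply: (integbM (c := (L + L) ^+ 2)) => //; first by mea.
  by move=> v; rewrite normrX lerXn2r ?nnegrE // addr_ge0.
have le x : (smooth x - f x) ^+ 2 <=
    K1n * \int[leb]_v (`|K v| * (f (x + h * v) - f x) ^+ 2).
  have ikd : integ leb (fun v => K v * (f (x + h * v) - f x)).
    by apply: (integbM (c := L + L)) => //; mea.
  have -> : smooth x - f x = \int[leb]_v (K v * (f (x + h * v) - f x)).
    have Ex : f x = \int[leb]_v (f x * K v) by rewrite RintZ // K1 mulr1.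
    rewrite [X in _ - X = _]Ex -RintB; last 2 first.
    - exact: integ_smooth_section.
    - exact: integZ.
    by apply: eq_Rintegral => v _; ring.
  have iwa : integ leb (fun v => `|K v| * `|f (x + h * v) - f x|).
    by apply: integ_eq (integ_norm (iw x)) => v; rewrite normrM normr_id.
  have iwa2 : integ leb (fun v => `|K v| * `|f (x + h * v) - f x| ^+ 2).
    by apply: integ_eq (iw2 x) => v; rewrite real_normK ?num_real.
  have := sq_Rint_le ia (fun v => normr_ge0 _) iwa iwa2.
  under [X in _ <= _ * X -> _]eq_Rintegral do rewrite real_normK ?num_real //.
  apply: le_trans; rewrite -[leLHS]real_normK ?num_real //.
  rewrite lerXn2r ?nnegrE //; first by apply: Rintegral_ge0 => v _; rewrite mulr_ge0.
  by apply: Rint_norm_le => // v; rewrite normrM.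
have iG := integZ K1n (integ_fubini2 iF).
have i2 : integ leb (fun x => (smooth x - f x) ^+ 2).
  apply: integ_le iG _; first by mea.
  by move=> x; rewrite ger0_norm ?sqr_ge0 //; exact: le.
split => //.
apply: le_trans (Rint_le i2 iG le) _.
rewrite RintZ; last exact: (integ_fubini2 iF).
rewrite -(Rint_swap iF) /=.
rewrite le_eqVlt; apply/orP; left; apply/eqP; congr (_ * _).
apply: eq_Rintegral => v _; rewrite RintZ //; exact: integ_sq_increment.
Qed.

(** The substitution [y = x + h v] absorbs one of the two factors [1 / h] and leaves
    [h^-1 \int K(v)^2 autocorr f (h v) dv]; then [K^2 <= MK |K|] and [autocorr f <= int_sq f]. *)
Lemma kernel_second_moment :
  integ (leb \x leb)%E (fun z : R * R => (K ((z.1 - z.2) / h) / h) ^+ 2 * (f z.1 * f z.2)) /\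
  \int[leb]_x \int[leb]_y ((K ((x - y) / h) / h) ^+ 2 * (f x * f y)) <=
  MK * K1n * int_sq f / h.
Proof.
have ib x y : `|(K ((x - y) / h) / h) ^+ 2| <= (MK / h) ^+ 2.
  rewrite normrX lerXn2r ?nnegrE ?divr_ge0 // ?(ltW h0) //.
  by rewrite normrM normfV (gtr0_norm h0) ler_pM2r ?invr_gt0.
have iF : integ (leb \x leb)%E
    (fun z : R * R => (K ((z.1 - z.2) / h) / h) ^+ 2 * (f z.1 * f z.2)).
  apply: (integ_prod (m1 := leb) (m2 := leb) (a := fun x => (MK / h) ^+ 2 * f x) (b := f)) => //.
  - by mea.
  - exact: integZ.
  - move=> x y /=; rewrite normrM (ger0_norm (mulr_ge0 (f0 x) (f0 y))) -[leRHS]mulrA.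
    by rewrite ler_wpM2r ?mulr_ge0.
split => //.
have mk x : measurable_fun setT (fun y : R => (K ((x - y) / h) / h) ^+ 2) by mea.
have iK2 : integ leb (fun v => (K v) ^+ 2).
  have : integ leb (fun v => K v * K v) by apply: (integbM (c := MK)).
  by apply: integ_eq => v; rewrite expr2.
have E x : \int[leb]_y ((K ((x - y) / h) / h) ^+ 2 * (f x * f y)) =
    h^-1 * (f x * \int[leb]_v (K v ^+ 2 * f (x + h * v))).
  have ig : integ leb (fun y => (K ((x - y) / h) / h) ^+ 2 * f y).
    by apply: (integMb iff (mk x) (c := (MK / h) ^+ 2)) => y; exact: ib.
  have ik2 : integ leb (fun v => K v ^+ 2 * f (x + h * v)).
    by apply: (integbM (c := L)) => //; mea.
  have Ea := Rint_affine x h0 ig.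
  transitivity (f x * \int[leb]_y ((K ((x - y) / h) / h) ^+ 2 * f y)).
    by rewrite -RintZ //; apply: eq_Rintegral => y _; ring.
  rewrite mulrCA; congr (_ * _).
  apply: (mulfI (x := h^-1)); first by rewrite invr_eq0 gt_eqF.
  rewrite -Ea -RintZ // -RintZ; last exact: integZ.
  apply: eq_Rintegral => v _; rewrite -[in RHS]Ksym [h * v + x]addrC.
  rewrite (_ : (x - (x + h * v)) / h = - v); last by field; rewrite gt_eqF.
  by rewrite exprMn; field; rewrite gt_eqF.
under eq_Rintegral do rewrite E.
have iF2 : integ (leb \x leb)%E (fun z : R * R => f z.1 * (K z.2 ^+ 2 * f (z.1 + h * z.2))).
  apply: (integ_prod (m1 := leb) (m2 := leb) (a := f) (b := fun v => L * K v ^+ 2)) => //.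
  - by mea.
  - exact: integZ.
  - move=> x v /=; rewrite normrM (ger0_norm (f0 x)) ler_wpM2l // normrM.
    by rewrite (ger0_norm (sqr_ge0 (K v))) mulrC ler_wpM2r ?sqr_ge0.
have ik2 x : integ leb (fun v => K v ^+ 2 * f (x + h * v)).
  by apply: (integbM (c := L)) => //; mea.
have E2 : \int[leb]_x (f x * \int[leb]_v (K v ^+ 2 * f (x + h * v))) =
    \int[leb]_v (K v ^+ 2 * autocorr f (h * v)).
  transitivity (\int[leb]_x \int[leb]_v (f x * (K v ^+ 2 * f (x + h * v)))).
    by apply: eq_Rintegral => x _; rewrite RintZ.
  rewrite (Rint_swap iF2); apply: eq_Rintegral => v _ /=.
  rewrite -RintZ; last by apply: integ_autocorr.
  by apply: eq_Rintegral => x _; ring.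
have i1 : integ leb (fun x => f x * \int[leb]_v (K v ^+ 2 * f (x + h * v))).
  by apply: integ_eq (integ_fubini1 iF2) => x /=; rewrite RintZ.
rewrite RintZ // E2 mulrC ler_wpM2r ?invr_ge0 ?(ltW h0) //.
have -> : MK * K1n * int_sq f = \int[leb]_v (MK * int_sq f * `|K v|).
  by rewrite RintZ; [ring|exact: integ_norm].
have mac : measurable_fun setT (fun v : R => autocorr f (h * v)).
  have := measurable_sq_increment => ms.
  have -> : (fun v => autocorr f (h * v)) = (fun v => int_sq f - sq_increment f (h * v) / 2).
    by apply/funext => v; rewrite autocorrE.
  by mea.
apply: Rint_le.
- apply: (integbM (c := int_sq f)) => // v.
  by rewrite ger0_norm ?autocorr_ge0 ?autocorr_le.
- exact/integZ/integ_norm.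
move=> v; rewrite (mulrAC MK); apply: ler_pM.
- exact: sqr_ge0.
- exact: autocorr_ge0.
- by rewrite -(real_normK (num_real (K v))) expr2 ler_wpM2r.
- exact: autocorr_le.
Qed.

End smoothing.

(** * Independent samples *)

Section probability_toolbox.
Context d {T : measurableType d} {R : realType} (P : probability T R).

Lemma integ_cst (c : R) : integ P (fun=> c).
Proof. exact: finite_measure_integrable_cst. Qed.

Lemma integ_bounded (c : R) (g : T -> R) : measurable_fun setT g ->
  (forall x, `|g x| <= c) -> integ P g.
Proof. by move=> mg gc; apply: integ_le (integ_cst c) gc. Qed.

Lemma Rint_cst (c : R) : \int[P]_x c = c.
Proof.
have h := @probability_setT _ _ _ P.
by rewrite /Rintegral integral_cst // [X in (_ * X)%E]h mule1.
Qed.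

End probability_toolbox.

(** * Integration against a law with density *)

Section density.
Context {R : realType}.
Local Notation leb := (@lebesgue_measure R).
Variables (nu : probability (measurableTypeR R) R) (f : R -> R).
Hypothesis iff : integ leb f.
Hypothesis nuE : forall A, measurable A -> (nu A = \int[leb]_(x in A) (f x)%:E)%E.

Lemma density_dominates : nu `<< leb.
Proof.
apply/null_content_dominatesP => A mA A0; rewrite nuE //.
apply: null_set_integral => //.
exact: measurable_funTS (measurable_int _ iff).
Qed.

(** The Radon-Nikodym derivative comes from a choice; it coincides with [f] almost everywhere
    because both have the same integral over every measurable set. *)
Lemma integral_density (g : R -> \bar R) : nu.-integrable setT g ->
  (\int[nu]_x g x = \int[leb]_x (g x * (f x)%:E))%E.
Proof.
move=> ig; have dom := density_dominates.
have mg := measurable_int _ ig.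
have mf := measurable_int _ iff.
rewrite -(Radon_Nikodym_change_of_variables dom) //.
apply: ae_eq_integral => //.
- exact: emeasurable_funM.
- exact: emeasurable_funM.
- apply: ae_eqe_mul2l => /=.
  rewrite Radon_NikodymE /=.
  case: cid => /= h [h1 h2 h3].
  apply: integral_ae_eq => //=.
  by move=> E E01 mE; rewrite -h3 //= nuE.
Qed.

Lemma Rint_density (g : R -> R) (c : R) : measurable_fun setT g -> (forall x, `|g x| <= c) ->
  \int[nu]_x g x = \int[leb]_x (g x * f x).
Proof.
move=> mg gc.
have ig : integ nu g.
  exact: (integ_bounded nu mg gc).
by rewrite /Rintegral integral_density.
Qed.

End density.

(** * Independence, one variable at a time *)

Section independence.
Context {R : realType} {d0 : measure_display} {Omega : measurableType d0}.
Variables (P : probability Omega R) (X : nat -> {RV P >-> R}).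

(* [V] is independent of the sequence X_k, X_(k+1), ... *)
Definition indep_future {d} {T : measurableType d} (V : Omega -> T) (k : nat) : Prop :=
  measurable_fun setT V /\
  forall (J : {fset nat}) (B : nat -> set R) (A : set T),
    measurable A -> (forall j, measurable (B j)) -> (forall j, j \in J -> (k <= j)%N) ->
    P (V @^-1` A `&` \bigcap_(j in [set` J]) (X j @^-1` B j)) =
    (P (V @^-1` A) * \prod_(j <- J) P (X j @^-1` B j))%E.

Lemma indep_future0 : mutually_independent X -> indep_future (fun=> tt) 0.
Proof.
move=> H; split; first exact: measurable_cst.
move=> J B A mA mB _; have HJ := H J B mB.
have [->|->] : A = set0 \/ A = setT.
  have [At|At] := pselect (A tt); [right|left]; apply/seteqP; split => // -[] //.
- by rewrite preimage_set0 set0I measure0 mul0e.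
- by rewrite preimage_setT setTI HJ probability_setT mul1e.
Qed.

Let measurable_preX j (B : set R) : measurable B -> measurable (X j @^-1` B).
Proof. by move=> mB; rewrite -[X in measurable X]setTI; exact: measurable_funP. Qed.

Let measurable_capX (J : {fset nat}) (B : nat -> set R) : (forall j, measurable (B j)) ->
  measurable (\bigcap_(j in [set` J]) (X j @^-1` B j)).
Proof.
move=> mB; apply: fin_bigcap_measurable => //.
by move=> j _; exact: measurable_preX.
Qed.

(** For a fixed future event [E], both sides are finite measures in the event of the pair: the image
    of [P] restricted to [E], and [P E] times the law of the pair. They agree on rectangles, which
    are stable under intersection and generate the product sigma-algebra. *)
Lemma indep_future_next d (T : measurableType d) (V : Omega -> T) k :
  indep_future V k -> indep_future (fun w => (V w, X k w)) k.+1.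
Proof.
move=> [mV H].
have mVX : measurable_fun setT (fun w => (V w, X k w)) by exact: measurable_fun_pair.
split => // J B C mC mB Jk.
set E := \bigcap_(j in _) _.
have mE : measurable E by exact: measurable_capX.
set c := (\prod_(j <- J) _)%E.
have EE : P E = c.
  have := H J B setT measurableT mB; rewrite preimage_setT setTI probability_setT mul1e.
  by apply => j /Jk; exact: ltnW.
have c0 : (0 <= fine c)%R by rewrite fine_ge0 // -EE.
have cf : c = (fine c)%:E by rewrite fineK // -EE; exact: fin_num_measure.
have rect (A : set T) (B' : set R) : measurable A -> measurable B' ->
    P ((fun w => (V w, X k w)) @^-1` (A `*` B') `&` E) =
    (P ((fun w => (V w, X k w)) @^-1` (A `*` B')) * c)%E.
  move=> mA mB'.
  have preE : (fun w => (V w, X k w)) @^-1` (A `*` B') = V @^-1` A `&` X k @^-1` B' by [].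
  (* Treats [X k] as one more future variable of [V]; all indices of [J] exceed [k], so the new
     condition overwrites none. *)
  pose B2 j := if j == k then B' else B j.
  have mB2 j : measurable (B2 j) by rewrite /B2; case: ifP.
  have kJ : k \notin J by apply/negP => /Jk; rewrite ltnn.
  have H1 := H (k |` J)%fset B2 A mA mB2.
  have {}H1 := H1 _; rewrite big_fsetU1 //= in H1.
  have B2k : B2 k = B' by rewrite /B2 eqxx.
  have B2J j : j \in J -> B2 j = B j.
    by rewrite /B2; case: eqP => // -> /Jk; rewrite ltnn.
  have E2 : \bigcap_(j in [set` (k |` J)%fset]) (X j @^-1` B2 j) = X k @^-1` B' `&` E.
    apply/seteqP; split => w.
      move=> h; split; first by rewrite -B2k; apply: h => /=; rewrite !inE eqxx.
      by move=> j /= jJ; rewrite -B2J //; apply: h => /=; rewrite !inE jJ orbT.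
    move=> [hk hE] j /=; rewrite !inE => /orP[/eqP ->|jJ]; first by rewrite B2k.
    by rewrite B2J //; exact: hE.
  have P2 : (\prod_(j <- J) P (X j @^-1` B2 j) = c)%E.
    by apply: eq_big_seq => j jJ; rewrite B2J.
  rewrite E2 P2 B2k in H1.
  rewrite preE -setIA H1; last first.
    by move=> j; rewrite !inE => /orP[/eqP -> //|/Jk /ltnW].
  have H3 := H [fset k]%fset (fun=> B') A mA (fun=> mB').
  rewrite big_seq_fset1 set_fset1 bigcap_set1 in H3.
  by rewrite H3 ?muleA // => j; rewrite !inE => /eqP ->.
unshelve epose (m1 := (pushforward (mrestr P mE) (fun w => (V w, X k w)) : {measure set _ -> \bar R})).
  exact: mVX.
unshelve epose (m2 := (mscale (NngNum c0) (pushforward P (fun w => (V w, X k w))) : {measure set _ -> \bar R})).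
  exact: mVX.
suff : m1 C = m2 C.
  rewrite /m1 /m2 /= /mscale /= /pushforward /mrestr /= => ->.
  by rewrite -cf muleC.
apply: (measure_unique [set A1 `*` A2 | A1 in measurable & A2 in measurable] (fun=> setT)) => //.
- exact: measurable_prod_measurableType.
- move=> _ _ [A1 mA1 [A2 mA2 <-]] [B1 mB1 [B2 mB2 <-]].
  exists (A1 `&` B1); first exact: measurableI.
  exists (A2 `&` B2); first exact: measurableI.
  by rewrite setXI.
- by move=> _; exists setT => //; exists setT => //; rewrite setXTT.
- exact: bigcup_const.
- move=> _ [A1 mA1 [A2 mA2 <-]].
  rewrite /m1 /m2 /= /mscale /= /pushforward /mrestr /= rect //.
  by rewrite -cf muleC.
- move=> _; rewrite /m1 /= /pushforward /mrestr /=.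
  rewrite (le_lt_trans (probability_le1 _ _)) ?ltry //.
  by rewrite preimage_setT setTI.
Qed.

(** [T] is a nested product that grows with [n], starting from [unit], hence the existential type;
    the [p i] with [i < n] are its coordinates, the others are junk. *)
Lemma sample_vector : mutually_independent X -> forall n,
  exists d (T : measurableType d) (V : Omega -> T) (p : nat -> T -> R),
    [/\ indep_future V n, forall i, measurable_fun setT (p i) &
        forall i w, (i < n)%N -> X i w = p i (V w)].
Proof.
move=> iX; elim=> [|n [d [T [V [p [iV mp Xp]]]]]].
  exists _, unit, (fun=> tt), (fun _ _ => 0); split => //.
  exact: indep_future0.
exists _, (T * R)%type, (fun w => (V w, X n w)),
  (fun i z => if i == n then z.2 else p i z.1); split.
- exact: indep_future_next.
- by move=> i; case: eqP => _; [exact: measurable_snd|apply: measurableT_comp].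
- move=> i w; rewrite ltnS leq_eqVlt; case: eqP => [->//|_ /= /Xp]; exact.
Qed.

(** The hypothesis at the singleton [{k}] says that the law of the pair agrees with the product of
    the marginal laws on rectangles; Fubini's theorem does the rest. *)
Lemma expectation_next d (T : measurableType d) (V : Omega -> T) k
  (F : T * R -> R) (c : R) : indep_future V k -> measurable_fun setT F ->
  (forall z, `|F z| <= c) ->
  \int[P]_w F (V w, X k w) = \int[P]_w \int[distribution P (X k)]_x F (V w, x).
Proof.
move=> [mV H] mF Fc.
have mVX : measurable_fun setT (fun w => (V w, X k w)) by exact: measurable_fun_pair.
pose rv : Omega -> T := V.
pose mrv := isMeasurableFun.Build _ _ _ _ rv mV.
pose V' : {RV P >-> T} := HB.pack rv mrv.
unshelve epose (m := (pushforward P (fun w => (V w, X k w)) : {measure set _ -> \bar R})).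
  exact: mVX.
have iF := integ_bounded (distribution P V' \x distribution P (X k))%E mF Fc.
have mE C : measurable C -> (distribution P V' \x distribution P (X k))%E C = m C.
  apply: product_measure_unique => A B mA mB.
  have := H [fset k]%fset (fun=> B) A mA (fun=> mB).
  rewrite big_seq_fset1 set_fset1 bigcap_set1; apply.
  by move=> j; rewrite !inE => /eqP ->.
have iFm : P.-integrable setT ((EFin \o F) \o (fun w => (V w, X k w))).
  apply: (integ_bounded P (c := c)) => //; exact: measurableT_comp.
transitivity (\int[(distribution P V' \x distribution P (X k))%E]_z F z).
  rewrite /Rintegral; congr fine.
  rewrite [RHS](eq_measure_integral m); last by move=> C mC _; exact: mE.
  rewrite integral_pushforward //; exact/measurable_EFinP.
rewrite -Rint_fubini1 // /Rintegral; congr fine.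
rewrite integral_distribution //.
  apply/measurable_EFinP; apply: measurable_Rint => // v.
  by apply: (integ_bounded _ (c := c)) => //; apply: measurableT_comp.
apply: (integ_bounded P (c := c)) => [|w].
  apply: (measurableT_comp (f := fun v => \int[distribution P (X k)]_x F (v, x))) => //.
  apply: measurable_Rint => // v.
  by apply: (integ_bounded _ (c := c)) => //; apply: measurableT_comp.
rewrite -[leRHS](Rint_cst (distribution P (X k))); apply: Rint_norm_le => //.
  by apply: (integ_bounded _ (c := c)) => //; apply: measurableT_comp.
exact: integ_cst.
Qed.

End independence.

Lemma double_sum_recr (V : nmodType) (G : nat -> nat -> V) n :
  \sum_(i < n.+1) \sum_(j < n.+1 | (i < j)%N) G i j =
  \sum_(i < n) \sum_(j < n | (i < j)%N) G i j + \sum_(i < n) G i n.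
Proof.
rewrite big_ord_recr /= [X in _ + X]big1 ?addr0; last first.
  by move=> j; rewrite ltnNge -ltnS ltn_ord.
rewrite -big_split; apply: eq_bigr => i _ /=.
by rewrite big_mkcond big_ord_recr /= ltn_ord -big_mkcond.
Qed.

(** * Second moments of linear and degenerate sums *)

Section second_moments.
Context {R : realType} {d0 : measure_display} {Omega : measurableType d0}.
Variables (P : probability Omega R) (X : nat -> {RV P >-> R}) (mu : probability R R).
Hypotheses (iX : mutually_independent X)
  (lawX : forall i A, measurable A -> distribution P (X i) A = mu A).

Lemma Rint_law i (g : R -> R) :
  \int[distribution P (X i)]_x g x = \int[mu]_x g x.
Proof.
rewrite /Rintegral; congr fine; apply: eq_measure_integral => A mA _; exact: lawX.
Qed.

Lemma Rint_law_comp i (c : R) (g : R -> R) : measurable_fun setT g ->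
  (forall x, `|g x| <= c) -> \int[P]_w g (X i w) = \int[mu]_x g x.
Proof.
move=> mg gc; rewrite -(Rint_law i) /Rintegral integral_distribution //.
  exact/measurable_EFinP.
by apply: (integ_bounded P (c := c)) => //; exact: measurableT_comp.
Qed.

Lemma expectation_step n : exists d (T : measurableType d) (V : Omega -> T) (p : nat -> T -> R),
  [/\ measurable_fun setT V, forall i, measurable_fun setT (p i),
      forall i w, (i < n)%N -> X i w = p i (V w) &
      forall (F : T * R -> R) (c : R), measurable_fun setT F -> (forall z, `|F z| <= c) ->
        \int[P]_w F (V w, X n w) = \int[P]_w \int[mu]_x F (V w, x)].
Proof.
have [d [T [V [p [iV mp Xp]]]]] := sample_vector iX n.
exists d, T, V, p; split => //; first by case: iV.
move=> F c mF Fc; rewrite (expectation_next iV mF Fc).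
by apply: eq_Rintegral => w _; exact: Rint_law.
Qed.

Lemma sum_bound n (Q : pred 'I_n) (G : 'I_n -> R) (c : R) : 0 <= c ->
  (forall i, `|G i| <= c) -> `|\sum_(i < n | Q i) G i| <= n%:R * c.
Proof.
move=> c0 Gc; rewrite (le_trans (ler_norm_sum _ _ _)) // big_mkcond /=.
apply: (@le_trans _ _ (\sum_(i < n) c)).
  by apply: ler_sum => i _; case: ifP.
by rewrite sumr_const card_ord mulr_natl.
Qed.

Section linear.
Variables (a : R -> R) (c : R).
Hypotheses (ma : measurable_fun setT a) (ac : forall x, `|a x| <= c)
  (a0 : \int[mu]_x a x = 0).

Let c0 : 0 <= c. Proof. exact: le_trans (ac 0). Qed.

(** Integrating out the last variable kills the cross term, as [a] is centred; each step adds one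
    [\int a^2]. *)
Lemma second_moment_sum n :
  \int[P]_w ((\sum_(i < n) a (X i w)) ^+ 2) = n%:R * \int[mu]_x (a x ^+ 2).
Proof.
elim: n => [|n IH].
  under eq_Rintegral do rewrite big_ord0 expr0n.
  by rewrite Rint_cst mul0r.
have [d [T [V [p [mV mp Xp step]]]]] := expectation_step n.
pose s v := \sum_(i < n) a (p i v).
have ms : measurable_fun setT s by apply: measurable_sum => i; exact: measurableT_comp.
have sE w : \sum_(i < n) a (X i w) = s (V w).
  by apply: eq_bigr => i _; rewrite (Xp _ _ (ltn_ord i)).
have sb v : `|s v| <= n%:R * c.
  exact: sum_bound.
under eq_Rintegral do rewrite big_ord_recr /= sE.
have ia : integ mu a := integ_bounded mu ma ac.
have ia2 : integ mu (fun x => a x ^+ 2).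
  apply: (integ_bounded mu (c := c ^+ 2)) => [|x]; first by mea.
  by rewrite normrX lerXn2r ?nnegrE.
have is2 : integ P (fun w => s (V w) ^+ 2).
  apply: (integ_bounded P (c := (n%:R * c) ^+ 2)) => [|w]; first by mea.
  by rewrite normrX lerXn2r ?nnegrE // mulr_ge0.
rewrite (step (fun z => (s z.1 + a z.2) ^+ 2) ((n%:R * c + c) ^+ 2)) /=; last 2 first.
- by mea.
- move=> z; rewrite normrX lerXn2r ?nnegrE // ?addr_ge0 ?mulr_ge0 //.
  by rewrite (le_trans (ler_normD _ _)) // lerD.
transitivity (\int[P]_w (s (V w) ^+ 2 + \int[mu]_x (a x ^+ 2))).
  apply: eq_Rintegral => w _.
  transitivity (\int[mu]_x ((s (V w) ^+ 2 + 2 * s (V w) * a x) + a x ^+ 2)).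
    by apply: eq_Rintegral => x _; ring.
  have i1 := integ_cst mu (s (V w) ^+ 2).
  have i2 := integZ (2 * s (V w)) ia.
  by rewrite (RintD (integD i1 i2) ia2) (RintD i1 i2) RintZ // a0 mulr0 addr0 Rint_cst.
rewrite (RintD is2 (integ_cst P _)) Rint_cst -natr1 mulrDl mul1r -IH.
by congr (_ + _); apply: eq_Rintegral => w _; rewrite sE.
Qed.

End linear.

Section degenerate.
Variables (psi : R * R -> R) (c : R).
Hypotheses (mpsi : measurable_fun setT psi) (psic : forall z, `|psi z| <= c)
  (psi1 : forall x, \int[mu]_y psi (x, y) = 0)
  (psi2 : forall y, \int[mu]_x psi (x, y) = 0).

Let c0 : 0 <= c. Proof. exact: le_trans (psic (0, 0)). Qed.

(** The step from [n] to [n + 1] adds the column [D] of the pairs with the last variable. Given the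
    past, [D] is centred by [psi1], so there is no cross term. For a fixed value of the last
    variable, [D] is a centred i.i.d. sum by [psi2], of second moment [n \int psi^2]; and
    [n (n-1) / 2 + n = (n+1) n / 2]. *)
Lemma second_moment_degenerate n :
  \int[P]_w ((\sum_(i < n) \sum_(j < n | (i < j)%N) psi (X i w, X j w)) ^+ 2) =
  n%:R * (n%:R - 1) / 2 * \int[mu]_y \int[mu]_x (psi (x, y) ^+ 2).
Proof.
elim: n => [|n IH].
  under eq_Rintegral do rewrite big_ord0 expr0n.
  by rewrite Rint_cst !mul0r.
have [d [T [V [p [mV mp Xp step]]]]] := expectation_step n.
pose s v := \sum_(i < n) \sum_(j < n | (i < j)%N) psi (p i v, p j v).
pose D (z : T * R) := \sum_(i < n) psi (p i z.1, z.2).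
have ms : measurable_fun setT s.
  apply: measurable_sum => i.
  rewrite (_ : (fun v => _) = fun v =>
    \sum_(j < n) if (i < j)%N then psi (p i v, p j v) else 0); last first.
    by apply/funext => v; rewrite big_mkcond.
  apply: measurable_sum => j; case: (i < j)%N; last exact: measurable_cst.
  by mea.
have mD : measurable_fun setT D.
  by apply: measurable_sum => i; have := mp i => ?; mea.
have sE w : \sum_(i < n) \sum_(j < n | (i < j)%N) psi (X i w, X j w) = s (V w).
  by apply: eq_bigr => i _; apply: eq_bigr => j _; rewrite (Xp _ _ (ltn_ord i)) (Xp _ _ (ltn_ord j)).
have DE w x : D (V w, x) = \sum_(i < n) psi (X i w, x).
  by apply: eq_bigr => i _; rewrite (Xp _ _ (ltn_ord i)).
have Db z : `|D z| <= n%:R * c.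
  exact: sum_bound.
have sb v : `|s v| <= n%:R * (n%:R * c).
  by apply: sum_bound => [|i]; [rewrite mulr_ge0|exact: sum_bound].
under eq_Rintegral do rewrite (double_sum_recr (fun i j => psi (X i _, X j _))) sE -DE.
have mDs v : measurable_fun setT (fun x => D (v, x)) by mea.
have iD v : integ mu (fun x => D (v, x)) by exact: (integ_bounded mu (c := n%:R * c)).
have iD2 v : integ mu (fun x => D (v, x) ^+ 2).
  apply: (integ_bounded mu (c := (n%:R * c) ^+ 2)) => [|x]; first by have := mDs v => ?; mea.
  by rewrite normrX lerXn2r ?nnegrE // mulr_ge0.
have is2 : integ P (fun w => s (V w) ^+ 2).
  apply: (integ_bounded P (c := (n%:R * (n%:R * c)) ^+ 2)) => [|w]; first by mea.
  by rewrite normrX lerXn2r ?nnegrE // !mulr_ge0.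
have mD2 : measurable_fun setT (fun z => D z ^+ 2) by mea.
have iDP : integ (P \x mu)%E (fun z => D (V z.1, z.2) ^+ 2).
  apply: (integ_bounded (P \x mu)%E (c := (n%:R * c) ^+ 2)) => [|x]; first by mea.
  by rewrite normrX lerXn2r ?nnegrE // mulr_ge0.
rewrite (step (fun z => (s z.1 + D z) ^+ 2) ((n%:R * (n%:R * c) + n%:R * c) ^+ 2)) /=; last 2 first.
- by mea.
- move=> z; rewrite normrX lerXn2r ?nnegrE // ?addr_ge0 ?mulr_ge0 //.
  by rewrite (le_trans (ler_normD _ _)) // lerD.
have ED v : \int[mu]_x D (v, x) = 0.
  rewrite /D Rint_sum; first by rewrite big1 // => i _ /=; exact: psi1.
  by move=> i; apply: (integ_bounded mu (c := c)) => //=; mea.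
transitivity (\int[P]_w (s (V w) ^+ 2 + \int[mu]_x (D (V w, x) ^+ 2))).
  apply: eq_Rintegral => w _.
  transitivity (\int[mu]_x ((s (V w) ^+ 2 + 2 * s (V w) * D (V w, x)) + D (V w, x) ^+ 2)).
    by apply: eq_Rintegral => x _; ring.
  have i1 := integ_cst mu (s (V w) ^+ 2).
  have i2 := integZ (2 * s (V w)) (iD (V w)).
  by rewrite (RintD (integD i1 i2) (iD2 _)) (RintD i1 i2) RintZ // ED mulr0 addr0 Rint_cst.
rewrite (RintD is2); last exact: integ_fubini1 iDP.
rewrite (Rint_swap iDP) /=.
have -> : \int[mu]_y \int[P]_x (D (V x, y) ^+ 2) =
    n%:R * \int[mu]_y \int[mu]_x (psi (x, y) ^+ 2).
  have ipp : integ (mu \x mu)%E (fun z => psi (z.2, z.1) ^+ 2).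
    apply: (integ_bounded (mu \x mu)%E (c := c ^+ 2)) => [|x]; first by mea.
    by rewrite normrX lerXn2r ?nnegrE.
  rewrite -RintZ; last exact: (integ_fubini1 ipp).
  apply: eq_Rintegral => y _.
  under eq_Rintegral do rewrite DE.
  apply: (second_moment_sum (c := c)) => //; by mea.
have -> : \int[P]_x (s (V x) ^+ 2) = n%:R * (n%:R - 1) / 2 * \int[mu]_y \int[mu]_x (psi (x, y) ^+ 2).
  by rewrite -IH; apply: eq_Rintegral => w _; rewrite sE.
by rewrite -natr1; field.
Qed.

End degenerate.

End second_moments.

(** * Bias and variance of the statistic *)

(** Each index belongs to [n - 1] pairs. *)
Lemma double_sum_additive (R : pzRingType) (u : nat -> R) n :
  \sum_(i < n) \sum_(j < n | (i < j)%N) (u i + u j) = (n%:R - 1) * \sum_(i < n) u i.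
Proof.
elim: n => [|n IH]; first by rewrite !big_ord0 mulr0.
rewrite (double_sum_recr (fun i j => u i + u j)) IH big_ord_recr /= -natr1 addrK.
rewrite big_split /= sumr_const card_ord mulrBl mul1r mulrDr (mulr_natl (u n)).
by rewrite addrA subrK.
Qed.

Lemma sum_sub_const (R : pzRingType) (u : nat -> R) (c : R) n :
  \sum_(i < n) (u i - c) = \sum_(i < n) u i - n%:R * c.
Proof. by rewrite sumrB sumr_const card_ord mulr_natl. Qed.

(** * Hoeffding's decomposition of the statistic *)

Section hoeffding.
Context {R : realType} {d0 : measure_display} {Omega : measurableType d0}.
Local Notation leb := (@lebesgue_measure R).
Variables (P : probability Omega R) (X : nat -> {RV P >-> R}).
Variables (K f : R -> R) (MK L h : R).
Hypotheses (mK : measurable_fun setT K) (Ksym : forall u, K (- u) = K u)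
  (KM : forall u, `|K u| <= MK) (iK : integ leb K) (K1 : \int[leb]_u K u = 1).
Hypotheses (iff : integ leb f) (f0 : forall x, 0 <= f x) (fL : forall x, f x <= L).
Hypothesis h0 : 0 < h.
Hypothesis iid : iid_with_density X f.

Local Notation K1n := (\int[leb]_u `|K u|).
Local Notation mu := (distribution P (X 0%N)).
Local Notation p := (smooth K f h).
Local Notation theta := (int_sq f).

Let mf : measurable_fun setT f := integ_mfun iff.
Let L0 : 0 <= L. Proof. exact: le_trans (f0 0) (fL 0). Qed.
Let fn x : `|f x| <= L. Proof. by rewrite ger0_norm. Qed.
Let MK0 : 0 <= MK. Proof. exact: le_trans (KM 0). Qed.
Let mp : measurable_fun setT p := measurable_smooth h mK iK iff f0 fL.
Let pb x : `|p x| <= L * K1n := smooth_bound h iK iff f0 fL x.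
Let K1n0 : 0 <= K1n. Proof. by apply: Rintegral_ge0. Qed.
Let iX : mutually_independent X. Proof. by case: iid. Qed.

Lemma lawE i A : measurable A -> distribution P (X i) A = mu A.
Proof. by move=> mA; case: iid => _ H; rewrite !H. Qed.

Lemma Rint_mu (g : R -> R) (c : R) : measurable_fun setT g -> (forall x, `|g x| <= c) ->
  \int[mu]_x g x = \int[leb]_x (g x * f x).
Proof.
move=> mg gc.
rewrite -(Rint_law_comp lawE 0 mg gc).
pose X0 : Omega -> measurableTypeR R := X 0%N.
have mX0 : measurable_fun setT X0.
  have H : measurable_fun setT (X 0%N) by [].
  by move=> _ Y mY; exact: (H measurableT Y mY).
pose mixin := isMeasurableFun.Build _ _ _ _ X0 mX0.
pose X' : {RV P >-> measurableTypeR R} := HB.pack X0 mixin.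
have nuE A : measurable A -> (distribution P X' A = \int[leb]_(x in A) (f x)%:E)%E.
  by case: iid => _; exact.
rewrite -(Rint_density (nu := distribution P X') iff nuE mg gc).
rewrite /Rintegral integral_distribution //.
  exact/measurable_EFinP.
by apply: (integ_bounded P (c := c)) => //; exact: measurableT_comp.
Qed.

Let theta_h : R := \int[leb]_x (p x * f x).

Let Emp : \int[mu]_x p x = theta_h. Proof. exact: (Rint_mu mp pb). Qed.

Let Emf : \int[mu]_x f x = theta.
Proof. by rewrite (Rint_mu mf fn); apply: eq_Rintegral => x _; rewrite expr2. Qed.

Let k (z : R * R) : R := K ((z.1 - z.2) / h) / h.
(** The degenerate part of [k]: both conditional means are removed and the mean [theta_h], then
    removed twice, is added back once. *)
Let psi (z : R * R) : R := k z - (p z.1 + p z.2 - theta_h).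

Let mk : measurable_fun setT k. Proof. by rewrite /k; mea. Qed.
Let mpsi : measurable_fun setT psi. Proof. by rewrite /psi; mea. Qed.

Let kb z : `|k z| <= MK / h.
Proof. by rewrite normrM normfV (gtr0_norm h0) ler_pM2r ?invr_gt0. Qed.

Let cpsi : R := MK / h + (L * K1n + L * K1n + `|theta_h|).

Let psib z : `|psi z| <= cpsi.
Proof.
rewrite (le_trans (ler_normB _ _)) // lerD //.
rewrite (le_trans (ler_normB _ _)) // lerD //.
by rewrite (le_trans (ler_normD _ _)) // lerD.
Qed.

Let ksym x y : k (x, y) = k (y, x).
Proof. by rewrite /k /= -[in LHS]Ksym -mulNr opprB. Qed.

Let psisym x y : psi (x, y) = psi (y, x).
Proof. by rewrite /psi ksym /= [p x + _]addrC. Qed.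

Let Emk x : \int[mu]_y k (x, y) = p x.
Proof.
have mkx : measurable_fun setT (fun y => k (x, y)) by mea.
by rewrite (Rint_mu mkx (c := MK / h)) //; exact: smooth_kernel.
Qed.

Let psi1 x : \int[mu]_y psi (x, y) = 0.
Proof.
have mkx : measurable_fun setT (fun y => k (x, y)) by mea.
have i1 : integ mu (fun y => k (x, y)) by exact: (integ_bounded mu mkx (c := MK / h)).
have i2 : integ mu p by exact: (integ_bounded mu mp pb).
have i3 := integ_cst mu (p x - theta_h).
transitivity (\int[mu]_y (k (x, y) - (p y + (p x - theta_h)))).
  by apply: eq_Rintegral => y _; rewrite /psi /=; ring.
rewrite (RintB i1 (integD i2 i3)) (RintD i2 i3) Emk Emp Rint_cst.
by ring.
Qed.

Let psi2 y : \int[mu]_x psi (x, y) = 0.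
Proof. by under eq_Rintegral do rewrite psisym. Qed.

Let T (n : nat) (w : Omega) := T_stat X K h n w.

Let T_E n w : (2 <= n)%N -> T n w = theta_h +
  2 / (n%:R * (n%:R - 1)) * (\sum_(i < n) \sum_(j < n | (i < j)%N) psi (X i w, X j w)) +
  2 / n%:R * \sum_(i < n) (p (X i w) - theta_h).
Proof.
move=> n2; have n0 : n%:R != 0 :> R by rewrite pnatr_eq0 -lt0n (leq_trans _ n2).
have n1 : n%:R - 1 != 0 :> R by rewrite subr_eq0 pnatr_eq1 gtn_eqF.
have hh : h != 0 by rewrite gt_eqF.
have E1 : \sum_(i < n) \sum_(j < n | (i < j)%N) K ((X i w - X j w) / h) =
    h * \sum_(i < n) \sum_(j < n | (i < j)%N) k (X i w, X j w).
  rewrite mulr_sumr; apply: eq_bigr => i _; rewrite mulr_sumr; apply: eq_bigr => j _.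
  by rewrite /k /=; field.
(* Giving half of [theta_h] to each index turns [p x + p y - theta_h] into a sum [u i + u j]. *)
have E2 : \sum_(i < n) \sum_(j < n | (i < j)%N) k (X i w, X j w) =
    \sum_(i < n) \sum_(j < n | (i < j)%N) psi (X i w, X j w) +
    (n%:R - 1) * \sum_(i < n) (p (X i w) - theta_h / 2).
  rewrite -(double_sum_additive (fun i => p (X i w) - theta_h / 2)) -big_split.
  apply: eq_bigr => i _; rewrite -big_split; apply: eq_bigr => j _ /=.
  by rewrite /psi /=; field.
rewrite /T /T_stat E1 E2 !(sum_sub_const (fun i => p (X i w))).
by field; rewrite n0 n1 hh.
Qed.

Let S n w := \sum_(i < n) \sum_(j < n | (i < j)%N) psi (X i w, X j w).

Let mS n : measurable_fun setT (S n).
Proof.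
apply: measurable_sum => i.
rewrite (_ : (fun v => _) = fun v =>
  \sum_(j < n) if (i < j)%N then psi (X i v, X j v) else 0); last first.
  by apply/funext => v; rewrite big_mkcond.
apply: measurable_sum => j; case: (i < j)%N; last exact: measurable_cst.
by mea.
Qed.

Let cpsi0 : 0 <= cpsi. Proof. exact: le_trans (psib (0, 0)). Qed.

Let Sb n w : `|S n w| <= n%:R * (n%:R * cpsi).
Proof. by apply: sum_bound => [|i]; [rewrite mulr_ge0|exact: sum_bound]. Qed.

Let ES n : \int[P]_w S n w = 0.
Proof.
elim: n => [|n IH].
  by under eq_Rintegral do rewrite /S big_ord0; rewrite Rint_cst.
under eq_Rintegral do rewrite /S (double_sum_recr (fun i j => psi (X i _, X j _))).
have ipsi i j : integ P (fun w => psi (X i w, X j w)).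
  by apply: (integ_bounded P (c := cpsi)) => //; mea.
rewrite RintD; last 2 first.
- exact: (integ_bounded P (mS n) (Sb n)).
- by apply: integ_sum => i; exact: ipsi.
rewrite IH add0r Rint_sum; last by move=> i; exact: ipsi.
rewrite big1 // => i _.
have [d [T' [V [q [mV mq Xq step]]]]] := expectation_step iX lawE n.
have mF : measurable_fun setT (fun z : T' * R => psi (q i z.1, z.2)).
  by have := mq i => ?; mea.
have := step _ cpsi mF (fun z => psib _) => /=.
under eq_Rintegral do rewrite -(Xq _ _ (ltn_ord i)).
move=> ->; under eq_Rintegral do rewrite psi1.
by rewrite Rint_cst.
Qed.

Let mT n : measurable_fun setT (fun w => \sum_(i < n) (p (X i w) - theta_h)).
Proof. by apply: measurable_sum => i; mea. Qed.

Let ip n : integ P (fun w => \sum_(i < n) (p (X i w) - theta_h)).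
Proof.
apply: integ_sum => i; apply: integB; last exact: integ_cst.
by apply: (integ_bounded P (c := L * K1n)) => //; mea.
Qed.

Lemma integ_T n : (2 <= n)%N -> integ P (T_stat X K h n).
Proof.
move=> n2; have iS := integ_bounded P (mS n) (Sb n).
have iR := integD (integD (integ_cst P theta_h) (integZ (2 / (n%:R * (n%:R - 1))) iS))
  (integZ (2 / n%:R) (ip n)).
by apply: integ_eq iR => w; rewrite -/(T n w) (T_E w n2).
Qed.

Lemma mean_T n : (2 <= n)%N -> \int[P]_w T_stat X K h n w = theta_h.
Proof.
move=> n2; have iS := integ_bounded P (mS n) (Sb n).
under eq_Rintegral do rewrite -/(T n _) T_E //.
rewrite (RintD (integD (integ_cst P theta_h) (integZ _ iS)) (integZ _ (ip n))).
rewrite (RintD (integ_cst P theta_h) (integZ _ iS)) !RintZ // Rint_cst ES mulr0 addr0.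
have ipi i : integ P (fun w => p (X i w)).
  by apply: (integ_bounded P (c := L * K1n)) => //; mea.
rewrite Rint_sum; last by move=> i; apply: integB => //; exact: integ_cst.
rewrite big1 ?mulr0 ?addr0 // => i _.
rewrite RintB // ?Rint_cst; last exact: integ_cst.
by rewrite (Rint_law_comp lawE i mp pb) Emp subrr.
Qed.

Lemma bias_T n : (2 <= n)%N -> `|\int[P]_w T_stat X K h n w - int_sq f| <=
  2^-1 * \int[leb]_v (`|K v| * sq_increment f (h * v)).
Proof.
move=> n2; rewrite mean_T //; exact: (smooth_bias h mK iK K1 iff f0 fL).
Qed.

Let Psi := \int[mu]_y \int[mu]_x (psi (x, y) ^+ 2).

(** Under the product law [psi] is orthogonal to every bounded function of one variable, hence to
    [q = k - psi]; so the second moment of [k] is that of [psi] plus that of [q]. The moment of [k]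
    becomes a Lebesgue integral by inserting the density twice. *)
Let Psi_le : Psi <= MK * K1n * int_sq f / h.
Proof.
pose M := (mu \x mu)%E.
have ib (g : R * R -> R) (c : R) : measurable_fun setT g -> (forall z, `|g z| <= c) -> integ M g.
  exact: integ_bounded.
have sqb (g : R * R -> R) (c : R) : (forall z, `|g z| <= c) -> forall z, `|g z ^+ 2| <= c ^+ 2.
  by move=> gc z; rewrite normrX lerXn2r ?nnegrE // (le_trans _ (gc z)).
have mpsi2 : measurable_fun setT (fun z => psi z ^+ 2) by mea.
have mk2 : measurable_fun setT (fun z => k z ^+ 2) by mea.
have ipsi2 := ib _ _ mpsi2 (sqb _ _ psib).
have ik2 := ib _ _ mk2 (sqb _ _ kb).
rewrite /Psi (Rint_fubini2 ipsi2).
apply: (@le_trans _ _ (\int[M]_z (k z ^+ 2))).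
  have prodb (g g' : R * R -> R) (c c' : R) : (forall z, `|g z| <= c) -> (forall z, `|g' z| <= c') ->
      forall z, `|g z * g' z| <= c * c'.
    by move=> gc gc' z; rewrite normrM ler_pM.
  have i1 : integ M (fun z => p z.1 * psi z).
    apply: (ib _ _ _ (prodb (fun z => p z.1) psi _ _ (fun z => pb z.1) psib)); by mea.
  have i2 : integ M (fun z => p z.2 * psi z).
    apply: (ib _ _ _ (prodb (fun z => p z.2) psi _ _ (fun z => pb z.2) psib)); by mea.
  have i3 : integ M (fun z => theta_h * psi z) by apply: integZ; exact: (ib _ _ mpsi psib).
  have Epsi : \int[M]_z psi z = 0.
    rewrite -Rint_fubini1; last exact: (ib _ _ mpsi psib).
    by under eq_Rintegral do rewrite psi1; rewrite Rint_cst.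
  have E1 : \int[M]_z (p z.1 * psi z) = 0.
    rewrite -Rint_fubini1 //=.
    rewrite -[RHS](Rint_cst mu); apply: eq_Rintegral => x _.
    rewrite RintZ ?psi1 ?mulr0 //; apply: (integ_bounded mu (c := cpsi)) => //.
    by mea.
  have E2 : \int[M]_z (p z.2 * psi z) = 0.
    rewrite -Rint_fubini2 //=.
    rewrite -[RHS](Rint_cst mu); apply: eq_Rintegral => x _.
    rewrite RintZ ?psi2 ?mulr0 //; apply: (integ_bounded mu (c := cpsi)) => //.
    by mea.
  pose q (z : R * R) := p z.1 + p z.2 - theta_h.
  have mq : measurable_fun setT q by rewrite /q; mea.
  have iq2 : integ M (fun z => q z ^+ 2).
    apply: (ib _ _ _ (sqb q (L * K1n + L * K1n + `|theta_h|) _)); first by mea.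
    move=> z; rewrite (le_trans (ler_normB _ _)) // lerD //.
    by rewrite (le_trans (ler_normD _ _)) // lerD.
  have i12 := integB (integD i1 i2) i3.
  have -> : \int[M]_z (k z ^+ 2) =
      \int[M]_z (psi z ^+ 2 + 2 * (p z.1 * psi z + p z.2 * psi z - theta_h * psi z) + q z ^+ 2).
    by apply: eq_Rintegral => z _; rewrite /psi /q; ring.
  rewrite (RintD (integD ipsi2 (integZ 2 i12)) iq2) (RintD ipsi2 (integZ 2 i12)).
  rewrite (RintZ 2 i12) (RintB (integD i1 i2) i3) (RintD i1 i2) E1 E2.
  rewrite RintZ ?Epsi; last exact: (ib _ _ mpsi psib).
  rewrite mulr0 addr0 subrr mulr0 addr0 lerDl.
  by apply: Rintegral_ge0 => z _; rewrite sqr_ge0.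
rewrite -Rint_fubini1 //.
have [iF] := kernel_second_moment mK Ksym KM iK iff f0 fL h0.
apply: le_trans; rewrite le_eqVlt; apply/orP; left; apply/eqP.
have mkx x : measurable_fun setT (fun y => k (x, y) ^+ 2) by mea.
have mG : measurable_fun setT (fun x => \int[mu]_y (k (x, y) ^+ 2)).
  apply: (measurable_Rint (m2 := mu) (F := fun z => k z ^+ 2)) => // x.
  exact: (integ_bounded mu (mkx x) (fun y => sqb _ _ kb (x, y))).
have Gb x : `|\int[mu]_y (k (x, y) ^+ 2)| <= (MK / h) ^+ 2.
  rewrite -[leRHS](Rint_cst mu); apply: Rint_norm_le => [||y].
  - exact: (integ_bounded mu (mkx x) (fun y => sqb _ _ kb (x, y))).
  - exact: integ_cst.
  - exact: sqb.
rewrite (Rint_mu mG Gb); apply: eq_Rintegral => x _.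
rewrite (Rint_mu (mkx x) (fun y => sqb _ _ kb (x, y))) mulrC -RintZ.
  by apply: eq_Rintegral => y _; rewrite /k /=; ring.
apply: (integMb iff (mkx x) (c := (MK / h) ^+ 2)) => y.
exact: (sqb k _ kb (x, y)).
Qed.

Let V := \int[leb]_x ((p x - f x) ^+ 2).
(** What remains of the projection [p - theta_h] once [Y_i / 2], that is [f - theta], is
    subtracted. *)
Let a x := (p x - f x) - (theta_h - theta).
Let ma : measurable_fun setT a. Proof. by rewrite /a; mea. Qed.
Let ca := (L * K1n + L) + `|theta_h - theta|.
Let ab x : `|a x| <= ca.
Proof.
rewrite (le_trans (ler_normB _ _)) // lerD //.
by rewrite (le_trans (ler_normB _ _)) // lerD.
Qed.

Let ipf : integ mu (fun x => p x - f x).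
Proof.
apply: integB; first exact: (integ_bounded mu mp pb).
exact: (integ_bounded mu mf fn).
Qed.

Let Epf : \int[mu]_x (p x - f x) = theta_h - theta.
Proof.
rewrite RintB ?Emp ?Emf //; first exact: (integ_bounded mu mp pb).
exact: (integ_bounded mu mf fn).
Qed.

Let Ea : \int[mu]_x a x = 0.
Proof. by rewrite (RintB ipf (integ_cst mu _)) Epf Rint_cst subrr. Qed.

(** A variance is at most the second moment, here of [p - f]; bounding the density by [L] then
    passes to Lebesgue measure. The factor [L] of the variance bound originates here. *)
Let Ea2 : \int[mu]_x (a x ^+ 2) <= L * V.
Proof.
have mpf2 : measurable_fun setT (fun x => (p x - f x) ^+ 2) by mea.
have pf2b x : `|(p x - f x) ^+ 2| <= (L * K1n + L) ^+ 2.
  rewrite normrX lerXn2r ?nnegrE // ?addr_ge0 ?mulr_ge0 //.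
  by rewrite (le_trans (ler_normB _ _)) // lerD.
have ipf2 := integ_bounded mu mpf2 pf2b.
apply: (@le_trans _ _ (\int[mu]_x ((p x - f x) ^+ 2))).
  have -> : \int[mu]_x (a x ^+ 2) =
      \int[mu]_x ((p x - f x) ^+ 2 - 2 * (theta_h - theta) * (p x - f x) + (theta_h - theta) ^+ 2).
    by apply: eq_Rintegral => x _; rewrite /a; ring.
  rewrite (RintD (integB ipf2 (integZ _ ipf)) (integ_cst mu _)).
  rewrite (RintB ipf2 (integZ _ ipf)) (RintZ _ ipf) Epf Rint_cst.
  rewrite -addrA gerDl -mulrA -expr2 addrC.
  by rewrite -{1}[_ ^+ 2]mul1r -mulrBl mulr_le0_ge0 ?sqr_ge0 // subr_le0 ler1n.
rewrite (Rint_mu mpf2 pf2b).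
have [iv _] := smooth_variance h mK iK K1 iff f0 fL.
rewrite -RintZ //; apply: Rint_le.
- by apply: (integbM (c := L)).
- exact: integZ.
- by move=> x; rewrite mulrC ler_wpM2r ?sqr_ge0.
Qed.

Lemma remainder_T n : (2 <= n)%N ->
  integ P (fun w => (T_stat X K h n w - theta_h - n%:R^-1 * \sum_(i < n) Y_var X f i w) ^+ 2) /\
  \int[P]_w ((T_stat X K h n w - theta_h - n%:R^-1 * \sum_(i < n) Y_var X f i w) ^+ 2) <=
  8 * (MK * K1n * int_sq f / h) / n%:R ^+ 2 +
  8 * L / n%:R * (K1n * \int[leb]_v (`|K v| * sq_increment f (h * v))).
Proof.
move=> n2; have n0 : n%:R != 0 :> R by rewrite pnatr_eq0 -lt0n (leq_trans _ n2).
have n1 : n%:R - 1 != 0 :> R by rewrite subr_eq0 pnatr_eq1 gtn_eqF.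
pose A w := \sum_(i < n) a (X i w).
have mA : measurable_fun setT A by apply: measurable_sum => i; mea.
have ca0 : 0 <= ca by apply: le_trans (ab 0).
have Ab w : `|A w| <= n%:R * ca by exact: sum_bound.
pose s1 : R := 2 / (n%:R * (n%:R - 1)); pose s2 : R := 2 / n%:R.
have E w : T_stat X K h n w - theta_h - n%:R^-1 * \sum_(i < n) Y_var X f i w =
    s1 * S n w + s2 * A w.
  rewrite -/(T n w) T_E // /A /a /Y_var -mulr_sumr.
  rewrite (sum_sub_const (fun i => p (X i w))) (sum_sub_const (fun i => f (X i w))).
  rewrite (sum_sub_const (fun i => p (X i w) - f (X i w))) sumrB.
  by rewrite /s1 /s2 -/(S n w); field; rewrite n0 n1.
have sq_b (g : Omega -> R) (c : R) : (forall w, `|g w| <= c) -> forall w, `|g w ^+ 2| <= c ^+ 2.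
  by move=> gc z; rewrite normrX lerXn2r ?nnegrE // (le_trans _ (gc z)).
have iS2 : integ P (fun w => S n w ^+ 2).
  by apply: (integ_bounded P _ (sq_b _ _ (Sb n))); have := mS n => ?; mea.
have iA2 : integ P (fun w => A w ^+ 2).
  by apply: (integ_bounded P _ (sq_b _ _ Ab)); mea.
have iB := integD (integZ (2 * s1 ^+ 2) iS2) (integZ (2 * s2 ^+ 2) iA2).
have le w : (s1 * S n w + s2 * A w) ^+ 2 <= 2 * s1 ^+ 2 * S n w ^+ 2 + 2 * s2 ^+ 2 * A w ^+ 2.
  by have := sqr_ge0 (s1 * S n w - s2 * A w); lra.
have i2 : integ P (fun w => (s1 * S n w + s2 * A w) ^+ 2).
  apply: integ_le iB _; first by have := mS n => ?; mea.
  by move=> w; rewrite ger0_norm ?sqr_ge0.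
split; first by apply: integ_eq i2 => w; rewrite E.
under eq_Rintegral do rewrite E.
apply: le_trans (Rint_le i2 iB le) _.
rewrite (RintD (integZ _ iS2) (integZ _ iA2)) (RintZ _ iS2) (RintZ _ iA2).
rewrite (second_moment_degenerate iX lawE mpsi psib psi1 psi2) -/Psi.
rewrite (second_moment_sum iX lawE ma ab Ea).
have Psi0 : 0 <= Psi by apply: Rintegral_ge0 => y _; apply: Rintegral_ge0 => x _; rewrite sqr_ge0.
apply: lerD.
  have -> : 2 * s1 ^+ 2 * (n%:R * (n%:R - 1) / 2 * Psi) = 4 / (n%:R * (n%:R - 1)) * Psi.
    by rewrite /s1; field; rewrite n0 n1.
  have n2R : 2 <= n%:R :> R by rewrite ler_nat.
  (* From [n >= 2] follows [n <= 2 (n - 1)], which doubles the constant 4. *)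
  apply: (@le_trans _ _ (8 / n%:R ^+ 2 * Psi)).
    rewrite ler_wpM2r // ler_pdivrMr; last by rewrite mulr_gt0 //; lra.
    rewrite mulrAC ler_pdivlMr ?exprn_gt0 //; last by lra.
    rewrite -subr_ge0.
    have -> : 8 * (n%:R * (n%:R - 1)) - 4 * n%:R ^+ 2 = 4 * n%:R * (n%:R - 2) :> R by ring.
    by rewrite !mulr_ge0 // subr_ge0.
  rewrite mulrAC ler_wpM2r ?invr_ge0 ?exprn_ge0 //.
  by rewrite ler_wpM2l.
have -> : 2 * s2 ^+ 2 * (n%:R * \int[mu]_x (a x ^+ 2)) = 8 / n%:R * \int[mu]_x (a x ^+ 2).
  by rewrite /s2; field.
have [_ hV] := smooth_variance h mK iK K1 iff f0 fL.
rewrite (mulrAC 8 L) -[leRHS]mulrA; apply: ler_wpM2l; first by rewrite divr_ge0.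
apply: le_trans Ea2 _.
by rewrite ler_wpM2l.
Qed.

End hoeffding.

Section kernel_facts.
Context {R : realType}.
Local Notation leb := (@lebesgue_measure R).
Variable K : R -> R.
Hypothesis hK : is_kernel K.

Lemma kernel_measurable : measurable_fun setT K. Proof. by case: hK. Qed.

Lemma kernel_integ : integ leb K.
Proof.
case: hK => mK _ _ K1 _; have mK' : measurable_fun setT (EFin \o K) by exact/measurable_EFinP.
apply/integrableP; split => //.
by rewrite (integral_fin_num_abs leb measurableT mK) K1.
Qed.

Lemma kernel_Rint : \int[leb]_u K u = 1.
Proof. by case: hK => _ _ _ K1 _; rewrite /Rintegral K1. Qed.

(** The weight [1 + |v|] dominates every [|v|^(2 alpha)] with [2 alpha <= 1], so this one moment
    yields a constant free of [alpha]. *)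
Lemma kernel_moment : integ leb (fun v => `|K v| * (1 + `|v|)).
Proof.
have mK := kernel_measurable.
have iKv : integ leb (fun v => `|K v| * `|v|).
  case: hK => _ _ _ _ Kv; apply: integ_ge0 => //.
  - by mea.
have iS := integD (integ_norm kernel_integ) iKv; apply: integ_eq iS => v.
by rewrite mulrDr mulr1.
Qed.

End kernel_facts.

Section sobolev_bound.
Context {R : realType}.
Local Notation leb := (@lebesgue_measure R).
Local Notation cF := (\int[leb]_t fejer t).
Variables (K f : R -> R) (alpha r L h : R).
Hypotheses (hK : is_kernel K) (ha : 0 < alpha <= 1 / 2) (r0 : 0 <= r) (h0 : 0 < h).
Hypotheses (iff : integ leb f) (f0 : forall x, 0 <= f x) (fL : forall x, f x <= L).
Hypothesis hN : (sobolev_norm alpha f <= r%:E)%E.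

Let fn x : `|f x| <= L. Proof. by rewrite ger0_norm. Qed.

Lemma powR_le_linear (v : R) : 0 <= v -> v `^ (2 * alpha) <= 1 + v.
Proof.
case/andP: ha => a0 a1 v0.
have [v1|/ltW v1] := leP 1 v.
  apply: (@le_trans _ _ v); last by rewrite lerDr.
  by rewrite -[leRHS]powRr1 // ler_powR //; lra.
have [->|vn0] := eqVneq v 0.
  by rewrite powR0 ?addr0 ?ler01 // mulf_neq0 ?gt_eqF.
apply: (@le_trans _ _ 1); last by rewrite lerDl.
rewrite -[leRHS](powRr0 v) ger_powR //; first by rewrite v1 lt_neqAle eq_sym vn0 v0.
by rewrite mulr_ge0 // ltW.
Qed.

Lemma sobolev_kernel_increment :
  \int[leb]_v (`|K v| * sq_increment f (h * v)) <=
  4 / cF * (\int[leb]_v (`|K v| * (1 + `|v|))) * r ^+ 2 * h `^ (2 * alpha).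
Proof.
have [hS hr] := sobolev_norm_spectrum iff r0 hN.
have cF0 := @Rint_fejer_gt0 R.
have iM := kernel_moment hK.
have -> : 4 / cF * (\int[leb]_v (`|K v| * (1 + `|v|))) * r ^+ 2 * h `^ (2 * alpha) =
    \int[leb]_v (4 / cF * r ^+ 2 * h `^ (2 * alpha) * (`|K v| * (1 + `|v|))).
  by rewrite RintZ //; ring.
apply: Rint_le.
- exact: (integ_K_increment h (kernel_integ hK) iff f0 fL).
- exact: integZ.
move=> v; have := sobolev_sq_increment ha iff fn hS hr (h * v).
rewrite mulrC -ler_pdivlMr // => le1.
rewrite [leRHS](_ : _ = `|K v| * (4 / cF * r ^+ 2 * h `^ (2 * alpha) * (1 + `|v|))); last by ring.
rewrite ler_wpM2l //; apply: le_trans le1 _.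
rewrite normrM (gtr0_norm h0) powRM ?(ltW h0) //.
rewrite [leRHS](_ : _ = 4 * (h `^ (2 * alpha) * (1 + `|v|)) * r ^+ 2 / cF); last by ring.
rewrite ler_wpM2r ?invr_ge0 ?(ltW cF0) // ler_wpM2r ?sqr_ge0 // ler_wpM2l //.
by rewrite ler_wpM2l ?powR_ge0 // powR_le_linear.
Qed.

Lemma sobolev_int_sq_le : int_sq f <= r ^+ 2 / cF.
Proof.
have [hS hr] := sobolev_norm_spectrum iff r0 hN.
by rewrite ler_pdivlMr ?Rint_fejer_gt0 // mulrC; exact: sobolev_int_sq ha iff fn hS hr.
Qed.

End sobolev_bound.

(** * Replacing the density by a bounded version *)

Section truncation.
Context {R : realType}.
Local Notation leb := (@lebesgue_measure R).
Variables (f : R -> R) (B : R).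
Hypotheses (df : is_density f) (B0 : 0 <= B)
  (fB : {ae leb, forall x, f x <= B}).

(* An everywhere bounded version of a density that is bounded by [B] almost everywhere. *)
Definition trunc (x : R) : R := Num.min (f x) B.

Lemma density_integ : integ leb f.
Proof. by case: df => mf f0 f1; apply: integ_ge0 => //; rewrite f1 ltry. Qed.

Let mf : measurable_fun setT f. Proof. by case: df. Qed.

Lemma measurable_trunc : measurable_fun setT trunc.
Proof. exact: measurable_minr. Qed.

Lemma trunc_ge0 x : 0 <= trunc x.
Proof. by case: df => _ f0 _; rewrite /trunc le_min f0 B0. Qed.

Lemma trunc_le x : trunc x <= B.
Proof. by rewrite /trunc ge_min lexx orbT. Qed.

Lemma trunc_ae : {ae leb, forall x, trunc x = f x}.
Proof.
have := fB; apply: filterS; first exact: (ae_filter_ringOfSetsType leb).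
by move=> x fx; apply/min_idPl.
Qed.

Lemma integ_trunc : integ leb trunc.
Proof.
apply: integ_le density_integ _; first exact: measurable_trunc.
by move=> x; rewrite ger0_norm ?trunc_ge0 // /trunc ge_min lexx.
Qed.

Lemma integral_trunc (G : R -> R -> R) (A : set R) : measurable A ->
  measurable_fun setT (fun x => G x (f x)) -> measurable_fun setT (fun x => G x (trunc x)) ->
  (\int[leb]_(x in A) (G x (trunc x))%:E = \int[leb]_(x in A) (G x (f x))%:E)%E.
Proof.
move=> mA m1 m2; apply: ae_eq_integral => //.
- by apply: measurable_funTS; exact/measurable_EFinP.
- by apply: measurable_funTS; exact/measurable_EFinP.
- have := trunc_ae; apply: filterS; first exact: (ae_filter_ringOfSetsType leb).
  by move=> x /= -> _.
Qed.

Lemma Rint_trunc (G : R -> R -> R) :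
  measurable_fun setT (fun x => G x (f x)) -> measurable_fun setT (fun x => G x (trunc x)) ->
  \int[leb]_x G x (trunc x) = \int[leb]_x G x (f x).
Proof. by move=> m1 m2; rewrite /Rintegral integral_trunc. Qed.

Lemma int_sq_trunc : int_sq trunc = int_sq f.
Proof.
have mt := measurable_trunc.
by apply: (Rint_trunc (G := fun _ y => y ^+ 2)); mea.
Qed.

(** Both functions are integrable, so both transforms are given by the same integrals, which ignore
    null sets; they agree at every frequency. *)
Lemma sobolev_norm_trunc alpha : sobolev_norm alpha trunc = sobolev_norm alpha f.
Proof.
have mt := measurable_trunc.
rewrite /sobolev_norm; apply: eq_Lnorm => u; congr (_%:E); congr (_ * _).
rewrite /fourier.
have -> : f \in Lfun leb 1 by apply/Lfun1_integrable; exact: density_integ.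
have -> : trunc \in Lfun leb 1 by apply/Lfun1_integrable; exact: integ_trunc.
congr Normc.normc; rewrite /fourier_L1; congr Complex.
  by apply: (Rint_trunc (G := fun x y => cos (x * u) * y)); mea.
by apply: (Rint_trunc (G := fun x y => - sin (x * u) * y)); mea.
Qed.

Context {d : measure_display} {Omega : measurableType d}.
Variables (P : probability Omega R) (X : nat -> {RV P >-> R}).
Hypothesis iid : iid_with_density X f.

Lemma iid_trunc : iid_with_density X trunc.
Proof.
have mt := measurable_trunc.
case: iid => iX H; split => // i A mA; rewrite H //.
by rewrite (integral_trunc (G := fun _ y => y)).
Qed.

(** The law of [X i] has a density, so it charges no Lebesgue null set. *)
Lemma trunc_as i : {ae P, forall w, trunc (X i w) = f (X i w)}.
Proof.
have mt := measurable_trunc.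
pose N := [set x | trunc x != f x].
have mN : measurable N.
  rewrite (_ : N = (fun x => trunc x - f x) @^-1` [set~ 0]); last first.
    apply/seteqP; split => x; rewrite /N /=.
      by move=> /eqP h /eqP; rewrite subr_eq0 => /eqP.
    by move=> h; apply/eqP => e; apply: h; rewrite e subrr.
  have mg : measurable_fun setT (fun x => trunc x - f x) by mea.
  by rewrite -[X in measurable X]setTI; apply: mg => //; exact: measurableC.
have N0 : leb N = 0%E.
  have [N' [mN' N'0 NN']] := trunc_ae.
  apply/eqP; rewrite -measure_le0 -N'0; apply: le_measure; [exact: mem_set|exact: mem_set|].
  by move=> x /= /eqP xN; apply: NN' => /= h; exact: xN.
exists (X i @^-1` N); split.
- by rewrite -[X in measurable X]setTI; exact: measurable_funP.
- case: iid => _ /(_ i N mN) => H.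
  rewrite -[LHS]/(distribution P (X i) N) H.
  apply: null_set_integral => //.
  by apply: measurable_funTS; exact/measurable_EFinP.
- by move=> w /= h; apply/eqP.
Qed.

End truncation.

(** * Bias and variance bounds with explicit constants *)

Section part_one.
Context {R : realType}.
Local Notation leb := (@lebesgue_measure R).
Local Notation cF := (\int[leb]_t fejer t).

Lemma ess_bounded (f : R -> R) (B : R) : (forall x, 0 <= f x) ->
  (Lnorm leb +oo%E (EFin \o f) <= B%:E)%E -> {ae leb, forall x, f x <= B}.
Proof.
move=> f0; rewrite unlock /Lnorm.
(* The norm at [+oo] is the essential supremum only on a space of positive measure. *)
have -> : (0 < leb setT)%E.
  have : (@lebesgue_measure R `[0%R, 1%R]%classic <= leb setT)%E.
    by apply: le_measure; [exact: mem_set|exact: mem_set|].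
  by apply: lt_le_trans; rewrite lebesgue_measure_itv /= lte01 oppr0 adde0.
move=> /ess_supP H.
have : {ae leb, forall x, ((abse \o (EFin \o f)) x <= B%:E)%E} by exact: H.
apply: filterS; first exact: (ae_filter_ringOfSetsType leb).
by move=> x /=; rewrite lee_fin ger0_norm.
Qed.

Lemma Lfun_bounded (f : R -> R) : (forall x, 0 <= f x) -> f \in Lfun leb +oo%E ->
  exists B : R, 0 <= B /\ {ae leb, forall x, f x <= B}.
Proof.
move=> f0; rewrite classical_sets.inE => /andP[_]; rewrite classical_sets.inE /= => fy.
have N0 := @Lnorm_ge0 _ _ _ leb +oo%E (EFin \o f).
exists (fine (Lnorm leb +oo%E (EFin \o f))); split; first exact: fine_ge0.
by apply: ess_bounded => //; rewrite fineK // ge0_fin_numE.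
Qed.

Variables (K : R -> R) (MK : R).
Hypotheses (hK : is_kernel K) (KM : forall u, `|K u| <= MK).
Local Notation K1n := (\int[leb]_u `|K u|).
Local Notation kappa := (\int[leb]_v (`|K v| * (1 + `|v|))).

(** The factor 2 is the 1/2 of the bias formula times the 4 of [two_sub_cos_le]. *)
Definition bias_cst (r : R) : R := 2 * kappa / cF * r ^+ 2.
(** Degenerate part plus linear part, each with the 8 of [remainder_T]; the second has in addition
    the 4 of [two_sub_cos_le]. Their sum allows both terms to be bounded by the maximum. *)
Definition var_cst : R := 8 * (MK * K1n / cF) + 32 * (K1n * kappa / cF).

Let MK0 : 0 <= MK. Proof. exact: le_trans (KM 0). Qed.
Let Ksym u : K (- u) = K u. Proof. by case: hK. Qed.
Let K1n0 : 0 <= K1n. Proof. exact: Rintegral_ge0. Qed.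
Let kappa0 : 0 <= kappa. Proof. by apply: Rintegral_ge0 => v _; rewrite mulr_ge0 // addr_ge0. Qed.
Let cF0 := @Rint_fejer_gt0 R.

Lemma var_cst_ge0 : 0 <= var_cst.
Proof. by rewrite addr_ge0 // !mulr_ge0 // invr_ge0 ltW. Qed.

Variables (alpha r h : R) (f : R -> R).
Hypotheses (ha : 0 < alpha <= 1 / 2) (r0 : 0 <= r) (h0 : 0 < h).
Hypotheses (hN : (sobolev_norm alpha f <= r%:E)%E).
Context {d : measure_display} {Omega : measurableType d}.
Variables (P : probability Omega R) (X : nat -> {RV P >-> R}).
Hypothesis iid : iid_with_density X f.

Section bounded_density.
Variable L : R.
Hypotheses (iff : integ leb f) (f0 : forall x, 0 <= f x) (fL : forall x, f x <= L).

Let L0 : 0 <= L. Proof. exact: le_trans (f0 0) (fL 0). Qed.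

Lemma bias_bound n : (2 <= n)%N ->
  `|\int[P]_w T_stat X K h n w - int_sq f| <= bias_cst r * h `^ (2 * alpha).
Proof.
move=> n2; apply: le_trans (bias_T (kernel_measurable hK) Ksym KM (kernel_integ hK)
  (kernel_Rint hK) iff f0 fL h0 iid n2) _.
have := sobolev_kernel_increment hK ha r0 h0 iff f0 fL hN.
rewrite -(ler_pM2l (x := 2^-1)) ?invr_gt0 // => /le_trans; apply.
by rewrite /bias_cst le_eqVlt; apply/orP; left; apply/eqP; field; rewrite gt_eqF.
Qed.

Lemma remainder_bound n : (2 <= n)%N ->
  let Z w := T_stat X K h n w - \int[P]_w T_stat X K h n w
    - n%:R^-1 * \sum_(i < n) Y_var X f i w in
  integ P (fun w => Z w ^+ 2) /\
  \int[P]_w (Z w ^+ 2) <=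
  r ^+ 2 * var_cst * Num.max (1 / (n%:R ^+ 2 * h)) (L * h `^ (2 * alpha) / n%:R).
Proof.
move=> n2 Z.
have [iZ le1] := remainder_T (kernel_measurable hK) Ksym KM (kernel_integ hK)
  (kernel_Rint hK) iff f0 fL h0 iid n2.
rewrite -(mean_T (kernel_measurable hK) Ksym KM (kernel_integ hK)
  iff f0 fL h0 iid n2) in iZ le1.
split => //; apply: le_trans le1 _.
have le2 := sobolev_kernel_increment hK ha r0 h0 iff f0 fL hN.
have le3 := sobolev_int_sq_le ha r0 iff f0 fL hN.
have n0 : 0 < n%:R :> R by rewrite ltr0n (leq_trans _ n2).
set u := 1 / _; set v := L * _ / _.
have u0 : 0 <= u by rewrite divr_ge0 // mulr_ge0 // ltW.
have v0 : 0 <= v by rewrite divr_ge0 // mulr_ge0 // powR_ge0.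
apply: (@le_trans _ _ (r ^+ 2 * (8 * (MK * K1n / cF) * u + 32 * (K1n * kappa / cF) * v))); last first.
  rewrite -[leRHS]mulrA ler_wpM2l ?sqr_ge0 // /var_cst [leRHS]mulrDl.
  have c1 : 0 <= 8 * (MK * K1n / cF) by rewrite !mulr_ge0 // invr_ge0 ltW.
  have c2 : 0 <= 32 * (K1n * kappa / cF) by rewrite !mulr_ge0 // invr_ge0 ltW.
  apply: lerD; by rewrite ler_wpM2l // le_max lexx ?orbT.
rewrite mulrDr; apply: lerD.
  have -> : 8 * (MK * K1n * int_sq f / h) / n%:R ^+ 2 = 8 * (MK * K1n) * u * int_sq f.
    by rewrite /u; field; rewrite !gt_eqF.
  have -> : r ^+ 2 * (8 * (MK * K1n / cF) * u) = 8 * (MK * K1n) * u * (r ^+ 2 / cF).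
    by field; rewrite gt_eqF.
  by rewrite ler_wpM2l //; apply: mulr_ge0 => //; apply: mulr_ge0 => //; exact: mulr_ge0.
have -> : r ^+ 2 * (32 * (K1n * kappa / cF) * v) =
    8 * L / n%:R * (K1n * (4 / cF * kappa * r ^+ 2 * h `^ (2 * alpha))).
  by rewrite /v; field; rewrite !gt_eqF.
by rewrite ler_wpM2l ?divr_ge0 ?mulr_ge0 ?(ltW n0) // ler_wpM2l.
Qed.

End bounded_density.

End part_one.

Section part_one_general.
Context {R : realType}.
Local Notation leb := (@lebesgue_measure R).
Variables (K : R -> R) (MK alpha r h : R) (f : R -> R).
Hypotheses (hK : is_kernel K) (KM : forall u, `|K u| <= MK).
Hypotheses (ha : 0 < alpha <= 1 / 2) (r0 : 0 <= r) (h0 : 0 < h).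
Hypotheses (hN : (sobolev_norm alpha f <= r%:E)%E) (df : is_density f).
Context {d : measure_display} {Omega : measurableType d}.
Variables (P : probability Omega R) (X : nat -> {RV P >-> R}).
Hypothesis iid : iid_with_density X f.
Variable n : nat.
Hypothesis n2 : (2 <= n)%N.

Let Ksym u : K (- u) = K u. Proof. by case: hK. Qed.
Let f0 x : 0 <= f x. Proof. by case: df. Qed.

(** The essential bound [B] makes the integrals finite but leaves no trace in the estimate, which is
    thus uniform over all bounded densities of the Sobolev ball. *)
Lemma bias_bound_ereal : f \in Lfun leb +oo%E ->
  (`| 'E_P[T_stat X K h n] - (int_sq f)%:E | <= (bias_cst K r * h `^ (2 * alpha))%:E)%E.
Proof.
move=> /(Lfun_bounded f0)[B [B0 fB]].
have iT := integ_T X (kernel_measurable hK) KM (kernel_integ hK)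
  (integ_trunc df B0) (trunc_ge0 df B0) (@trunc_le _ f B) h0 n2.
rewrite unlock Rint_EFin // -EFinB abse_EFin lee_fin -(int_sq_trunc df fB).
apply: (bias_bound hK KM ha r0 h0 _ (iid_trunc df fB iid) (integ_trunc df B0)
  (trunc_ge0 df B0) (@trunc_le _ f B) n2).
by rewrite sobolev_norm_trunc.
Qed.

(** Truncation is done at [L] itself. The variables [Y_i] of [f] and of its truncation agree almost
    surely, simultaneously for all [i]. *)
Lemma remainder_bound_ereal (L : R) : 0 < L -> sup_ball L f ->
  ('E_P[fun w => ((T_stat X K h n w - fine 'E_P[T_stat X K h n]
                   - n%:R^-1 * \sum_(i < n) Y_var X f i w) ^+ 2)%R]
   <= (r ^+ 2 * var_cst K MK *
       Num.max (1 / (n%:R ^+ 2 * h)) (L * h `^ (2 * alpha) / n%:R))%:E)%E.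
Proof.
move=> /ltW L0 [_ /(ess_bounded f0) fL].
have iT := integ_T X (kernel_measurable hK) KM (kernel_integ hK)
  (integ_trunc df L0) (trunc_ge0 df L0) (@trunc_le _ f L) h0 n2.
have hN' : (sobolev_norm alpha (trunc f L) <= r%:E)%E by rewrite sobolev_norm_trunc.
have [] := remainder_bound hK KM ha r0 h0 hN' (iid_trunc df fL iid) (integ_trunc df L0)
  (trunc_ge0 df L0) (@trunc_le _ f L) n2.
move=> iZ; rewrite -lee_fin -Rint_EFin //; apply: le_trans.
have mt := measurable_trunc L df; have mT := integ_mfun iT.
have mf : measurable_fun setT f by case: df.
have mZ (g : R -> R) (c : R) : measurable_fun setT g ->
    measurable_fun setT (fun w => (T_stat X K h n w - c
      - n%:R^-1 * \sum_(i < n) Y_var X g i w) ^+ 2).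
  move=> mg; have mY : measurable_fun setT (fun w => \sum_(i < n) Y_var X g i w).
    by apply: measurable_sum => i; rewrite /Y_var; mea.
  by mea.
rewrite unlock [X in fine X]Rint_EFin //= le_eqVlt; apply/orP; left; apply/eqP.
apply: ae_eq_integral => //.
- by apply/measurable_EFinP; exact: mZ.
- by apply/measurable_EFinP; exact: mZ.
have : {ae P, forall w, forall i, trunc f L (X i w) = f (X i w)}.
  by apply: ae_foralln => i; exact: trunc_as.
apply: filterS => w /= wE _.
rewrite /Y_var (int_sq_trunc df fL); congr (((_ - _ * _) ^+ 2)%:E).
by apply: eq_bigr => i _; rewrite wE.
Qed.

End part_one_general.

(** * Central limit theorem *)

Section trigonometric_taylor.
Context {R : realType}.

(** One rung of the ladder for the Taylor bounds: each inequality below has the previous one, or an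
    evident one, as its derivative. *)
Lemma derive_ge0_ge0 (F f : R -> R) : (forall x : R, is_derive x 1 F (f x)) -> F 0 = 0 ->
  (forall x : R, 0 <= x -> 0 <= f x) -> forall x : R, 0 <= x -> 0 <= F x.
Proof.
move=> dF F0 f0 x x0; rewrite -F0.
apply: (@ger0_derive1_ndecry R F 0) => //.
- by move=> y; rewrite in_itv /= andbT => y0; rewrite derive1E; have [_ ->] := dF y; rewrite f0 // ltW.
- apply: continuous_subspaceT => y.
  by apply: differentiable_continuous; apply/derivable1_diffP; have [] := dF y.
Qed.

Let sin_le (x : R) : 0 <= x -> 0 <= x - sin x.
Proof.
have d (y : R) : is_derive y 1 (fun x : R => x - sin x) (1 - cos y).
  by apply: is_derive_eq; rewrite /GRing.scale /= ?mulr1.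
apply: (derive_ge0_ge0 d).
- by rewrite sin0 subr0.
- by move=> y _; rewrite subr_ge0 cos_le1.
Qed.

Let cos_ge (x : R) : 0 <= x -> 0 <= cos x - 1 + x ^+ 2 / 2.
Proof.
have d (y : R) : is_derive y 1 (fun x : R => cos x - 1 + x ^+ 2 / 2) (y - sin y).
  by apply: is_derive_eq; rewrite /GRing.scale /=; field.
apply: (derive_ge0_ge0 d).
- by rewrite cos0 expr0n /= mul0r subrr addr0.
- exact: sin_le.
Qed.

Let sin_ge (x : R) : 0 <= x -> 0 <= sin x - x + x ^+ 3 / 6.
Proof.
have d (y : R) : is_derive y 1 (fun x : R => sin x - x + x ^+ 3 / 6) (cos y - 1 + y ^+ 2 / 2).
  by apply: is_derive_eq; rewrite /GRing.scale /=; field.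
apply: (derive_ge0_ge0 d).
- by rewrite sin0 expr0n /= mul0r subrr addr0.
- exact: cos_ge.
Qed.

(** A cubic error is enough for the limit theorem. The coefficient 1/3 makes the third derivative
    [2 - sin x], visibly positive. *)
Let cos_le (x : R) : 0 <= x -> 0 <= 1 - x ^+ 2 / 2 + x ^+ 3 / 3 - cos x.
Proof.
have d (y : R) : is_derive y 1 (fun x : R => 1 - x ^+ 2 / 2 + x ^+ 3 / 3 - cos x) (y ^+ 2 + sin y - y).
  by apply: is_derive_eq; rewrite /GRing.scale /=; field.
apply: (derive_ge0_ge0 d).
- by rewrite cos0 !expr0n /= !mul0r subr0 addr0 subrr.
have d2 (y : R) : is_derive y 1 (fun x : R => x ^+ 2 + sin x - x) (2 * y + cos y - 1).
  by apply: is_derive_eq; rewrite /GRing.scale /=; field.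
apply: (derive_ge0_ge0 d2).
- by rewrite sin0 expr0n /= add0r subrr.
have d3 (y : R) : is_derive y 1 (fun x : R => 2 * x + cos x - 1) (2 - sin y).
  by apply: is_derive_eq; rewrite /GRing.scale /=; field.
apply: (derive_ge0_ge0 d3).
- by rewrite cos0 mulr0 add0r subrr.
- by move=> y _; have := sin_le1 y; lra.
Qed.

Lemma sin_taylor (x : R) : `|sin x - x| <= `|x| ^+ 3.
Proof.
wlog x0 : x / 0 <= x => [H|].
  have [/H//|/ltW x0] := leP 0 x.
  by have := H (- x); rewrite oppr_ge0 sinN -opprB !normrN => /(_ x0); rewrite opprK addrC.
rewrite (ger0_norm x0) ler_norml.
have := sin_le x0; have := sin_ge x0; have : 0 <= x ^+ 3 by exact: exprn_ge0.
by move=> *; apply/andP; split; lra.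
Qed.

Lemma cos_taylor (x : R) : `|cos x - (1 - x ^+ 2 / 2)| <= `|x| ^+ 3.
Proof.
wlog x0 : x / 0 <= x => [H|].
  have [/H//|/ltW x0] := leP 0 x.
  by have := H (- x); rewrite oppr_ge0 cosN sqrrN normrN; apply.
rewrite (ger0_norm x0) ler_norml.
have := cos_le x0; have := cos_ge x0; have : 0 <= x ^+ 3 by exact: exprn_ge0.
by move=> *; apply/andP; split; lra.
Qed.

End trigonometric_taylor.

(** * The characteristic function of the normal law *)

Section gaussian_density.
Context {R : realType}.
Local Notation leb := (@lebesgue_measure R).

Definition gexp (z : R) : R := expR (- (z ^+ 2 / 2)).

Lemma gexp_normal z : gexp z = normal_fun 0 1 z.
Proof. by rewrite /gexp /normal_fun subr0 expr1n mulNr. Qed.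

Lemma gexp_ge0 z : 0 <= gexp z. Proof. exact: expR_ge0. Qed.

Lemma measurable_gexp : measurable_fun setT gexp.
Proof. by rewrite (_ : gexp = normal_fun 0 1); [exact: measurable_normal_fun|apply/funext => z; exact: gexp_normal]. Qed.

Lemma gexp_pdf z : normal_pdf 0 1 z = normal_peak 1 * gexp z.
Proof. by rewrite normal_pdfE ?oner_eq0 // -gexp_normal. Qed.

Lemma integ_gexp : integ leb gexp.
Proof.
have := integZ (normal_peak 1)^-1 (@integrable_normal_pdf R 0 1).
apply: integ_eq => z /=; rewrite gexp_pdf mulKf //.
by rewrite gt_eqF // normal_peak_gt0 // oner_eq0.
Qed.

(** Its value, the square root of 2 pi, enters only through the total mass 1 of the normal
    density. *)
Definition gconst : R := \int[leb]_z gexp z.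

Lemma expR_neg_le (w : R) : 0 <= w -> expR (- w) <= (1 + w)^-1.
Proof.
move=> w0; rewrite expRN lef_pV2 ?posrE ?expR_gt0 //; last by rewrite ltr_pwDl.
exact: expR_ge1Dx.
Qed.

(* [z^2 <= 4 (1 + z^2/4) <= 4 exp (z^2/4)] *)
Lemma sq_gexp_le z : z ^+ 2 * gexp z <= 4 * expR (- (z ^+ 2 / 4)).
Proof.
have -> : gexp z = expR (- (z ^+ 2 / 4)) * expR (- (z ^+ 2 / 4)).
  by rewrite -expRD /gexp; congr expR; field.
rewrite mulrA ler_wpM2r ?expR_ge0 // expRN ler_pdivrMr ?expR_gt0 //.
by have := expR_ge1Dx (z ^+ 2 / 4); lra.
Qed.

Lemma integ_sq_gexp : integ leb (fun z => z ^+ 2 * gexp z).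
Proof.
have mg := measurable_gexp.
have s0 : 0 < (Num.sqrt 2)^-1 :> R by rewrite invr_gt0 sqrtr_gt0.
have h := integ_affine 0 s0 integ_gexp.
apply: integ_le (integZ 4 h) _; first by mea.
move=> z; rewrite (ger0_norm (mulr_ge0 (sqr_ge0 z) (gexp_ge0 z))).
rewrite (le_trans (sq_gexp_le z)) // ler_wpM2l // addr0 /gexp exprMn exprVn sqr_sqrtr //.
by rewrite le_eqVlt; apply/orP; left; apply/eqP; congr expR; field.
Qed.

Lemma integ_norm_gexp : integ leb (fun z => `|z| * gexp z).
Proof.
have mg := measurable_gexp.
apply: integ_le (integD integ_gexp integ_sq_gexp) _; first by mea.
move=> z; rewrite normrM normr_id (ger0_norm (gexp_ge0 z)) -[X in X + _]mul1r -mulrDl.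
rewrite ler_wpM2r ?gexp_ge0 // -(real_normK (num_real z)).
by have := sqr_ge0 (`|z| - 1 / 2); lra.
Qed.

(** Limits of [F] along the integers suffice: the integral over [[-(n+1), n+1]] converges to the
    whole integral by domination. It serves as integration by parts on the line. *)
Lemma FTC_line (F f : R -> R) : continuous f -> (forall x : R, is_derive x 1 F (f x)) ->
  integ leb f ->
  F n.+1%:R @[n --> \oo] --> 0 -> F (- n.+1%:R) @[n --> \oo] --> 0 ->
  \int[leb]_x f x = 0.
Proof.
move=> cf dF iff F1 F2.
have mf := continuous_measurable_fun cf.
have cF : continuous F.
  by move=> u; apply: differentiable_continuous; apply/derivable1_diffP; have [] := dF u.
have E n : \int[leb]_x (f x * \1_(`[- n.+1%:R, n.+1%:R]%classic : set R) x) =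
    F n.+1%:R - F (- n.+1%:R).
  have : (\int[leb]_(x in `[(- n.+1%:R)%R, n.+1%:R]) (f x)%:E =
      (F n.+1%:R)%:E - (F (- n.+1%:R))%:E)%E.
    apply: continuous_FTC2; first by rewrite gtrN.
    - exact: continuous_subspaceT.
    - split.
      + by move=> x _; have [] := dF x.
      + exact: cvg_at_right_filter (cF _).
      + exact: cvg_at_left_filter (cF _).
    - by move=> x _; rewrite derive1E; have [_ ->] := dF x.
  move=> h; have -> : F n.+1%:R - F (- n.+1%:R) =
      fine ((F n.+1%:R)%:E - (F (- n.+1%:R))%:E)%E by [].
  rewrite -h /Rintegral; congr fine; rewrite [RHS]integral_mkcond.
  apply: eq_integral => x _; rewrite /patch indicE; case: ifPn => _; first by rewrite mulr1.
  by rewrite mulr0.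
have c1 : F n.+1%:R - F (- n.+1%:R) @[n --> \oo] --> \int[leb]_x f x.
  under eq_fun do rewrite -E.
  apply: (dominated_Rint _ _ (integ_norm iff)) => //.
  - by move=> n; apply: measurable_funM => //; exact: measurable_indic.
  - move=> x; apply: cvg_near_cst; near=> n.
    rewrite indicE mem_set ?mulr1 //= in_itv /= -ler_norml -natr1.
    rewrite (@le_trans _ _ n%:R) ?lerDl //; near: n; exact: nbhs_infty_ger.
  - by move=> n x; rewrite normrM ler_piMr // indicE; case: (_ \in _); rewrite ?normr1 ?normr0.
have c2 : F n.+1%:R - F (- n.+1%:R) @[n --> \oo] --> 0 - 0 by exact: cvgB.
by rewrite subr0 in c2; exact: (cvg_unique _ c1 c2).
Unshelve. all: end_near.
Qed.

Let dgexp (z : R) : is_derive z 1 gexp (- z * gexp z).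
Proof.
by rewrite /gexp; apply: is_derive_eq; rewrite /GRing.scale /=; field.
Qed.

Let cgexp : continuous gexp.
Proof.
by move=> u; apply: differentiable_continuous; apply/derivable1_diffP; have [] := dgexp u.
Qed.

Let gexp_decay (z : R) : 1 <= `|z| -> gexp z <= 2 * `|z|^-1.
Proof.
move=> z1; have z0 : 0 < `|z| by rewrite (lt_le_trans ltr01).
rewrite ler_pdivlMr // mulrC.
have h : gexp z <= (1 + `|z| ^+ 2 / 2)^-1.
  by rewrite real_normK ?num_real //; apply: expR_neg_le; rewrite divr_ge0 ?sqr_ge0.
apply: le_trans (ler_wpM2l (ltW z0) h) _.
rewrite ler_pdivrMr; last by rewrite ltr_pwDl // divr_ge0 ?sqr_ge0.
by have := sqr_ge0 (`|z| - 1 / 2); lra.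
Qed.

Let cvg_harm (u : nat -> R) : (forall n, `|u n| <= 2 * n.+1%:R^-1) -> u n @[n --> \oo] --> 0.
Proof.
have harm : 2 * n.+1%:R^-1 @[n --> \oo] --> (0 : R).
  by rewrite -(mulr0 2); apply: cvgM; [exact: cvg_cst|exact: cvg_harmonic].
move=> h; apply/cvgr0Pnorm_le => e e0.
move/cvgrPdist_le : harm => /(_ e e0); apply: filterS => n.
by rewrite sub0r normrN; apply: le_trans; rewrite (le_trans (h n)) // ler_norm.
Qed.

(** The product [y(t) exp(t^2/2)] has zero derivative. *)
Lemma gaussian_ode (y : R -> R) : (forall t : R, is_derive t 1 y (- (t * y t))) ->
  forall t, y t = y 0 * expR (- (t ^+ 2 / 2)).
Proof.
move=> dy t.
have d0 (s : R) : is_derive s 1 (fun s => y s * expR (s ^+ 2 / 2)) 0.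
  by have := dy s => ?; apply: is_derive_eq; rewrite /GRing.scale /=; field.
have := is_derive_0_is_cst t 0 d0.
rewrite expr0n /= mul0r expR0 mulr1 expRN => <-.
by rewrite -mulrA mulfV ?mulr1 // gt_eqF ?expR_gt0.
Qed.

Section characteristic_function.
Variable b : R.

Let Phi t := \int[leb]_z (cos (t * z + b) * gexp z).

Let integ_cos t : integ leb (fun z => cos (t * z + b) * gexp z).
Proof. by apply: integMb integ_gexp _ (fun z => cos_max _); mea. Qed.

Let integ_sin t : integ leb (fun z => sin (t * z + b) * (z * gexp z)).
Proof.
have mg := measurable_gexp.
apply: integ_le integ_norm_gexp _; first by mea.
move=> z; rewrite normrM -[leRHS]mul1r ler_pM ?sin_max //.
by rewrite normrM (ger0_norm (gexp_ge0 z)).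
Qed.

(** Integration by parts: the derivative of [sin (t z + b) gexp z], which vanishes at infinity, is
    the difference of the two integrands. The phase [b] covers the real and the imaginary part of
    the characteristic function at once. *)
Let Rint_sin t : \int[leb]_z (sin (t * z + b) * (z * gexp z)) = t * Phi t.
Proof.
rewrite -RintZ //.
apply/eqP; rewrite eq_sym -subr_eq0 -RintB ?integ_sin //; last exact: integZ.
apply/eqP; apply: (FTC_line (F := fun z => sin (t * z + b) * gexp z)).
- move=> u.
  have cl : {for u, continuous (fun z : R => t * z + b)}.
    by apply: cvgD; [apply: cvgM; [exact: cvg_cst|exact: cvg_id]|exact: cvg_cst].
  apply: cvgB; apply: cvgM.
  + exact: cvg_cst.
  + apply: cvgM; last exact: cgexp.
    exact: (continuous_comp cl (@continuous_cos _ _)).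
  + exact: (continuous_comp cl (@continuous_sin _ _)).
  + by apply: cvgM; [exact: cvg_id|exact: cgexp].
- by move=> x; apply: is_derive_eq; rewrite /GRing.scale /=; rewrite /gexp; field.
- by apply: integB => //; exact: integZ.
- apply: cvg_harm => n; rewrite normrM (ger0_norm (gexp_ge0 _)).
  have n1 : 1 <= `|n.+1%:R| :> R by rewrite normr_nat ler1n.
  have := gexp_decay n1; rewrite normr_nat; apply: le_trans.
  by rewrite ler_piMl ?gexp_ge0 ?sin_max.
- apply: cvg_harm => n; rewrite normrM (ger0_norm (gexp_ge0 _)).
  have n1 : 1 <= `|- n.+1%:R| :> R by rewrite normrN normr_nat ler1n.
  have := gexp_decay n1; rewrite normrN normr_nat; apply: le_trans.
  by rewrite ler_piMl ?gexp_ge0 ?sin_max.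
Qed.

Let dPhi (t : R) : is_derive t 1 Phi (- (t * Phi t)).
Proof.
pose f (t z : R) := cos (t * z + b) * gexp z.
have df (s z : R) : is_derive s 1 (f ^~ z) (- (sin (s * z + b) * (z * gexp z))).
  by rewrite /f; apply: is_derive_eq; rewrite /GRing.scale /=; ring.
have d1 s z : partial1of2 f s z = - (sin (s * z + b) * (z * gexp z)).
  by rewrite partial1of2E; have [_ ->] := df s z.
(* Any neighbourhood of [t] would do, since the dominating function [|z| gexp z] is uniform in the
   frequency. *)
have It : (`]t - 1, t + 1[%classic : set R) t by rewrite /= in_itv /=; lra.
have iF x : (`]t - 1, t + 1[%classic : set R) x -> leb.-integrable setT (EFin \o f x).
  by move=> _; exact: integ_cos.
have dF x y : (`]t - 1, t + 1[%classic : set R) x -> [set: R] y -> derivable (f ^~ y) x 1.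
  by move=> _ _; have [] := df x y.
have G0 (z : R) : 0 <= `|z| * gexp z by rewrite mulr_ge0 ?gexp_ge0.
have Gub x y : (`]t - 1, t + 1[%classic : set R) x -> [set: R] y ->
    `|partial1of2 f x y| <= `|y| * gexp y.
  move=> _ _; rewrite d1 normrN !normrM (ger0_norm (gexp_ge0 y)).
  by rewrite ler_piMl ?sin_max // mulr_ge0 ?gexp_ge0.
have h1 := derivable_under_integral measurableT It iF dF G0 integ_norm_gexp Gub.
have h2 := differentiation_under_integral measurableT It iF dF G0 integ_norm_gexp Gub.
apply: DeriveDef => //; rewrite -derive1E [LHS]h2 -Rint_sin.
under eq_Rintegral do rewrite d1.
rewrite -mulN1r -RintZ //.
by apply: eq_Rintegral => z _; rewrite mulN1r.
Qed.

Lemma gexp_cos t : \int[leb]_z (cos (t * z + b) * gexp z) =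
  gconst * cos b * expR (- (t ^+ 2 / 2)).
Proof.
rewrite -/(Phi t) (gaussian_ode dPhi t) /Phi; congr (_ * _).
rewrite mulrC -RintZ ?integ_gexp //.
by apply: eq_Rintegral => z _; rewrite mul0r add0r.
Qed.

End characteristic_function.

End gaussian_density.

Section gaussian_law.
Context {R : realType}.
Local Notation leb := (@lebesgue_measure R).
Variable s : R.
Hypothesis s0 : 0 < s.

Let pdfE x : normal_pdf 0 s x = normal_peak s * gexp (s^-1 * x + 0).
Proof.
rewrite normal_pdfE ?gt_eqF // /normal_fun /gexp; congr (_ * expR _).
by rewrite addr0 subr0 -mulr_natl; field; rewrite gt_eqF.
Qed.

Let Rint_scale (g : R -> R) : integ leb g ->
  \int[leb]_x (normal_peak s * g (s^-1 * x + 0)) = normal_peak s * (s * \int[leb]_x g x).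
Proof.
move=> ig; have s'0 : 0 < s^-1 by rewrite invr_gt0.
by rewrite RintZ ?(Rint_affine 0 s'0 ig) ?invrK //; exact: integ_affine.
Qed.

Let peakE : normal_peak s * (s * gconst) = 1.
Proof.
rewrite /gconst -Rint_scale; last exact: integ_gexp.
rewrite -[RHS](f_equal fine (@integral_normal_pdf R 0 s)) /Rintegral.
by congr fine; apply: eq_integral => z _; rewrite pdfE.
Qed.

Lemma normal_prob_cos a b :
  \int[normal_prob 0 s]_z cos (a * z + b) = cos b * expR (- ((a * s) ^+ 2 / 2)).
Proof.
have mc : measurable_fun setT (fun z : R => cos (a * z + b)) by mea.
rewrite (Rint_density (@integrable_normal_pdf R 0 s) _ mc (fun z => cos_max _)) //.
have mg := @measurable_gexp R.
have ig : integ leb (fun z => cos (a * s * z + b) * gexp z).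
  by apply: integMb integ_gexp _ (fun z => cos_max _); mea.
transitivity (\int[leb]_z (normal_peak s * (cos (a * s * (s^-1 * z + 0) + b) * gexp (s^-1 * z + 0)))).
  apply: eq_Rintegral => z _; rewrite pdfE mulrCA addr0.
  by rewrite (mulrA (a * s)) mulfK ?gt_eqF.
rewrite (Rint_scale ig) gexp_cos.
rewrite -[RHS]mul1r -peakE; ring.
Qed.

End gaussian_law.

(** The formula covers the point mass at [v = 0] as well. This degenerate limit does occur, for
    instance for a uniform density, where [f(X_i)] is almost surely constant. *)
Lemma gaussian_cos (R : realType) (v a b : R) : 0 <= v ->
  \int[gaussian 0 v]_z cos (a * z + b) = cos b * expR (- (a ^+ 2 * v / 2)).
Proof.
move=> v0; rewrite /gaussian; case: eqVneq => [->|vn].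
  rewrite mulr0 mul0r oppr0 expR0 mulr1 /Rintegral integral_dirac //; last first.
    by apply/measurable_EFinP; mea.
  by rewrite diracT mul1e /= mulr0 add0r.
rewrite normal_prob_cos ?sqrtr_gt0 ?lt0r ?vn //.
by rewrite exprMn sqr_sqrtr.
Qed.

Lemma expR_neg_taylor (R : realType) (w : R) : 0 <= w -> `|expR (- w) - (1 - w)| <= w ^+ 2.
Proof.
move=> w0; have h1 := expR_ge1Dx (- w); have h2 := expR_neg_le w0.
have h3 : (1 + w)^-1 <= 1 - w + w ^+ 2.
  rewrite -[leLHS]mul1r ler_pdivrMr ?ltr_pwDl //.
  by have : 0 <= w ^+ 3 by [exact: exprn_ge0]; lra.
by rewrite ler_norml; have := sqr_ge0 w => ?; apply/andP; split; lra.
Qed.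

(** * The characteristic function of a centred i.i.d. sum *)

Section characteristic_function_of_sum.
Context {R : realType} {d0 : measure_display} {Omega : measurableType d0}.
Variables (P : probability Omega R) (X : nat -> {RV P >-> R}) (mu : probability R R).
Hypotheses (iX : mutually_independent X)
  (lawX : forall i A, measurable A -> distribution P (X i) A = mu A).
Variables (y : R -> R) (c : R).
Hypotheses (my : measurable_fun setT y) (yc : forall x, `|y x| <= c)
  (y0 : \int[mu]_x y x = 0).

Let c0 : 0 <= c. Proof. exact: le_trans (yc 0). Qed.
Let v := \int[mu]_x (y x ^+ 2).
Let v0 : 0 <= v. Proof. by apply: Rintegral_ge0 => x _; exact: sqr_ge0. Qed.

Section fixed_frequency.
Variable a : R.
(** Error of one step: a cubic term for the sine, one for the cosine, and the quadratic error in
    replacing [1 - w] by [exp (- w)] with [w = a^2 v / 2]. *)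
Let delta := 2 * (`|a| * c) ^+ 3 + (a ^+ 2 * v / 2) ^+ 2.

Let ay3 x : `|a * y x| ^+ 3 <= (`|a| * c) ^+ 3.
Proof. by rewrite lerXn2r ?nnegrE ?mulr_ge0 // normrM ler_wpM2l. Qed.

Let iy : integ mu y := integ_bounded mu my yc.
Let iy2 : integ mu (fun x => y x ^+ 2).
Proof.
apply: (integ_bounded mu (c := c ^+ 2)) => [|x]; first by mea.
by rewrite normrX lerXn2r ?nnegrE.
Qed.
Let icos : integ mu (fun x => cos (a * y x)).
Proof. by apply: (integ_bounded mu (c := 1)) => [|x]; [mea|exact: cos_max]. Qed.
Let isin : integ mu (fun x => sin (a * y x)).
Proof. by apply: (integ_bounded mu (c := 1)) => [|x]; [mea|exact: sin_max]. Qed.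

Let Esin : `|\int[mu]_x sin (a * y x)| <= (`|a| * c) ^+ 3.
Proof.
have -> : \int[mu]_x sin (a * y x) = \int[mu]_x (sin (a * y x) - a * y x).
  by rewrite (RintB isin (integZ a iy)) RintZ // y0 mulr0 subr0.
rewrite -[leRHS](Rint_cst mu); apply: Rint_norm_le.
- exact: integB isin (integZ a iy).
- exact: integ_cst.
- by move=> x; exact: le_trans (sin_taylor _) (ay3 x).
Qed.

Let Ecos : `|\int[mu]_x cos (a * y x) - expR (- (a ^+ 2 * v / 2))| <=
  (`|a| * c) ^+ 3 + (a ^+ 2 * v / 2) ^+ 2.
Proof.
set w := _ / 2; have w0 : 0 <= w by rewrite /w divr_ge0 // (mulr_ge0 (sqr_ge0 a) v0).
have -> : \int[mu]_x cos (a * y x) - expR (- w) =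
    (\int[mu]_x cos (a * y x) - (1 - w)) - (expR (- w) - (1 - w)) by ring.
apply: le_trans (ler_normB _ _) _; apply: lerD; last exact: expR_neg_taylor.
have i1 := integB (integ_cst mu 1) (integZ (a ^+ 2 / 2) iy2).
have -> : 1 - w = \int[mu]_x (1 - a ^+ 2 / 2 * y x ^+ 2).
  by rewrite (RintB (integ_cst mu 1) (integZ _ iy2)) Rint_cst RintZ // /w mulrAC.
rewrite -RintB // -[X in _ <= X](Rint_cst mu); apply: Rint_norm_le.
- exact: integB.
- exact: integ_cst.
- move=> x; apply: le_trans _ (ay3 x).
  by have := cos_taylor (a * y x); rewrite exprMn mulrAC.
Qed.

(** By the addition formula, integrating out the last variable multiplies the cosine term by [gc]
    and adds a sine term with coefficient [gs]. Here [gc] is close to [q] and [gs] is close to 0,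
    while all other factors are at most 1, so the errors merely add up. *)
Lemma cos_sum b n :
  `|\int[P]_w cos (a * (\sum_(i < n) y (X i w)) + b) -
    expR (- (a ^+ 2 * v / 2)) ^+ n * cos b| <= n%:R * delta.
Proof.
elim: n => [|n IH].
  under eq_Rintegral do rewrite big_ord0 mulr0 add0r.
  by rewrite Rint_cst expr0 mul1r subrr normr0 mul0r.
have [d [T [V [p [mV mp Xp step]]]]] := expectation_step iX lawX n.
pose s u := \sum_(i < n) y (p i u).
have ms : measurable_fun setT s by apply: measurable_sum => i; exact: measurableT_comp.
have sE w : \sum_(i < n) y (X i w) = s (V w).
  by apply: eq_bigr => i _; rewrite (Xp _ _ (ltn_ord i)).
move: IH; under eq_Rintegral do rewrite sE.
under [X in _ -> `|X - _| <= _]eq_Rintegral do rewrite big_ord_recr /= sE.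
set q := expR _; set C := \int[P]_w _ => IH.
pose gc := \int[mu]_x cos (a * y x); pose gs := \int[mu]_x sin (a * y x).
have Ec : `|gc - q| <= _ := Ecos; have Es : `|gs| <= _ := Esin.
have ic : integ P (fun w => cos (a * s (V w) + b)).
  by apply: (integ_bounded P (c := 1)) => [|w]; [mea|exact: cos_max].
have is_ : integ P (fun w => sin (a * s (V w) + b)).
  by apply: (integ_bounded P (c := 1)) => [|w]; [mea|exact: sin_max].
have Cb : `|C| <= 1.
  rewrite -[leRHS](Rint_cst P); apply: Rint_norm_le => //; first exact: integ_cst.
  by move=> w; exact: cos_max.
have Sb : `|\int[P]_w sin (a * s (V w) + b)| <= 1.
  rewrite -[leRHS](Rint_cst P); apply: Rint_norm_le => //; first exact: integ_cst.
  by move=> w; exact: sin_max.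
have -> : \int[P]_w cos (a * (s (V w) + y (X n w)) + b) =
    gc * C - gs * \int[P]_w sin (a * s (V w) + b).
  rewrite (step (fun z => cos (a * (s z.1 + y z.2) + b)) 1) /=; last 2 first.
  - by mea.
  - by move=> z; exact: cos_max.
  rewrite -!RintZ // -RintB; [|exact: integZ|exact: integZ].
  apply: eq_Rintegral => w _.
  transitivity (\int[mu]_x (cos (a * s (V w) + b) * cos (a * y x) -
      sin (a * s (V w) + b) * sin (a * y x))).
    apply: eq_Rintegral => x _.
    by rewrite -cosD; congr cos; ring.
  by rewrite RintB ?RintZ //; [rewrite mulrC (mulrC (sin _))|exact: integZ|exact: integZ].
set S := \int[P]_w _ in Sb *.
have q0 : 0 <= q by exact: expR_ge0.
have q1 : q <= 1.
  by rewrite /q -[leRHS]expR0 ler_expR oppr_le0 divr_ge0 // (mulr_ge0 (sqr_ge0 a) v0).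
have -> : gc * C - gs * S - q ^+ n.+1 * cos b =
    (gc - q) * C - gs * S + q * (C - q ^+ n * cos b) by rewrite exprS; ring.
have -> : n.+1%:R * delta = delta + n%:R * delta by rewrite -natr1 mulrDl mul1r addrC.
apply: le_trans (ler_normD _ _) _; apply: lerD; last first.
  by rewrite normrM (ger0_norm q0); apply: le_trans IH; rewrite ler_piMl.
apply: le_trans (ler_normB _ _) _; rewrite !normrM /delta.
have : `|gc - q| * `|C| <= (`|a| * c) ^+ 3 + (a ^+ 2 * v / 2) ^+ 2.
  by apply: le_trans Ec; rewrite ler_piMr.
have : `|gs| * `|S| <= (`|a| * c) ^+ 3 by apply: le_trans Es; rewrite ler_piMr.
by move=> *; lra.
Qed.

End fixed_frequency.

(** At [a = t / sqrt n] the product of the [n] exponentials is exactly the limit, and the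
    accumulated error [n * delta] is at most [D / sqrt n], below [e] once [n >= (D / e)^2]. *)
Lemma cos_clt t b :
  \int[P]_w cos (t * ((Num.sqrt n%:R)^-1 * \sum_(i < n) y (X i w)) + b) @[n --> \oo] -->
  cos b * expR (- (t ^+ 2 * v / 2)).
Proof.
pose D := 2 * (`|t| * c) ^+ 3 + (t ^+ 2 * v / 2) ^+ 2.
have D0 : 0 <= D by rewrite addr_ge0 ?sqr_ge0 // mulr_ge0 // exprn_ge0 // mulr_ge0.
apply/cvgrPdist_le => e e0; near=> n.
have n0 : 0 < n%:R :> R by rewrite ltr0n; near: n; exact: nbhs_infty_gt.
have sn0 : 0 < Num.sqrt n%:R :> R by rewrite sqrtr_gt0.
have nE : n%:R = Num.sqrt n%:R ^+ 2 :> R by rewrite sqr_sqrtr // ltW.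
pose a := t / Num.sqrt n%:R; have := cos_sum a b n.
have -> : expR (- (a ^+ 2 * v / 2)) ^+ n = expR (- (t ^+ 2 * v / 2)).
  rewrite -expRM_natr; congr expR; rewrite /a.
  by move: nE sn0; set q := Num.sqrt _ => -> q0; field; rewrite gt_eqF.
under eq_Rintegral do rewrite /a -mulrA.
rewrite mulrC distrC => /le_trans; apply.
have s1 : 1 <= Num.sqrt n%:R :> R by rewrite -[leLHS]sqrtr1 ler_wsqrtr // ler1n -(ltr0n R).
have De : D <= e * Num.sqrt n%:R.
  rewrite mulrC -ler_pdivrMr // -[leLHS]ger0_norm ?divr_ge0 ?(ltW e0) //.
  rewrite -sqrtr_sqr ler_wsqrtr //; near: n; exact: nbhs_infty_ger.
rewrite -[leRHS](mulfK (lt0r_neq0 sn0)) ler_pdivlMr //; apply: le_trans De.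
rewrite /a normrM normfV (ger0_norm (ltW sn0)).
rewrite /D; set q := Num.sqrt n%:R in nE sn0 s1 *; rewrite nE.
have -> : q ^+ 2 * (2 * (`|t| / q * c) ^+ 3 + ((t / q) ^+ 2 * v / 2) ^+ 2) * q =
   2 * (`|t| * c) ^+ 3 + (t ^+ 2 * v / 2) ^+ 2 / q by field; rewrite gt_eqF.
by rewrite lerD2l ler_pdivrMr // ler_peMr ?sqr_ge0.
Unshelve. all: end_near.
Qed.

End characteristic_function_of_sum.

(** * From characteristic functions to weak convergence *)

Section fejer_transform.
Context d {T : measurableType d} {R : realType} (Q : probability T R).
Local Notation leb := (@lebesgue_measure R).
Variable Z : T -> R.
Hypothesis mZ : measurable_fun setT Z.

(** The kernel is a mixture of cosines of frequencies in [[0, 1]], so its expectations are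
    determined by the characteristic function; the shift [y] goes into the phase. *)
Lemma expectation_fejer s y : \int[Q]_w fejer (s * (Z w - y)) =
  \int[leb]_u (tri u * \int[Q]_w cos (u * s * Z w + - (u * s * y))).
Proof.
have mt := @measurable_tri R.
have mF : measurable_fun setT (fun z : T * R => tri z.2 * cos (z.2 * (s * (Z z.1 - y)))) by mea.
have iF : integ (Q \x leb)%E (fun z : T * R => tri z.2 * cos (z.2 * (s * (Z z.1 - y)))).
  apply: (integ_prod (m1 := Q) (m2 := leb) (a := fun=> 1) mF (integ_cst Q 1) (@integ_tri R)).
  by move=> w u /=; rewrite mul1r normrM (ger0_norm (tri_ge0 u)) ler_piMr ?tri_ge0 ?cos_max.
rewrite /fejer (Rint_swap (m1 := Q) (m2 := leb) iF) /=.
apply: eq_Rintegral => u _; rewrite RintZ.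
  by congr (_ * _); apply: eq_Rintegral => w _; congr cos; ring.
by apply: (integ_bounded Q (c := 1)) => [|w]; [mea|exact: cos_max].
Qed.

Lemma expectation_fejer_smoothing (g : R -> R) s : integ leb g ->
  \int[Q]_w \int[leb]_y (g y * fejer (s * (Z w - y))) =
  \int[leb]_y (g y * \int[Q]_w fejer (s * (Z w - y))).
Proof.
move=> ig; have mg := integ_mfun ig; have mf := @measurable_fejer R.
have mF : measurable_fun setT (fun z : T * R => g z.2 * fejer (s * (Z z.1 - z.2))) by mea.
have iF : integ (Q \x leb)%E (fun z : T * R => g z.2 * fejer (s * (Z z.1 - z.2))).
  apply: (integ_prod (m1 := Q) (m2 := leb) (a := fun=> 1) mF (integ_cst Q 1) (integ_norm ig)).
  move=> w u /=; rewrite mul1r normrM ler_piMr //.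
  by rewrite (ger0_norm (fejer_ge0 _)) fejer_le1.
rewrite (Rint_swap (m1 := Q) (m2 := leb) iF) /=.
apply: eq_Rintegral => u _; rewrite RintZ //.
apply: (integ_bounded Q (c := 1)) => [|w]; first by mea.
by rewrite (ger0_norm (fejer_ge0 _)) fejer_le1.
Qed.

Lemma measurable_expectation_cos s y :
  measurable_fun setT (fun u : R => \int[Q]_w cos (u * s * Z w + - (u * s * y))).
Proof.
apply: (measurable_Rint (m2 := Q) (F := fun z : R * T => cos (z.1 * s * Z z.2 + - (z.1 * s * y)))).
  by mea.
by move=> u; apply: (integ_bounded Q (c := 1)) => [|w]; [mea|exact: cos_max].
Qed.

Lemma measurable_expectation_fejer s :
  measurable_fun setT (fun y : R => \int[Q]_w fejer (s * (Z w - y))).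
Proof.
have mf := @measurable_fejer R.
apply: (measurable_Rint (m2 := Q) (F := fun z : R * T => fejer (s * (Z z.2 - z.1)))).
  by mea.
move=> u; apply: (integ_bounded Q (c := 1)) => [|w]; first by mea.
by rewrite (ger0_norm (fejer_ge0 _)) fejer_le1.
Qed.

Lemma norm_Rint_le1 (g : T -> R) : measurable_fun setT g -> (forall w, `|g w| <= 1) ->
  `|\int[Q]_w g w| <= 1.
Proof.
move=> mg g1; rewrite -[leRHS](Rint_cst Q).
by apply: Rint_norm_le => //; [exact: integ_bounded mg g1|exact: integ_cst].
Qed.

End fejer_transform.

Section uniform_continuity.
Context {R : realType}.
Local Notation leb := (@lebesgue_measure R).
Variables (g : R -> R) (A : R).
Hypotheses (cg : continuous g) (g0 : forall x, A <= `|x| -> g x = 0).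

Lemma compact_support_unif e : 0 < e ->
  exists2 r : R, 0 < r & forall x y, `|x - y| < r -> `|g x - g y| <= e.
Proof.
move=> e0.
have /compact_near_coveringP cK : compact (`[- (A + 1), A + 1]%classic : set R).
  exact: segment_compact.
have H : \forall r \near (0 : R)^'+, `[- (A + 1), A + 1]%classic `<=`
    [set x | forall y, `|x - y| < r -> `|g x - g y| <= e].
  apply: cK => x _; have cgx : g y @[y --> x] --> g x := @cg x.
  move/cvgrPdist_lt : cgx => /(_ (e / 2)); rewrite divr_gt0 // => /(_ isT).
  move=> /nbhs_ballP [r /= r0 Hr].
  exists (ball x (r / 2), [set s | s < r / 2]).
    split => /=; first by apply: nbhsx_ballx; rewrite divr_gt0.
    by apply: nbhs_right_lt; rewrite divr_gt0.
  move=> [x' s] [/= xx' sr] y x'y.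
  have xx2 : `|x - x'| < r / 2 by [].
  have h1 : `|g x - g x'| < e / 2 by apply: Hr; rewrite /ball /=; lra.
  have h2 : `|g x - g y| < e / 2.
    apply: Hr; rewrite /ball /= -(subrKA x').
    by apply: (le_lt_trans (ler_normD _ _)); have := lt_trans x'y sr; lra.
  have -> : g x' - g y = (g x - g y) - (g x - g x') by ring.
  by apply: (le_trans (ler_normB _ _)); lra.
(* [r < 1] settles the points off the segment: if [|x| > A + 1], then [|y| > A] and both values
   vanish. *)
have [r [[r0 r1] Kr]] := filter_ex (filterI (filterI (nbhs_right_gt 0) (nbhs_right_lt ltr01)) H).
exists r => // x y xy; have [xA|xA] := leP `|x| (A + 1).
  by apply: (Kr x) => //; rewrite /= in_itv /= -ler_norml.
rewrite !g0 ?subrr ?normr0 ?(ltW e0) //; last by lra.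
have : `|x| <= `|x - y| + `|y| by rewrite -[in leLHS](subrK y x) ler_normD.
by lra.
Qed.
End uniform_continuity.

Section fejer_approximation.
Context {R : realType}.
Local Notation leb := (@lebesgue_measure R).
Let cF := \int[leb]_t (fejer t : R).
Variables (g : R -> R) (A : R).
Hypotheses (A0 : 0 <= A) (cg : continuous g) (g0 : forall x, A <= `|x| -> g x = 0).

(** Convolution of [g] with [s fejer (s .) / cF], an approximate identity of mass 1 as [s] grows. *)
Definition fejer_mean (s z : R) : R := s / cF * \int[leb]_y (g y * fejer (s * (z - y))).

Let cF0 : 0 < cF. Proof. exact: Rint_fejer_gt0. Qed.
Let ig : integ leb g. Proof. exact: integ_compact_support A0 cg g0. Qed.
Let mg : measurable_fun setT g := integ_mfun ig.
Let mf := @measurable_fejer R.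

Lemma integ_fejer_mean s z : integ leb (fun y => g y * fejer (s * (z - y))).
Proof.
apply: (integbM (c := 1)) => //; first by mea.
by move=> y; rewrite ger0_norm ?fejer_ge0 ?fejer_le1.
Qed.

Lemma measurable_fejer_mean s : measurable_fun setT (fejer_mean s).
Proof.
have mI : measurable_fun setT (fun z : R => \int[leb]_y (g y * fejer (s * (z - y)))).
  apply: (measurable_Rint (m2 := leb) (F := fun z : R * R => g z.2 * fejer (s * (z.1 - z.2)))).
    by mea.
  by move=> z; exact: integ_fejer_mean.
by rewrite /fejer_mean; mea.
Qed.

Lemma fejer_meanE s z : 0 < s -> fejer_mean s z = cF^-1 * \int[leb]_x (g (s^-1 * x + z) * fejer x).
Proof.
move=> s0; have s'0 : 0 < s^-1 by rewrite invr_gt0.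
have igs := integ_affine z s'0 ig.
have mgs := integ_mfun igs.
have ip : integ leb (fun x => g (s^-1 * x + z) * fejer x).
  apply: (integbM (c := 1)) => //.
  by move=> y; rewrite ger0_norm ?fejer_ge0 ?fejer_le1.
have := Rint_affine (- (s * z)) s0 ip.
have E y : g (s^-1 * (s * y + - (s * z)) + z) * fejer (s * y + - (s * z)) =
    g y * fejer (s * (z - y)).
  congr (g _ * _); first by field; rewrite gt_eqF.
  by rewrite -fejerN; congr fejer; ring.
under eq_Rintegral do rewrite E.
rewrite /fejer_mean => ->; field; rewrite !gt_eqF //.
Qed.

Lemma fejer_mean_cvg e : 0 < e ->
  exists2 s : R, 0 < s & forall z, `|fejer_mean s z - g z| <= e.
Proof.
move=> e0; have [M gM] := compact_support_bounded A0 cg g0.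
have M0 : 0 <= M := le_trans (normr_ge0 _) (gM 0).
have [r r0 gr] := compact_support_unif cg g0 (divr_gt0 e0 (ltr0n R 2)).
(* Majorant, up to [e / 2 * fejer x], of the error at all points [z] at once: where the minimum is
   below 1 uniform continuity applies, elsewhere [2 M] is enough. Its integral tends to 0 by
   domination, which spares an explicit tail estimate. *)
pose w n x : R := 2 * M * (Num.min 1 (`|x| / (n.+1%:R * r)) * fejer x).
have mw n : measurable_fun setT (w n).
  rewrite /w; apply: measurable_funM => //; apply: measurable_funM => //.
  by apply: measurable_minr => //; mea.
have wE n (x : R) : 0 <= Num.min 1 (`|x| / (n.+1%:R * r)) <= 1.
  by rewrite le_min ler01 ge_min lexx andbT /= divr_ge0 // mulr_ge0 // ltW.
have wb n x : `|w n x| <= 2 * M * fejer x.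
  have /andP[h0 h1] := wE n x.
  rewrite /w ger0_norm ?mulr_ge0 ?fejer_ge0 //.
  by rewrite ler_wpM2l ?mulr_ge0 // ler_piMl ?fejer_ge0.
have iM : integ leb (fun x => 2 * M * fejer x) := integZ (2 * M) (@integ_fejer R).
have W : \int[leb]_x w n x @[n --> \oo] --> \int[leb]_x (cst 0 x : R).
  apply: (dominated_Rint _ _ iM) => // x.
  have wq n : `|w n x| <= 2 * M * `|x| / r * n.+1%:R^-1.
    have /andP[h0 h1] := wE n x.
    rewrite /w ger0_norm ?mulr_ge0 ?fejer_ge0 // -!mulrA ler_wpM2l // ler_wpM2l //.
    apply: (@le_trans _ _ (Num.min 1 (`|x| / (n.+1%:R * r)))).
      by rewrite ler_piMr ?fejer_le1.
    by rewrite ge_min invfM (mulrC r^-1) lexx orbT.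
  have L0 : 2 * M * `|x| / r * n.+1%:R^-1 @[n --> \oo] --> (0 : R).
    by rewrite -[X in _ --> X](mulr0 (2 * M * `|x| / r)); apply: cvgM; [exact: cvg_cst|exact: cvg_harmonic].
  apply/cvgr0Pnorm_le => d d0; move/cvgrPdist_le : L0 => /(_ d d0); apply: filterS => n.
  by rewrite sub0r normrN; apply: le_trans; rewrite (le_trans (wq n)) // ler_norm.
rewrite Rintegral_cst // mul0r in W.
move/cvgrPdist_le : W => /(_ (e / 2 * cF)); rewrite mulr_gt0 ?divr_gt0 // => /(_ isT).
move=> [n _ /(_ n (leqnn n))]; rewrite sub0r normrN => /(le_trans (ler_norm _)) Wn.
exists n.+1%:R => // z; rewrite fejer_meanE //.
have s'0 : 0 < n.+1%:R^-1 :> R by rewrite invr_gt0.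
have mgs := integ_mfun (integ_affine z s'0 ig).
have ip : integ leb (fun x => g (n.+1%:R^-1 * x + z) * fejer x).
  by apply: (integMb (c := M)) => //; exact: integ_fejer.
have iz := integZ (g z) (@integ_fejer R).
have iw : integ leb (w n) by apply: integ_le iM _; [exact: mw|exact: wb].
have -> : cF^-1 * \int[leb]_x (g (n.+1%:R^-1 * x + z) * fejer x) - g z =
    cF^-1 * \int[leb]_x (g (n.+1%:R^-1 * x + z) * fejer x - g z * fejer x).
  rewrite (RintB ip iz) RintZ ?integ_fejer // -/cF mulrBr; congr (_ - _).
  by rewrite mulrCA mulVf ?mulr1 // gt_eqF.
rewrite normrM normfV (ger0_norm (ltW cF0)) mulrC ler_pdivrMr //.
have -> : e * cF = \int[leb]_x (e / 2 * fejer x) + e / 2 * cF.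
  by rewrite (RintZ _ (@integ_fejer R)) -/cF; field.
apply: le_trans (lerD (lexx _) Wn).
rewrite -RintD //; last by apply: integZ; exact: integ_fejer.
apply: Rint_norm_le.
- exact: integB.
- by apply: integD => //; apply: integZ; exact: integ_fejer.
move=> x; rewrite -mulrBl normrM (ger0_norm (fejer_ge0 x)) /w mulrA -mulrDl.
rewrite ler_wpM2r ?fejer_ge0 //.
have [xr|xr] := ltP (`|x| / (n.+1%:R * r)) 1.
  apply: (@le_trans _ _ (e / 2)).
    apply: gr; rewrite addrK normrM normfV normr_nat mulrC ltr_pdivrMr //.
    by move: xr; rewrite ltr_pdivrMr ?mulr_gt0 // mul1r mulrC.
  by rewrite lerDl (mulr_ge0 (mulr_ge0 _ M0)) ?divr_ge0 ?mulr_ge0 ?(ltW r0).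
rewrite mulr1 (le_trans (ler_normB _ _)) //.
have h1 := gM (n.+1%:R^-1 * x + z); have h2 := gM z.
by have : 0 <= e by [exact: ltW]; lra.
Qed.

End fejer_approximation.

Section weak_convergence.
Context {R : realType} {d : measure_display} {Omega : measurableType d}.
Local Notation leb := (@lebesgue_measure R).
Variables (P : probability Omega R) (Z : nat -> Omega -> R).
Variable m : probability (measurableTypeR R) R.
Hypothesis mZ : forall n, measurable_fun setT (Z n).
Hypothesis cos_cvg : forall a b : R,
  \int[P]_w cos (a * Z n w + b) @[n --> \oo] --> \int[m]_z cos (a * z + b).

Let fejer_cvg s y :
  \int[P]_w fejer (s * (Z n w - y)) @[n --> \oo] --> \int[m]_z fejer (s * (z - y)).
Proof.
under eq_fun do rewrite expectation_fejer //.
rewrite (expectation_fejer m (@measurable_id _ _ _)).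
have mt := @measurable_tri R.
apply: (dominated_Rint _ _ (@integ_tri R)).
- by move=> n; have := measurable_expectation_cos P (mZ n) s y => ?; mea.
- by have := measurable_expectation_cos m (@measurable_id _ _ _) s y => ?; mea.
- by move=> u; apply: cvgM; [exact: cvg_cst|exact: cos_cvg].
- move=> n u; rewrite normrM (ger0_norm (tri_ge0 u)) ler_piMr ?tri_ge0 //.
  by have := mZ n => ?; apply: norm_Rint_le1 => [|w]; [mea|exact: cos_max].
Qed.

Section compact_support.
Variables (g : R -> R) (A : R).
Hypotheses (A0 : 0 <= A) (cg : continuous g) (g0 : forall x, A <= `|x| -> g x = 0).

Let ig : integ leb g. Proof. exact: integ_compact_support A0 cg g0. Qed.

Let fejer_mean_bound s : exists B : R, forall z, `|fejer_mean g s z| <= B.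
Proof.
exists (`|s / \int[leb]_t fejer t| * \int[leb]_y `|g y|) => z.
rewrite /fejer_mean normrM ler_wpM2l //; apply: Rint_norm_le.
- exact: integ_fejer_mean A0 cg g0 s z.
- exact: integ_norm.
- move=> y; rewrite normrM ler_piMr //.
  by rewrite ger0_norm ?fejer_ge0 ?fejer_le1.
Qed.

Let mean_cvg s :
  \int[P]_w fejer_mean g s (Z n w) @[n --> \oo] --> \int[m]_z fejer_mean g s z.
Proof.
have mg := integ_mfun ig; have mf := @measurable_fejer R.
have E d' (T : measurableType d') (Q : probability T R) (V : T -> R) : measurable_fun setT V ->
    \int[Q]_w fejer_mean g s (V w) =
    s / (\int[leb]_t fejer t) * \int[leb]_y (g y * \int[Q]_w fejer (s * (V w - y))).
  move=> mV; rewrite -(expectation_fejer_smoothing Q mV s ig) /fejer_mean RintZ //.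
  have mI : measurable_fun setT (fun w => \int[leb]_y (g y * fejer (s * (V w - y)))).
    apply: (measurable_Rint (m2 := leb) (F := fun z : T * R => g z.2 * fejer (s * (V z.1 - z.2)))).
      by mea.
    by move=> w; exact: integ_fejer_mean A0 cg g0 s (V w).
  apply: (integ_bounded Q mI (c := \int[leb]_y `|g y|)) => w; apply: Rint_norm_le.
  - exact: integ_fejer_mean A0 cg g0 s (V w).
  - exact: integ_norm.
  - move=> y; rewrite normrM ler_piMr //.
    by rewrite ger0_norm ?fejer_ge0 ?fejer_le1.
under eq_fun do rewrite (E _ _ P) //.
rewrite (E _ _ m _ (@measurable_id _ _ _)).
apply: cvgM; first exact: cvg_cst.
apply: (dominated_Rint _ _ (integ_norm ig)).
- by move=> n; have := measurable_expectation_fejer P (mZ n) s => ?; mea.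
- by have := measurable_expectation_fejer m (@measurable_id _ _ _) s => ?; mea.
- by move=> y; apply: cvgM; [exact: cvg_cst|exact: fejer_cvg].
- move=> n y; rewrite normrM ler_piMr //; have := mZ n => ?.
  apply: norm_Rint_le1 => [|w]; first by mea.
  by rewrite ger0_norm ?fejer_ge0 ?fejer_le1.
Qed.

(** The Fejer means approximate [g] uniformly, so replacing [g] by its mean costs [e / 3] under
    every law, and convergence for the means is already known. *)
Lemma compact_support_cvg : \int[P]_w g (Z n w) @[n --> \oo] --> \int[m]_z g z.
Proof.
have mg := integ_mfun ig; have [M gM] := compact_support_bounded A0 cg g0.
apply/cvgrPdist_le => e e0.
have [s s0 gs] := fejer_mean_cvg A0 cg g0 (divr_gt0 e0 (ltr0n R 3)).
have [B hB] := fejer_mean_bound s; have mh := measurable_fejer_mean A0 cg g0 s.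
have near_mean d' (T : measurableType d') (Q : probability T R) (V : T -> R) : measurable_fun setT V ->
    `|\int[Q]_w fejer_mean g s (V w) - \int[Q]_w g (V w)| <= e / 3.
  move=> mV; have i1 : integ Q (fun w => fejer_mean g s (V w)).
    by apply: (integ_bounded Q (c := B)) => // ; exact: measurableT_comp.
  have i2 : integ Q (fun w => g (V w)).
    by apply: (integ_bounded Q (c := M)) => // ; exact: measurableT_comp.
  rewrite -RintB // -[leRHS](Rint_cst Q); apply: Rint_norm_le.
  - exact: integB.
  - exact: integ_cst.
  - by move=> w; exact: gs.
have /cvgrPdist_le := @mean_cvg s; move=> /(_ (e / 3)); rewrite divr_gt0 // => /(_ isT).
apply: filterS => n hn.
have h1 := near_mean _ _ P _ (mZ n); have h2 := near_mean _ _ m _ (@measurable_id _ _ _).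
set a := \int[m]_z g z in h2 *; set b := \int[P]_w g (Z n w) in h1 *.
set a' := \int[m]_z _ in h2 hn; set b' := \int[P]_w _ in h1 hn.
have -> : a - b = (a' - b') + (b' - b) - (a' - a) by ring.
apply: (le_trans (ler_normB _ _)); have := ler_normD (a' - b') (b' - b); lra.
Qed.

End compact_support.

(** The nonnegative function [g + M] is minorised by its cutoffs, for which convergence holds, and
    under [m] the cutoffs lose little. As all laws have mass 1, the constant [M] cancels; this takes
    the place of a tightness argument. *)
Let lower_semicontinuity (g : R -> R) (M e : R) : continuous g -> (forall x, `|g x| <= M) -> 0 < e ->
  \forall n \near \oo, \int[m]_z g z - e <= \int[P]_w g (Z n w).
Proof.
move=> cg gM e0; have mg := continuous_measurable_fun cg.
have M0 : 0 <= M := le_trans (normr_ge0 _) (gM 0).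
pose u k x := (g x + M) * cutoff k.+1%:R x.
have gM0 x : 0 <= g x + M by have := gM x; rewrite ler_norml => /andP[]; lra.
have cu k : continuous (u k).
  move=> x; apply: cvgM; last exact: continuous_cutoff.
  by apply: cvgD; [exact: cg|exact: cvg_cst].
have u0 k x : 2 * k.+1%:R <= `|x| -> u k x = 0.
  by move=> ?; rewrite /u cutoff_eq0 ?mulr0.
have ug k x : u k x <= g x + M by rewrite /u ler_piMr ?cutoff_le1.
have uge k x : 0 <= u k x by rewrite /u mulr_ge0 ?cutoff_ge0.
have gMb x : g x + M <= M + M by rewrite lerD2r; exact: le_trans (ler_norm _) (gM x).
have mgM : measurable_fun setT (fun x => g x + M) by mea.
have mu k : measurable_fun setT (u k) := continuous_measurable_fun (cu k).
have ub k x : `|u k x| <= M + M by rewrite ger0_norm // (le_trans (ug k x)).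
have gMn x : `|g x + M| <= M + M by rewrite ger0_norm.
have : \int[m]_z u k z @[k --> \oo] --> \int[m]_z (g z + M).
  apply: (dominated_Rint _ _ (integ_cst m (M + M))) => // x.
  apply: cvg_near_cst; near=> k.
  rewrite /u cutoff_eq1 ?mulr1 // -natr1 (@le_trans _ _ k%:R) ?lerDl //.
  near: k; exact: nbhs_infty_ger.
move/cvgrPdist_le => /(_ (e / 2)); rewrite divr_gt0 // => /(_ isT) [k _ /(_ k (leqnn k)) hk].
have := compact_support_cvg (mulr_ge0 (ler0n R 2) (ler0n R k.+1)) (cu k) (u0 k).
move/cvgrPdist_le => /(_ (e / 2)); rewrite divr_gt0 // => /(_ isT).
apply: filterS => n; have := mZ n => mZn hn.
have mgZ : measurable_fun setT (fun w => g (Z n w)) by exact: measurableT_comp.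
have igZ := integ_bounded P mgZ (fun w => gM (Z n w)).
have ig := integ_bounded m mg gM.
have Em : \int[m]_z (g z + M) = \int[m]_z g z + M by rewrite (RintD ig (integ_cst m M)) Rint_cst.
have EP : \int[P]_w (g (Z n w) + M) = \int[P]_w g (Z n w) + M.
  by rewrite (RintD igZ (integ_cst P M)) Rint_cst.
have muZ : measurable_fun setT (fun w => u k (Z n w)) by exact: measurableT_comp.
have : \int[P]_w u k (Z n w) <= \int[P]_w (g (Z n w) + M).
  apply: Rint_le => //; first exact: integ_bounded muZ (fun w => ub k (Z n w)).
  exact: integD igZ (integ_cst P M).
have := ler_normlW hk; have := ler_normlW hn; rewrite Em EP.
by set a := \int[P]_w g _; set b := \int[m]_z g z; set c := \int[P]_w _; set f := \int[m]_z _; lra.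
Unshelve. all: end_near.
Qed.

(* Convergence of the expectations of [cos (a Z + b)] for all [a] and [b] is
   that of the characteristic functions. *)
Lemma cvg_in_distribution_cos : cvg_in_distribution P Z m.
Proof.
move=> g cg [M gM]; have mg := continuous_measurable_fun cg.
have igZ n : integ P (fun w => g (Z n w)).
  have := mZ n => mZn.
  by apply: integ_bounded (fun w => gM (Z n w)); exact: measurableT_comp.
rewrite (Rint_EFin (integ_bounded m mg gM)).
under eq_fun do rewrite unlock (Rint_EFin (igZ _)).
apply: cvg_EFin; first exact: nearW.
apply/cvgrPdist_le => e e0.
have cNg : continuous (fun x => - g x) by move=> x; apply: cvgN; exact: cg.
have gNM x : `|- g x| <= M by rewrite normrN.
have NR d' (T : measurableType d') (Q : probability T R) (V : T -> R) : measurable_fun setT V ->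
    \int[Q]_w (- g (V w)) = - \int[Q]_w g (V w).
  move=> mV; rewrite -mulN1r -RintZ; first by apply: eq_Rintegral => w _; rewrite mulN1r.
  by apply: integ_bounded (fun w => gM (V w)); exact: measurableT_comp.
(* The upper bound is the lower one for [- g]. *)
have := lower_semicontinuity cNg gNM e0; have := lower_semicontinuity cg gM e0.
apply: filterS2 => n; rewrite (NR _ _ P (Z n) (mZ n)) (NR _ _ m _ (@measurable_id _ _ _)).
rewrite /=.
by rewrite ler_norml => *; apply/andP; split; lra.
Qed.

End weak_convergence.

(** * Rates of convergence *)

Section rates.
Context {R : realType}.
Variable alpha : R.
Hypothesis a0 : 0 < alpha.

(** The bandwidth [n^(-2/(4 alpha+1))] balances bias and degenerate part: [h^(2 alpha)] is of the
    order of the rate and [1 / (n^2 h)] of its square. *)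
Definition rate (x : R) : R := x `^ (- (4 * alpha / (4 * alpha + 1))).

Let k0 : 0 < 4 * alpha + 1. Proof. by have := a0; lra. Qed.
Let kn : 4 * alpha + 1 != 0. Proof. by rewrite gt_eqF. Qed.

Lemma rate_gt0 x : 0 < x -> 0 < rate x. Proof. exact: powR_gt0. Qed.

Let rate2 x : rate x ^+ 2 = x `^ (- (8 * alpha / (4 * alpha + 1))).
Proof.
rewrite -powR_mulrn ?powR_ge0 // /rate -powRrM; congr (_ `^ _).
by field.
Qed.

Section fixed.
Variable x : R.
Hypothesis x1 : 1 <= x.
Let x0 : 0 < x. Proof. exact: lt_le_trans ltr01 x1. Qed.
Let xn : x != 0. Proof. by rewrite gt_eqF. Qed.

Lemma bandwidth_powR_le (h C : R) : 0 < h -> 0 <= C ->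
  h / x `^ (- (2 / (4 * alpha + 1))) <= C -> h `^ (2 * alpha) <= C `^ (2 * alpha) * rate x.
Proof.
move=> h0 C0; rewrite ler_pdivrMr ?powR_gt0 // => hC.
have -> : rate x = (x `^ (- (2 / (4 * alpha + 1)))) `^ (2 * alpha).
  by rewrite /rate -powRrM; congr (_ `^ _); field.
rewrite -powRM ?powR_ge0 //; apply: ge0_ler_powR => //.
- by rewrite mulr_ge0 // ltW.
- by rewrite nnegrE ltW.
- by rewrite nnegrE mulr_ge0 ?powR_ge0.
Qed.

Lemma inv_bandwidth_le (h c : R) : 0 < h -> 0 < c ->
  c <= h / x `^ (- (2 / (4 * alpha + 1))) -> 1 / (x ^+ 2 * h) <= c^-1 * rate x ^+ 2.
Proof.
move=> h0 c0; rewrite ler_pdivlMr ?powR_gt0 // => hc.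
have -> : rate x ^+ 2 = (x ^+ 2 * x `^ (- (2 / (4 * alpha + 1))))^-1.
  rewrite rate2 -(powR_mulrn 2 (ltW x0)) -powRD ?xn ?implybT // -powRN.
  by congr (_ `^ _); field.
rewrite mul1r -invfM lef_pV2 ?posrE ?mulr_gt0 ?exprn_gt0 ?powR_gt0 //.
by rewrite mulrCA ler_wpM2l ?sqr_ge0.
Qed.

Lemma inv_le_rate : x^-1 <= rate x.
Proof.
rewrite -powR_inv1 ?(ltW x0) //; apply: ler_powR => //.
by rewrite lerN2 ler_pdivrMr // mul1r lerDl.
Qed.

(** The threshold: [8 alpha / (4 alpha + 1) <= 1] exactly when [alpha <= 1/4]. The variance of the
    linear term, of order [1 / n], is then within the squared rate. *)
Lemma inv_le_rate2 : alpha <= 1 / 4 -> x^-1 <= rate x ^+ 2.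
Proof.
move=> a1; rewrite rate2 -powR_inv1 ?(ltW x0) //; apply: ler_powR => //.
by rewrite lerN2 ler_pdivrMr // mul1r; lra.
Qed.

End fixed.

Lemma rate2_cvg0 : 1 / 4 < alpha -> n%:R * rate n%:R ^+ 2 @[n --> \oo] --> 0.
Proof.
move=> a1; pose g := (4 * alpha - 1) / (4 * alpha + 1).
have g0 : 0 < g by rewrite divr_gt0 //; lra.
apply/cvgr0Pnorm_le => e e0; near=> n.
have n0 : 0 < n%:R :> R by rewrite ltr0n; near: n; exact: nbhs_infty_gt.
have nn : n%:R != 0 :> R by rewrite gt_eqF.
rewrite rate2 -[X in X * _](powRr1 (ltW n0)) -powRD ?nn ?implybT //.
have -> : 1 - 8 * alpha / (4 * alpha + 1) = - g by rewrite /g; field.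
rewrite ger0_norm ?powR_ge0 // powRN -[leRHS]invrK lef_pV2 ?posrE ?invr_gt0 ?powR_gt0 //.
have -> : e^-1 = (e `^ (- g^-1)) `^ g.
  by rewrite -powRrM mulNr mulVf ?gt_eqF // powR_inv1 // ltW.
apply: ge0_ler_powR; rewrite ?nnegrE ?powR_ge0 ?(ltW n0) ?(ltW g0) //.
near: n; exact: nbhs_infty_ger.
Unshelve. all: end_near.
Qed.

End rates.

(** * Consequences of mean-square estimates *)

Section mean_square.
Context {R : realType} {d : measure_display} {Omega : measurableType d}.
Variable P : probability Omega R.

Lemma chebyshev_Rint (Z : Omega -> R) (t : R) : measurable_fun setT Z ->
  integ P (fun w => Z w ^+ 2) -> 0 < t ->
  (P [set w | (t < `|Z w|)%R] <= (\int[P]_w (Z w ^+ 2) / t ^+ 2)%:E)%E.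
Proof.
move=> mZ iZ t0; set A := [set w | _].
have mA : measurable A.
  have -> : A = (fun w => `|Z w|) @^-1` `]t, +oo[%classic.
    by apply/seteqP; split => w; rewrite /A /= in_itv /= andbT.
  have mn : measurable_fun setT (fun w => `|Z w|) by exact: measurableT_comp.
  by rewrite -[X in measurable X]setTI; apply: mn.
have iA : integ P (\1_A : Omega -> R).
  apply: (integ_bounded P (c := 1)); first exact: measurable_indic.
  by move=> w; rewrite indicE; case: (_ \in _); rewrite ?normr1 ?normr0.
have -> : P A = (\int[P]_w (\1_A w : R))%:E.
  by rewrite -Rint_EFin // integral_indic // setIT.
rewrite lee_fin ler_pdivlMr ?exprn_gt0 // mulrC -RintZ //.
apply: Rint_le => //; first exact: integZ.
move=> w; rewrite indicE; case: (boolP (w \in A)) => [|_]; last by rewrite mulr0 sqr_ge0.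
move=> /set_mem; rewrite /A /= mulr1 => tZ.
by rewrite -[leRHS](real_normK (num_real _)) lerXn2r ?nnegrE ?(ltW t0) // ltW.
Qed.

Lemma cos_lipschitz (x y : R) : `|cos x - cos y| <= `|x - y|.
Proof.
wlog xy : x y / y <= x => [H|].
  by have [/H//|/ltW xy] := leP y x; rewrite distrC (distrC x); exact: H.
have [c _ ->] : exists2 c, c \in `[y, x]%R & cos x - cos y = - sin c * (x - y).
  apply: (@MVT_segment _ cos (fun c => - sin c)) => //.
  by apply: continuous_subspaceT; exact: continuous_cos.
by rewrite normrM normrN ler_piMl // sin_max.
Qed.

(** A Slutsky argument for cosines. They are 1-Lipschitz, and [|x| <= (t + x^2 / t) / 2] passes from
    the mean to the mean square; once the mean square is below [t^2], the bound is [|a| t]. *)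
Lemma cos_mean_square_cvg (Z W : nat -> Omega -> R) (a b l : R) :
  (forall n, measurable_fun setT (Z n)) -> (forall n, measurable_fun setT (W n)) ->
  (\forall n \near \oo, integ P (fun w => (Z n w - W n w) ^+ 2)) ->
  \int[P]_w ((Z n w - W n w) ^+ 2) @[n --> \oo] --> 0 ->
  \int[P]_w cos (a * W n w + b) @[n --> \oo] --> l ->
  \int[P]_w cos (a * Z n w + b) @[n --> \oo] --> l.
Proof.
move=> mZ mW iD D0 Wl.
suff H : \int[P]_w cos (a * Z n w + b) - \int[P]_w cos (a * W n w + b) @[n --> \oo] --> 0.
  have E n := esym (subrK (\int[P]_w cos (a * W n w + b)) (\int[P]_w cos (a * Z n w + b))).
  under eq_fun do rewrite E.
  by rewrite -[l]add0r; exact: (cvgD H Wl).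
apply/cvgr0Pnorm_le => e e0.
pose t := e / (`|a| + 1); have a1 : 0 < `|a| + 1 by rewrite ltr_pwDr.
have t0 : 0 < t by rewrite divr_gt0.
move/cvgrPdist_le : D0 => /(_ (t ^+ 2)); rewrite exprn_gt0 // => /(_ isT).
apply: filterS2 iD => n iD; rewrite sub0r normrN => /(le_trans (ler_norm _)) Dt.
have mZn := mZ n; have mWn := mW n.
have iZ : integ P (fun w => cos (a * Z n w + b)).
  by apply: (integ_bounded P (c := 1)) => [|w]; [mea|exact: cos_max].
have iW : integ P (fun w => cos (a * W n w + b)).
  by apply: (integ_bounded P (c := 1)) => [|w]; [mea|exact: cos_max].
have iB := integZ (`|a| / 2) (integD (integ_cst P t) (integZ t^-1 iD)).
rewrite -RintB //; apply: (@le_trans _ _ (\int[P]_w (`|a| / 2 * (t + t^-1 * (Z n w - W n w) ^+ 2)))).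
  apply: Rint_norm_le => //; first exact: integB.
  move=> w; apply: le_trans (cos_lipschitz _ _) _.
  have -> : a * Z n w + b - (a * W n w + b) = a * (Z n w - W n w) by ring.
  rewrite normrM -mulrA ler_wpM2l //; set x := Z n w - W n w.
  rewrite -(real_normK (num_real x)) -subr_ge0.
  have -> : 2^-1 * (t + t^-1 * `|x| ^+ 2) - `|x| = (t - `|x|) ^+ 2 / (2 * t).
    by field; rewrite gt_eqF.
  by rewrite divr_ge0 ?sqr_ge0 // mulr_ge0 // ltW.
rewrite RintZ; last exact: integD (integ_cst P t) (integZ t^-1 iD).
rewrite (RintD (integ_cst P t) (integZ t^-1 iD)) Rint_cst RintZ //.
apply: (@le_trans _ _ (`|a| / 2 * (t + t))).
  rewrite ler_wpM2l ?divr_ge0 // lerD2l mulrC ler_pdivrMr // -expr2 //.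
have -> : `|a| / 2 * (t + t) = `|a| * t by field.
rewrite /t mulrA ler_pdivrMr // mulrC ler_wpM2l ?(ltW e0) //.
by rewrite lerDl.
Qed.

End mean_square.

Lemma measurable_T_stat (R : realType) (d : measure_display) (Omega : measurableType d)
    (P : probability Omega R) (X : nat -> {RV P >-> R}) (K : R -> R) h n :
  measurable_fun setT K -> measurable_fun setT (T_stat X K h n).
Proof.
move=> mK; rewrite /T_stat; apply: measurable_funM => //.
apply: measurable_sum => i.
rewrite (_ : (fun v => _) = fun v =>
  \sum_(j < n) if (i < j)%N then K ((X i v - X j v) / h) else 0); last first.
  by apply/funext => v; rewrite big_mkcond.
apply: measurable_sum => j; case: (i < j)%N; last exact: measurable_cst.
by mea.
Qed.

(** * Rate and limit law for a bounded density *)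

Section part_two_bounded.
Context {R : realType}.
Local Notation leb := (@lebesgue_measure R).
Variables (K : R -> R) (MK : R).
Hypotheses (hK : is_kernel K) (KM : forall u, `|K u| <= MK).
Variables (alpha r L : R) (h : nat -> R) (f : R -> R).
Hypotheses (ha : 0 < alpha <= 1 / 2) (r0 : 0 <= r) (h0 : forall n, 0 < h n).
Hypothesis hn : same_order h (fun n => n%:R `^ (- (2 / (4 * alpha + 1)))).
Hypotheses (hN : (sobolev_norm alpha f <= r%:E)%E).
Context {d : measure_display} {Omega : measurableType d}.
Variables (P : probability Omega R) (X : nat -> {RV P >-> R}).
Hypothesis iid : iid_with_density X f.
Hypotheses (iff : integ leb f) (f0 : forall x, 0 <= f x) (fL : forall x, f x <= L).

Let L0 : 0 <= L. Proof. exact: le_trans (f0 0) (fL 0). Qed.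
Let mf : measurable_fun setT f := integ_mfun iff.
Let a0 : 0 < alpha. Proof. by case/andP: ha. Qed.
Local Notation theta := (int_sq f).
Local Notation mu := (distribution P (X 0%N)).

Let y (x : R) : R := 2 * (f x - theta).
Let c : R := 2 * (L + `|theta|).
Let my : measurable_fun setT y. Proof. by rewrite /y; mea. Qed.
Let yc x : `|y x| <= c.
Proof.
rewrite /y /c normrM ger0_norm // ler_wpM2l // (le_trans (ler_normB _ _)) // lerD2r.
by rewrite ger0_norm.
Qed.
Let fn x : `|f x| <= L. Proof. by rewrite ger0_norm. Qed.

Let Ef : \int[mu]_x f x = theta.
Proof. by rewrite (Rint_mu iff iid mf fn); apply: eq_Rintegral => x _; rewrite expr2. Qed.

Let y0 : \int[mu]_x y x = 0.
Proof.
have i := integ_bounded mu mf fn.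
by rewrite /y RintZ ?(RintB i (integ_cst mu theta)) ?Ef ?Rint_cst ?subrr ?mulr0 //;
  exact: integB i (integ_cst mu theta).
Qed.

Let v := \int[mu]_x (y x ^+ 2).

Let vE : v = 4 * (\int[leb]_x (f x ^+ 3) - theta ^+ 2).
Proof.
have f2n x : `|f x ^+ 2| <= L ^+ 2 by rewrite normrX lerXn2r ?nnegrE.
have mf2 : measurable_fun setT (fun x => f x ^+ 2) by mea.
have i1 := integ_bounded mu mf fn; have i2 := integ_bounded mu mf2 f2n.
have -> : v = \int[mu]_x (4 * (f x ^+ 2 - 2 * theta * f x + theta ^+ 2)).
  by apply: eq_Rintegral => x _; rewrite /y; ring.
have i3 := integB i2 (integZ (2 * theta) i1).
rewrite (RintZ _ (integD i3 (integ_cst mu _))) (RintD i3 (integ_cst mu _)).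
rewrite (RintB i2 (integZ _ i1)) (RintZ _ i1) Ef Rint_cst (Rint_mu iff iid mf2 f2n).
have -> : \int[leb]_x (f x ^+ 2 * f x) = \int[leb]_x (f x ^+ 3).
  by apply: eq_Rintegral => x _; rewrite [RHS]exprSr.
by ring.
Qed.

Let v0 : 0 <= v. Proof. by apply: Rintegral_ge0 => x _; exact: sqr_ge0. Qed.

Let iX : mutually_independent X. Proof. by case: iid. Qed.
Let T n w := T_stat X K (h n) n w.
Let S n w := \sum_(i < n) y (X i w).
Let rem n w := T n w - \int[P]_w T n w - n%:R^-1 * S n w.
Let bias n := \int[P]_w T n w - theta.
Local Notation rho n := (rate alpha n%:R).

Let TE n w : T n w - theta = bias n + rem n w + n%:R^-1 * S n w.
Proof. by rewrite /rem /bias; ring. Qed.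

Let mT n : measurable_fun setT (T n).
Proof. exact: measurable_T_stat (kernel_measurable hK). Qed.
Let mS n : measurable_fun setT (S n).
Proof. by apply: measurable_sum => i; exact: measurableT_comp. Qed.
Let mrem n : measurable_fun setT (rem n).
Proof. by have := mT n => ?; have := mS n => ?; rewrite /rem; mea. Qed.

(** One constant for bias and remainder. The second variance term [L h^(2 alpha) / n] is within the
    squared rate because both [h^(2 alpha)] and [1 / n] are within a constant of the rate. *)
Let error_rate : exists2 D : R, 0 <= D & \forall n \near \oo,
  [/\ `|bias n| <= D * rho n, integ P (fun w => rem n w ^+ 2) &
      \int[P]_w (rem n w ^+ 2) <= D * rho n ^+ 2].
Proof.
case: hn => c1 [C1 [c10 C10 hcC]].
pose Ch := C1 `^ (2 * alpha).
have Ch0 : 0 <= Ch by exact: powR_ge0.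
have b0 : 0 <= bias_cst K r.
  rewrite /bias_cst !mulr_ge0 ?sqr_ge0 ?invr_ge0 ?(ltW (@Rint_fejer_gt0 R)) //.
  by apply: Rintegral_ge0 => u _; rewrite mulr_ge0 // addr_ge0.
have w0 : 0 <= r ^+ 2 * var_cst K MK by rewrite mulr_ge0 ?sqr_ge0 // (var_cst_ge0 KM).
have m0 : 0 <= c1^-1 + L * Ch by rewrite addr_ge0 ?mulr_ge0 ?invr_ge0 // ltW.
exists (bias_cst K r * Ch + r ^+ 2 * var_cst K MK * (c1^-1 + L * Ch)).
  exact: addr_ge0 (mulr_ge0 b0 Ch0) (mulr_ge0 w0 m0).
near=> n; have n2 : (2 <= n)%N by near: n; exact: nbhs_infty_ge.
have x1 : 1 <= n%:R :> R by rewrite ler1n (leq_trans _ n2).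
have x0 : 0 < n%:R :> R by rewrite (lt_le_trans ltr01).
have /andP[hc hC] : c1 <= h n / n%:R `^ (- (2 / (4 * alpha + 1))) <= C1.
  by near: n.
have hp := bandwidth_powR_le a0 x1 (h0 n) (ltW C10) hC.
have hi := inv_bandwidth_le a0 x1 (h0 n) c10 hc.
have rho0 := rate_gt0 alpha x0.
have hb := bias_bound hK KM ha r0 (h0 n) hN iid iff f0 fL n2.
have [ir hr] := remainder_bound hK KM ha r0 (h0 n) hN iid iff f0 fL n2.
split => //.
  apply: le_trans hb _; apply: le_trans (ler_wpM2l b0 hp) _.
  by rewrite mulrA ler_wpM2r ?(ltW rho0) // lerDl; exact: mulr_ge0.
apply: le_trans hr _; rewrite [leRHS]mulrDl.
apply: (@le_trans _ _ (r ^+ 2 * var_cst K MK * ((c1^-1 + L * Ch) * rho n ^+ 2))); last first.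
  by rewrite mulrA lerDr; apply: mulr_ge0 (sqr_ge0 _); exact: mulr_ge0.
rewrite ler_wpM2l // [leRHS]mulrDl ge_max; apply/andP; split.
  by apply: le_trans hi _; rewrite lerDl mulr_ge0 ?sqr_ge0 ?mulr_ge0.
apply: (@le_trans _ _ (L * Ch * rho n ^+ 2)); last first.
  by rewrite lerDr mulr_ge0 ?sqr_ge0 // invr_ge0 ltW.
rewrite -!mulrA ler_wpM2l // expr2 mulrA ler_pM ?powR_ge0 ?invr_ge0 ?(ltW x0) //.
exact: inv_le_rate.
Unshelve. all: end_near.
Qed.

Let integ_S2 n : integ P (fun w => S n w ^+ 2).
Proof.
have Sb w : `|S n w| <= n%:R * c by apply: sum_bound => //; exact: le_trans (yc 0).
apply: (integ_bounded P (c := (n%:R * c) ^+ 2)) => [|w]; first by have := mS n => ?; mea.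
by rewrite normrX lerXn2r ?nnegrE // (le_trans _ (Sb w)).
Qed.

Lemma bigO_P_bounded : alpha <= 1 / 4 ->
  bigO_P P (fun n w => T_stat X K (h n) n w - theta)
    (fun n => n%:R `^ (- (4 * alpha / (4 * alpha + 1)))).
Proof.
move=> a4 e e0; have [D D0 HD] := error_rate.
(* From [(x + y + z)^2 <= 3 (x^2 + y^2 + z^2)] for bias, remainder and linear term. Below, [C + 1]
   keeps the threshold of Chebyshev's inequality positive when [C = 0]. *)
pose C := 3 * (D ^+ 2 + D + v).
have C0 : 0 <= C by rewrite mulr_ge0 // !addr_ge0 ?sqr_ge0.
exists (Num.sqrt ((C + 1) / e)); near=> n.
have [hb ir hr] : [/\ `|bias n| <= D * rho n, integ P (fun w => rem n w ^+ 2) &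
    \int[P]_w (rem n w ^+ 2) <= D * rho n ^+ 2] by near: n.
have x1 : 1 <= n%:R :> R by near: n; exact: nbhs_infty_ger.
have x0 : 0 < n%:R :> R by rewrite (lt_le_trans ltr01).
have rho0 := rate_gt0 alpha x0.
have t0 : 0 < Num.sqrt ((C + 1) / e) * rho n.
  by rewrite mulr_gt0 // sqrtr_gt0 divr_gt0 // ltr_pwDr.
have mTn := mT n; have mSn := mS n; have mrn := mrem n.
have iB := integD (integD (integ_cst P (3 * bias n ^+ 2)) (integZ 3 ir))
  (integZ (3 * n%:R^-1 ^+ 2) (integ_S2 n)).
have le w : (T n w - theta) ^+ 2 <=
    3 * bias n ^+ 2 + 3 * rem n w ^+ 2 + 3 * n%:R^-1 ^+ 2 * S n w ^+ 2.
  rewrite TE; set a := bias n; set b := rem n w; set s := n%:R^-1; set q := S n w.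
  have := sqr_ge0 (a - b); have := sqr_ge0 (b - s * q); have := sqr_ge0 (a - s * q).
  by lra.
have mZ : measurable_fun setT (fun w => T n w - theta) by mea.
have iZ : integ P (fun w => (T n w - theta) ^+ 2).
  by apply: integ_le iB _; [mea|move=> w; rewrite ger0_norm ?sqr_ge0].
apply: le_trans (chebyshev_Rint mZ iZ t0) _; rewrite lee_fin.
rewrite ler_pdivrMr ?exprn_gt0 // exprMn sqr_sqrtr; last by rewrite divr_ge0 ?addr_ge0 ?(ltW e0).
have -> : e * ((C + 1) / e * rho n ^+ 2) = (C + 1) * rho n ^+ 2 by field; rewrite gt_eqF.
apply: le_trans (Rint_le iZ iB le) _.
rewrite (RintD (integD (integ_cst P _) (integZ 3 ir)) (integZ _ (integ_S2 n))).
rewrite (RintD (integ_cst P _) (integZ 3 ir)) Rint_cst (RintZ _ ir) (RintZ _ (integ_S2 n)).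
rewrite (second_moment_sum iX (lawE iid) my yc y0) -/v.
have h1 : bias n ^+ 2 <= D ^+ 2 * rho n ^+ 2.
  by rewrite -exprMn -[leLHS](real_normK (num_real _)) lerXn2r ?nnegrE // mulr_ge0 // ltW.
have h2 : n%:R^-1 ^+ 2 * (n%:R * v) <= v * rho n ^+ 2.
  have -> : n%:R^-1 ^+ 2 * (n%:R * v) = v * n%:R^-1 by field; rewrite gt_eqF.
  by rewrite ler_wpM2l // inv_le_rate2.
have q0 := sqr_ge0 (rho n).
rewrite -(mulrA 3 (n%:R^-1 ^+ 2)).
have -> : (C + 1) * rho n ^+ 2 =
    3 * (D ^+ 2 * rho n ^+ 2) + 3 * (D * rho n ^+ 2) + 3 * (v * rho n ^+ 2) + rho n ^+ 2.
  by rewrite /C; ring.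
rewrite -[leLHS]addr0; apply: lerD => //.
by apply: lerD; [apply: lerD|]; rewrite ler_wpM2l.
Unshelve. all: end_near.
Qed.

Lemma cvg_in_distribution_bounded : 1 / 4 < alpha ->
  cvg_in_distribution P (fun n w => Num.sqrt n%:R * (T_stat X K (h n) n w - theta))
    (gaussian 0 (4 * (\int[leb]_x (f x ^+ 3) - theta ^+ 2))).
Proof.
move=> a4; rewrite -vE; have [D D0 HD] := error_rate.
have mZ n : measurable_fun setT (fun w => Num.sqrt n%:R * (T n w - theta)).
  by have := mT n => ?; mea.
have mW n : measurable_fun setT (fun w => (Num.sqrt n%:R)^-1 * S n w).
  by have := mS n => ?; mea.
(* The difference from the normalised linear sum is [sqrt n] times bias plus remainder, of mean
   square at most a constant times [n] times the squared rate. At [n = 0] the inverse square root is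
   0 by convention, hence the condition. *)
have E n w : (0 < n)%N -> Num.sqrt n%:R * (T n w - theta) - (Num.sqrt n%:R)^-1 * S n w =
    Num.sqrt n%:R * (bias n + rem n w).
  move=> n0; have x0 : 0 < Num.sqrt n%:R :> R by rewrite sqrtr_gt0 ltr0n.
  have nE : n%:R = Num.sqrt n%:R ^+ 2 :> R by rewrite sqr_sqrtr.
  rewrite TE; move: nE x0; set q := Num.sqrt _ => -> x0; field; rewrite gt_eqF //.
have le n w : (Num.sqrt n%:R * (bias n + rem n w)) ^+ 2 <=
    n%:R * (2 * bias n ^+ 2) + n%:R * 2 * rem n w ^+ 2.
  rewrite exprMn sqr_sqrtr // -mulrA -mulrDr ler_wpM2l //.
  by have := sqr_ge0 (bias n - rem n w); lra.
have H : \forall n \near \oo,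
    integ P (fun w => (Num.sqrt n%:R * (T n w - theta) - (Num.sqrt n%:R)^-1 * S n w) ^+ 2) /\
    \int[P]_w ((Num.sqrt n%:R * (T n w - theta) - (Num.sqrt n%:R)^-1 * S n w) ^+ 2) <=
    2 * (D ^+ 2 + D) * (n%:R * rho n ^+ 2).
  near=> n.
  have [hb ir hr] : [/\ `|bias n| <= D * rho n, integ P (fun w => rem n w ^+ 2) &
    \int[P]_w (rem n w ^+ 2) <= D * rho n ^+ 2] by near: n.
  have n0 : (0 < n)%N by near: n; exact: nbhs_infty_gt.
  have x0 : 0 < n%:R :> R by rewrite ltr0n.
  have rho0 := rate_gt0 alpha x0.
  have iB := integD (integ_cst P (n%:R * (2 * bias n ^+ 2))) (integZ (n%:R * 2) ir).
  have mrn := mrem n.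
  have i : integ P (fun w => (Num.sqrt n%:R * (bias n + rem n w)) ^+ 2).
    by apply: integ_le iB _; [mea|move=> w; rewrite ger0_norm ?sqr_ge0].
  split; first by apply: integ_eq i => w; rewrite E.
  under eq_Rintegral do rewrite E //.
  apply: le_trans (Rint_le i iB (le n)) _.
  rewrite (RintD (integ_cst P _) (integZ _ ir)) Rint_cst (RintZ _ ir).
  have h1 : bias n ^+ 2 <= D ^+ 2 * rho n ^+ 2.
    by rewrite -exprMn -[leLHS](real_normK (num_real _)) lerXn2r ?nnegrE // mulr_ge0 // ltW.
  have -> : 2 * (D ^+ 2 + D) * (n%:R * rho n ^+ 2) =
     n%:R * (2 * (D ^+ 2 * rho n ^+ 2)) + n%:R * 2 * (D * rho n ^+ 2) by ring.
  by apply: lerD; [rewrite ler_wpM2l // ler_wpM2l|rewrite ler_wpM2l // mulr_ge0].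
have L1 : 2 * (D ^+ 2 + D) * (n%:R * rho n ^+ 2) @[n --> \oo] --> 0.
  by rewrite -(mulr0 (2 * (D ^+ 2 + D))); apply: cvgM; [exact: cvg_cst|exact: rate2_cvg0].
apply: cvg_in_distribution_cos => // a b.
rewrite gaussian_cos //.
apply: (cos_mean_square_cvg mZ mW).
- by apply: filterS H => n [].
- apply/cvgr0Pnorm_le => e e0; move/cvgrPdist_le : L1 => /(_ e e0).
  apply: filterS2 H => n [_ Hn]; rewrite sub0r normrN => /(le_trans (ler_norm _)); apply: le_trans.
  by rewrite ger0_norm //; apply: Rintegral_ge0 => w _; exact: sqr_ge0.
- exact: (cos_clt iX (lawE iid) my yc y0).
Unshelve. all: end_near.
Qed.

End part_two_bounded.

Theorem theorem1 (R : realType) (K : R -> R) (hK : is_kernel K) :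
  (exists c1 c2 : R -> R,
    forall (alpha r L : R) (h : nat -> R),
      0 < alpha <= 1 / 2 -> 0 < r -> 0 < L -> is_bandwidth h ->
    forall (d : measure_display) (Omega : measurableType d)
      (P : probability Omega R) (X : nat -> {RV P >-> R}) (f : R -> R),
      is_density f -> f \in Lfun leb +oo%E -> iid_with_density X f ->
    forall n : nat, (2 <= n)%N ->
      (sobolev_ball alpha r f ->
        (`| 'E_P[T_stat X K (h n) n] - (int_sq f)%:E |
           <= (c1 r * h n `^ (2 * alpha))%:E)%E) /\
      (sobolev_ball alpha r f -> sup_ball L f ->
        ('E_P[fun w => ((T_stat X K (h n) n w
                         - fine 'E_P[T_stat X K (h n) n]
                         - n%:R^-1 * \sum_(i < n) Y_var X f i w) ^+ 2)%R]
           <= (c2 r ^+ 2 * Num.max (1 / (n%:R ^+ 2 * h n))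
                                   (L * h n `^ (2 * alpha) / n%:R))%:E)%E)) /\
  (forall (alpha : R) (f : R -> R) (h : nat -> R)
      (d : measure_display) (Omega : measurableType d)
      (P : probability Omega R) (X : nat -> {RV P >-> R}),
      0 < alpha <= 1 / 2 ->
      is_density f -> sobolev alpha f -> f \in Lfun leb +oo%E ->
      iid_with_density X f ->
      is_bandwidth h ->
      same_order h (fun n => n%:R `^ (- (2 / (4 * alpha + 1)))) ->
    (alpha <= 1 / 4 ->
      bigO_P P (fun n w => T_stat X K (h n) n w - int_sq f)
               (fun n => n%:R `^ (- (4 * alpha / (4 * alpha + 1))))) /\
    (1 / 4 < alpha ->
      let tau2 := \int[leb]_x (f x ^+ 3) - int_sq f ^+ 2 in
      cvg_in_distribution P
        (fun n w => Num.sqrt n%:R * (T_stat X K (h n) n w - int_sq f))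
        (gaussian 0 (4 * tau2)))).
Proof.
have [MK KM] : exists MK : R, forall u, `|K u| <= MK by case: hK.
split.
  (* The second constant is squared in the claim, hence the root. The bound [MK] was chosen from [K]
     alone, before all other data. *)
  exists (bias_cst K), (fun r => r * Num.sqrt (var_cst K MK)).
  move=> alpha r L h ha /ltW r0 L0 [h0 _] d Omega P X f df fy iid n n2; split.
    by move=> [_ hN]; exact: (bias_bound_ereal hK KM ha r0 (h0 n) hN df iid n2 fy).
  move=> [_ hN] hL; rewrite exprMn sqr_sqrtr ?(var_cst_ge0 KM) //.
  exact: (remainder_bound_ereal hK KM ha r0 (h0 n) hN df iid n2 L0 hL).
move=> alpha f h d Omega P X ha df sf fy iid [h0 _] hn.
(* With [f] fixed, an essential bound of [f] serves as [L] and its own Sobolev norm as the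
   radius. *)
have [mf f0 _] := df; have [L [L0 fL]] := Lfun_bounded f0 fy.
have [_ fin] := sf; have N0 : (0 <= sobolev_norm alpha f)%E by exact: Lnorm_ge0.
have hN : (sobolev_norm alpha (trunc f L) <= (fine (sobolev_norm alpha f))%:E)%E.
  by rewrite (sobolev_norm_trunc df L0 fL) fineK // ge0_fin_numE.
have r0 : 0 <= fine (sobolev_norm alpha f) by exact: fine_ge0.
have mt := measurable_trunc L df.
have E3 : \int[leb]_x (f x ^+ 3) = \int[leb]_x (trunc f L x ^+ 3).
  by rewrite (Rint_trunc fL (G := fun _ y => y ^+ 3)) //; mea.
rewrite /= E3 -(int_sq_trunc df fL); split => a4.
  exact: (bigO_P_bounded hK KM ha r0 h0 hn hN (iid_trunc df fL iid) (integ_trunc df L0)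
    (trunc_ge0 df L0) (@trunc_le _ f L)).
exact: (cvg_in_distribution_bounded hK KM ha r0 h0 hn hN (iid_trunc df fL iid) (integ_trunc df L0)
  (trunc_ge0 df L0) (@trunc_le _ f L)).
Qed.
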